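(* Fix $\alpha\in(0,1)$, $L>1$ and $\lambda^\ast>0$. Let $d=d_n$ be an arbitrary sequence of positive integers, and let $m_1=m_1(n)$, $m_2=n-m_1$ be positive integers with $\kappa_\ast\le m_1/n\le\kappa^\ast$ for some universal constants $0<\kappa_\ast\le\kappa^\ast<1$. Suppose that $\epsilon_n\ge K_n d^{1/4}n^{-1/2}$, where $K_n$ is a positive sequence increasing to infinity at any rate. Then $$\lim_{n\to\infty}\sup_{P\in\mathcal{P}_{0,d}}\mathbb{E}_P[\phi_{\mathrm{mean}}]=\alpha\quad\text{and}\quad\lim_{n\to\infty}\sup_{P\in\mathcal{Q}_{\mathrm{mean},d}(\epsilon_n)}\mathbb{E}_P[1-\phi_{\mathrm{mean}}]=0 .$$ In particular, $p_n=1-\Phi(T_{\mathrm{mean}})$ is a dimension-agnostic $p$-value, i.e. $\limsup_{n\to\infty}\sup_{P\in\mathcal{P}_{0,d_n}}P(p_n\le a)\le a$ for any $a\in[0,1]$, regardless of the sequence $(d_n)_{n\ge1}$.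
   Context: $\Phi$ is the cumulative distribution function of $N(0,1)$ and $z_\beta$ its $\beta$-quantile. $X_1,\dots,X_n$ are i.i.d. from $P$ on $\mathbb{R}^d$. For $\mu\in\mathbb{R}^d$, $\mathcal{P}_{\mu,d}$ is the set of all continuous distributions $P$ on $\mathbb{R}^d$ with mean $\mu$ such that, for $X\sim P$, $$\sup_{u\in\mathbb{S}^{d-1}}\frac{\{\mathbb{E}_P[|u^\top(X-\mu)|^3]\}^{1/3}}{\{\mathbb{E}_P[|u^\top(X-\mu)|^2]\}^{1/2}}\le L^{1/3},$$ where $\mathbb{S}^{d-1}$ is the unit sphere and $L$ is a fixed constant (say $L=2$); $\mathcal{P}_{0,d}$ is this class with $\mu=0$. The alternatives are $$\mathcal{Q}_{\mathrm{mean},d}(\epsilon_n)=\{P\in\mathcal{P}_{\mu,d}:\ \|\mu\|_2\ge\epsilon_n\ \text{and}\ \lambda_{\max}(\Sigma)<\lambda^\ast\},$$ where $\mu$ ranges over $\mathbb{R}^d$ and $\Sigma$ is the covariance matrix of $P$. Let $f_{\mathrm{mean}}(x)=\frac1{m_2}\sum_{j=m_1+1}^{n}X_j^\top x$, $\overline f_{\mathrm{mean}}=\frac1{m_1}\sum_{i=1}^{m_1}f_{\mathrm{mean}}(X_i)$, $$T_{\mathrm{mean}}=\frac{\sqrt{m_1}\,\overline f_{\mathrm{mean}}}{\sqrt{m_1^{-1}\sum_{i=1}^{m_1}\{f_{\mathrm{mean}}(X_i)-\overline f_{\mathrm{mean}}\}^2}},$$ and $\phi_{\mathrm{mean}}=\mathbf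 1(T_{\mathrm{mean}}>z_{1-\alpha})$. *)

(* Defs.v *)
From HB Require Import structures.
From mathcomp Require Import all_boot all_order all_algebra.
From mathcomp Require Import all_classical all_reals all_analysis.
Import Order.TTheory GRing.Theory Num.Theory.
Import numFieldNormedType.Exports.

Set Implicit Arguments.
Unset Strict Implicit.
Unset Printing Implicit Defensive.

Local Open Scope classical_set_scope.
Local Open Scope ring_scope.

Section iid.
Context {d : measure_display} {T : measurableType d} {R : realType}.

Definition cons_pair (n : nat) (x : T * n.-tuple T) : n.+1.-tuple T :=
  [the n.+1.-tuple T of x.1 :: x.2].

Lemma measurable_cons_pair (n : nat) :
  measurable_fun [set: T * n.-tuple T] (@cons_pair n).
Proof. exact: measurable_cons. Qed.

HB.instance Definition _ (n : nat) :=
  isMeasurableFun.Build _ _ _ _ (@cons_pair n) (@measurable_cons_pair n).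

(* The joint law of X_1, ..., X_n i.i.d. from P, i.e. the product measure
   P^n on n.-tuple T (see iid_lawE for its value on rectangles). *)
Fixpoint iid_law (P : probability T R) (n : nat) :
    probability (n.-tuple T) R :=
  match n with
  | 0 => dirac [tuple]
  | n'.+1 => distribution (P \x iid_law P n')%E (@cons_pair n')
  end.

Lemma iid_lawE (P : probability T R) (n : nat) (A : 'I_n -> set T) :
  (forall i, measurable (A i)) ->
  iid_law P n [set x | forall i, A i (tnth x i)] = (\prod_i P (A i))%E.
Proof.
elim: n A => [|n IH] A mA.
  rewrite big_ord0 /= diracE mem_set//; by case.
rewrite big_ord_recl -IH; last by move=> i; exact: mA.
rewrite [LHS]/= /distribution /pushforward/=.
rewrite (_ : _ @^-1` _ = A ord0 `*`
  [set x : n.-tuple T | forall i, A (lift ord0 i) (tnth x i)]); last first.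
  apply/seteqP; split => -[x y] /=.
    move=> h; split; first exact: (h ord0).
    by move=> i; have := h (lift ord0 i); rewrite tnthS.
  move=> [h0 h] i; case: (unliftP ord0 i) => [j ->|->//].
  by rewrite tnthS; exact: h.
rewrite product_measure1E//.
have -> : [set x : n.-tuple T | forall i, A (lift ord0 i) (tnth x i)] =
   \bigcap_(i in [set: 'I_n]) (@tnth _ T ^~ i) @^-1` A (lift ord0 i).
  by apply/seteqP; split => x /= h i; [move=> _|]; exact: h.
apply: fin_bigcap_measurable => // i _; rewrite -[X in measurable X]setTI.
exact: measurable_tnth.
Qed.

End iid.

Section euclidean.
Context {R : realType} {d : nat}.
Implicit Types u v x mu : d.-tuple R.

Definition dot u v : R := \sum_(i < d) tnth u i * tnth v i.

Definition norm2 u : R := Num.sqrt (dot u u).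

Definition sphere : set (d.-tuple R) := [set u | norm2 u = 1].

Definition vec0 : d.-tuple R := [tuple 0 | _ < d].

Definition vsub u v : d.-tuple R := [tuple tnth u i - tnth v i | i < d].

Definition coordinate (i : 'I_d) (x : d.-tuple R) : R := tnth x i.

Definition lambda_max (S : 'M[R]_d) : R := sup [set a | eigenvalue S a].

End euclidean.

Section classes.
Context {R : realType} {d : nat}.

Definition covariance_mx (P : probability (d.-tuple R) R) : 'M[R]_d :=
  \matrix_(i < d, j < d) fine (covariance P (coordinate i) (coordinate j)).

Definition moment_ratio (P : probability (d.-tuple R) R) (mu u : d.-tuple R) :
    \bar R :=
  let f x := (dot u (vsub x mu))%:E in
  ('N[P]_3%:E[f] / 'N[P]_2%:E[f])%E.

(* "Continuous" means that P has no atoms; P need not have a density, and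
   its covariance matrix may be singular (for d >= 2 and L close to 1 no law
   with a nonsingular covariance matrix satisfies the moment bound).  In a
   direction u along which X is degenerate the ratio is 0 / 0 = 0 in \bar R,
   i.e. no constraint is put on u.  Square integrability of the coordinates
   is required for the mean, the covariance and the ratio to be defined. *)
Definition Pclass (L : R) (mu : d.-tuple R) :
    set (probability (d.-tuple R) R) :=
  [set P : probability (d.-tuple R) R | [/\ forall x, P [set x] = 0%E,
     forall i, coordinate i \in Lfun P 2%:E,
     forall i, 'E_P[coordinate i]%E = (tnth mu i)%:E &
     (ereal_sup [set moment_ratio P mu u | u in sphere]
        <= (L `^ 3^-1)%:E)%E]].

Definition Qclass (L lstar eps : R) : set (probability (d.-tuple R) R) :=
  [set P : probability (d.-tuple R) R | exists mu : d.-tuple R, [/\ Pclass L mu P,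
     eps <= norm2 mu & lambda_max (covariance_mx P) < lstar]].

End classes.

Section normal.
Context {R : realType}.

Definition Phi (x : R) : R := fine (normal_prob 0 1 `]-oo, x]).

Definition zquantile (beta : R) : R := inf [set x | beta <= Phi x].

End normal.

(* The sample is indexed from 0: the first block is i < m1 and the second
   block, of size n - m1, is m1 <= j < n. *)
Section test.
Context {R : realType} {d n : nat}.
Variable m1 : nat.
Implicit Type X : n.-tuple (d.-tuple R).

Definition f_mean X (x : d.-tuple R) : R :=
  (n - m1)%:R^-1 * \sum_(j < n | (m1 <= j)%N) dot (tnth X j) x.

Definition fbar_mean X : R :=
  m1%:R^-1 * \sum_(i < n | (i < m1)%N) f_mean X (tnth X i).

Definition T_mean X : R :=
  Num.sqrt m1%:R * fbar_mean X /
  Num.sqrt (m1%:R^-1 *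
    \sum_(i < n | (i < m1)%N) (f_mean X (tnth X i) - fbar_mean X) ^+ 2).

Definition phi_mean (alpha : R) : n.-tuple (d.-tuple R) -> R :=
  \1_[set X | zquantile (1 - alpha) < T_mean X].

Definition p_mean X : R := 1 - Phi (T_mean X).

End test.

(* Main.v *)
From HB Require Import structures.
Require Import Defs.
From mathcomp Require Import all_boot all_order all_algebra.
From mathcomp Require Import all_classical all_reals all_analysis.
From mathcomp Require Import measurable_realfun normal_distribution.
From mathcomp Require Import ring lra.
Import Order.TTheory GRing.Theory Num.Theory.
Import numFieldNormedType.Exports.

Set Implicit Arguments.
Unset Strict Implicit.
Unset Printing Implicit Defensive.

Local Open Scope classical_set_scope.
Local Open Scope ring_scope.

(** Write v for the mean of the second block of the sample, k for the length
    of that block and m for the length of the first one.  Given the second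
    block, [T_mean] is the studentized mean of the m i.i.d. real variables
    v.X_i ([T_mean_cat]); everything is therefore one-dimensional once the
    second block is fixed, and this is why the dimension disappears.

    Level.  Let P have mean mu and let q(w) be the second moment of
    w.(X - mu).  If q(w) > 0, the moment condition of the class says that
    w.(X - mu) / sqrt q(w), which has mean 0 and variance 1, has third
    absolute moment at most L, whatever w and d ([Pclass_standardized]).  So
    it is enough to have a central limit theorem for studentized means which
    is uniform over all such variables ([uniform_studentized_clt]) and to
    integrate it over the second block ([split_conditional_le]).  The
    exceptional event q(v) = 0 is null: P has no atoms, while the solutions x
    of q(x + s) = 0 lie in a single coset of the kernel of the covariance, and
    such a coset contains at most one point outside a P-null set
    ([degenerate_shift_null]).

    The central limit theorem is obtained by replacing the summands one at a
    time by Gaussian ones ([lindeberg]).  The indicator of a half-line is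
    sandwiched between piecewise cubic functions, for which the Taylor
    inequality with a cubic remainder is plain algebra ([smooth_step_taylor]);
    the first two moments of the summands agree with those of the Gaussian,
    so each replacement costs O(n^(-3/2)).  The sample variance is within
    delta of 1 with high probability, uniformly, by truncating the squares
    ([svar_concentration]).

    Power.  Given the second block the statistic is (b + sqrt m W) / S with W
    and S the sample mean and deviation of a standardized variable and
    b = sqrt m (v.mu) / sqrt q(v); it falls below a fixed z with small
    probability as soon as b exceeds a constant B ([uniform_shifted_power]).
    The event b < B is controlled by second moments ([weak_signal_bound]):
    v.mu has mean |mu|^2 and variance at most lambda |mu|^2 / k, while
    q(v) <= 2 q(mu) + 2 q(v - mu), with q(mu) <= lambda |mu|^2 and
    E q(v - mu) <= lambda^2 d / k, where lambda bounds the largest eigenvalue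
    of the covariance ([rayleigh_bound]).  When |mu|^2 >= K^2 sqrt d / n all
    the terms are O(K^(-2)) ([weak_signal_rate]).

    The supremum over an empty class would be -oo, so the two limits also need
    an element of each class ([Pclass0_nonempty], [Qclass_nonempty]).  For the
    p-value, p <= a forces the statistic beyond the (1 - a')-quantile for any
    a' > a, so the level statement applies at a' ([p_mean_null_level]). *)

(** * Integrable real functions under a probability *)

Ltac mfun := repeat first
  [ exact: measurable_cst | exact: measurable_id | assumption
  | exact: measurable_tnth
  | exact: normr_measurable
  | apply: (proj2 (measurable_EFinP _ _))
  | apply: measurable_funB | apply: measurable_funD | apply: measurable_funM
  | apply: measurable_funX
  | apply: (measurableT_comp (@measurable_expR _))
  | apply: (measurableT_comp (@normr_measurable _ setT)) ].

Notation rintegrable P f := (integrable P setT (EFin \o f)).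

Section rintegrable.
Context {R : realType} d {T : measurableType d} (P : probability T R).
Implicit Types f g : T -> R.

Lemma rintegrable_cst (c : R) : rintegrable P (fun=> c).
Proof. exact: finite_measure_integrable_cst. Qed.

Lemma rintegrableD f g : rintegrable P f -> rintegrable P g ->
  rintegrable P (fun t => f t + g t).
Proof. by move=> /(integrableD measurableT)/[apply]. Qed.

Lemma rintegrableB f g : rintegrable P f -> rintegrable P g ->
  rintegrable P (fun t => f t - g t).
Proof. by move=> /(integrableB measurableT)/[apply]. Qed.

Lemma rintegrableZ (c : R) f : rintegrable P f ->
  rintegrable P (fun t => c * f t).
Proof. by move=> /(integrableZl measurableT c). Qed.

Lemma rintegrable_measurable f : rintegrable P f -> measurable_fun setT f.
Proof. by move=> /measurable_int/measurable_EFinP. Qed.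

Lemma rintegrable_le f g : measurable_fun setT f ->
  (forall t, `|f t| <= g t) -> rintegrable P g -> rintegrable P f.
Proof.
move=> mf fg; apply: le_integrable => //; first exact/measurable_EFinP.
by move=> t _ /=; rewrite lee_fin (le_trans (fg t))// ler_norm.
Qed.

Lemma rintegrable_bounded (M : R) f : measurable_fun setT f ->
  (forall t, `|f t| <= M) -> rintegrable P f.
Proof.
by move=> mf fM; apply: (rintegrable_le mf fM); exact: rintegrable_cst.
Qed.

Lemma rintegrable_ge0 f : measurable_fun setT f -> (forall t, 0 <= f t) ->
  (\int[P]_t (f t)%:E < +oo)%E -> rintegrable P f.
Proof.
move=> mf f0 foo; apply/integrableP; split; first exact/measurable_EFinP.
by under eq_integral do rewrite gee0_abs ?lee_fin//.
Qed.

Lemma fineK_rintegrable f : rintegrable P f ->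
  (\int[P]_t f t)%:E = (\int[P]_t (f t)%:E)%E.
Proof. by move=> intf; rewrite fineK// integrable_fin_num. Qed.

Lemma Rintegral_prob_cst (c : R) : \int[P]_t c = c.
Proof. by rewrite Rintegral_cst//= probability_setT mulr1. Qed.

End rintegrable.

Lemma measurable_gt_set {R : realType} d (T : measurableType d) (F : T -> R) z :
  measurable_fun setT F -> measurable [set X | z < F X].
Proof.
move=> mF; rewrite (_ : [set _ | _] = F @^-1` `]z, +oo[).
  by rewrite -[X in measurable X]setTI; exact: mF.
by apply/seteqP; split => x; rewrite /= in_itv/= andbT.
Qed.

Lemma measurable_ge_set {R : realType} d (T : measurableType d) (F : T -> R) z :
  measurable_fun setT F -> measurable [set X | z <= F X].
Proof.
move=> mF; rewrite (_ : [set _ | _] = F @^-1` `[z, +oo[).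
  by rewrite -[X in measurable X]setTI; exact: mF.
by apply/seteqP; split => x; rewrite /= in_itv/= andbT.
Qed.

Lemma measurable_le_set {R : realType} d (T : measurableType d) (F : T -> R) z :
  measurable_fun setT F -> measurable [set X | F X <= z].
Proof.
move=> mF; rewrite (_ : [set _ | _] = F @^-1` `]-oo, z]).
  by rewrite -[X in measurable X]setTI; exact: mF.
by apply/seteqP; split => x; rewrite /= in_itv.
Qed.

(** * Gaussian integrals and convolution *)

(** The normal law is given by its values on sets; the Radon-Nikodym derivative
    agrees almost everywhere with the density because both have the same
    integral over every measurable set. *)
Lemma integral_normal_prob {R : realType} (s : R) (f : _ -> \bar R) :
  measurable_fun setT f -> (forall x, (0 <= f x)%E) ->
  (\int[normal_prob 0 s]_x f x =
   \int[lebesgue_measure]_x (f x * (normal_pdf 0 s x)%:E))%E.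
Proof.
move=> mf f0.
have dom := normal_prob_dominates 0 s.
rewrite -(Radon_Nikodym_SigmaFinite.change_of_variables dom)//.
apply: ae_eq_integral => //.
- apply: emeasurable_funM => //; apply: (measurable_int lebesgue_measure).
  exact: Radon_Nikodym_SigmaFinite.f_integrable.
- apply: emeasurable_funM => //=; apply/measurable_EFinP.
  exact: measurable_normal_pdf.
- apply: ae_eqe_mul2l => /=.
  apply: integral_ae_eq => //=.
  + exact: Radon_Nikodym_SigmaFinite.f_integrable.
  + by apply/measurable_EFinP; exact: measurable_normal_pdf.
  + by move=> E E01 mE; rewrite -Radon_Nikodym_SigmaFinite.f_integral.
Qed.

Lemma integral_affine {R : realType} (f : R -> R) (a b : R) : 0 < a ->
  continuous f -> (forall x, 0 <= f x) ->
  (\int[lebesgue_measure]_x (f x)%:E =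
   \int[lebesgue_measure]_x (f (a * x + b) * a)%:E)%E.
Proof.
move=> a0 cf f0.
have Fd : ((fun x : R => a * x + b)^`())%classic = cst a.
  apply/funext => x; rewrite derive1E deriveD// derive_cst addr0.
  by rewrite deriveM// derive_cst derive_id scaler0 addr0 scaler1.
rewrite (@increasing_ge0_integration_by_substitutionT _ (fun x => a * x + b))//.
- by apply: eq_integral => x _; rewrite Fd.
- by move=> x y xy; rewrite ltrD2r ltr_pM2l.
- by rewrite Fd => x; exact: cvg_cst.
- by rewrite Fd; exact: is_cvg_cst.
- by rewrite Fd; exact: is_cvg_cst.
- have -> : (fun x : R => a * x + b) = (fun x => x + b) \o (fun x => x * a).
    by apply/funext => x /=; rewrite mulrC.
  apply: cvg_comp; last exact: cvg_addrr_Ny.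
  by apply: gt0_cvgMlNy => //; exact: cvg_id.
- have -> : (fun x : R => a * x + b) = (fun x => x + b) \o (fun x => x * a).
    by apply/funext => x /=; rewrite mulrC.
  apply: cvg_comp; last exact: cvg_addrr.
  by apply: gt0_cvgMly => //; exact: cvg_id.
Qed.

Lemma normal_pdf_pos {R : realType} (m s x : R) : 0 < s ->
  normal_pdf m s x =
  s^-1 * (Num.sqrt (pi *+ 2))^-1 * expR (- ((x - m) ^+ 2 / (s ^+ 2 * 2))).
Proof.
move=> s0; rewrite normal_pdfE ?gt_eqF// /normal_peak /normal_fun.
rewrite mulNr -[s ^+ 2 *+ 2]mulr_natr; congr (_ * _).
by rewrite -mulrnAr sqrtrM ?sqr_ge0// sqrtr_sqr gtr0_norm// invfM.
Qed.

Lemma integral_normal_scale {R : realType} (f : R -> R) (s : R) : 0 < s ->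
  continuous f -> (forall x, 0 <= f x) ->
  (\int[normal_prob 0 s]_x (f x)%:E = \int[normal_prob 0 1]_x (f (s * x))%:E)%E.
Proof.
move=> s0 cf f0.
have mf : measurable_fun setT f by exact: continuous_measurable_fun.
rewrite integral_normal_prob; last 2 first.
- exact/measurable_EFinP.
- by move=> x; rewrite lee_fin.
rewrite integral_normal_prob; last 2 first.
- by apply/measurable_EFinP; apply: (measurableT_comp mf); exact: measurable_funM.
- by move=> x; rewrite lee_fin.
under eq_integral do rewrite -EFinM.
rewrite (integral_affine 0 s0); first last.
- by move=> x; rewrite mulr_ge0// normal_pdf_ge0.
- move=> x; apply: cvgM; first exact: cf.
  by apply: continuous_normal_pdf; rewrite gt_eqF.
apply: eq_integral => x _; rewrite -EFinM; congr EFin.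
rewrite !normal_pdf_pos// addr0 !subr0 expr1n invr1 !mul1r.
have -> : (s * x) ^+ 2 / (s ^+ 2 * 2) = x ^+ 2 / 2.
  by field; rewrite gt_eqF.
by set w := (Num.sqrt _)^-1; field; rewrite gt_eqF.
Qed.

(** Completing the square: the product of two centred Gaussian densities at
    u - y and y is the density of their convolution at u times a Gaussian
    density in y, so that integrating y out is immediate. *)
Lemma normal_pdf_conv {R : realType} (s t u y : R) : 0 < s -> 0 < t ->
  let r := Num.sqrt (s ^+ 2 + t ^+ 2) in
  normal_pdf 0 s (u - y) * normal_pdf 0 t y =
  normal_pdf 0 r u * normal_pdf (u * t ^+ 2 / r ^+ 2) (s * t / r) y.
Proof.
move=> s0 t0 r.
have r2 : r ^+ 2 = s ^+ 2 + t ^+ 2.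
  by rewrite sqr_sqrtr// addr_ge0// sqr_ge0.
have st0 : 0 < s ^+ 2 + t ^+ 2 by rewrite addr_gt0// exprn_gt0.
have r0 : 0 < r by rewrite sqrtr_gt0.
rewrite !normal_pdf_pos ?divr_gt0 ?mulr_gt0// !subr0.
set w := (Num.sqrt _)^-1.
rewrite mulrACA -expRD [RHS]mulrACA -expRD; congr (_ * expR _).
  by field; rewrite !gt_eqF.
rewrite -!opprD; congr (- _).
rewrite [(s * t / r) ^+ 2]exprMn exprVn r2.
by field; rewrite !gt_eqF.
Qed.

(** Tonelli, after the translation x = u - y, reduces the double integral to
    [normal_pdf_conv].  Stating it for a nonnegative continuous g is enough:
    it is only applied to smooth steps. *)
Lemma integral_normal_conv {R : realType} (g : R -> R) (s t z : R) :
  0 < s -> 0 < t -> continuous g -> (forall x, 0 <= g x) ->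
  (\int[normal_prob 0 t]_y \int[normal_prob 0 s]_x (g (z + y + x))%:E =
   \int[normal_prob 0 (Num.sqrt (s ^+ 2 + t ^+ 2))]_u (g (z + u))%:E)%E.
Proof.
move=> s0 t0 cg g0.
have mg : measurable_fun setT g by exact: continuous_measurable_fun.
have r0 : 0 < Num.sqrt (s ^+ 2 + t ^+ 2).
  by rewrite sqrtr_gt0 addr_gt0// exprn_gt0.
pose F (p : measurableTypeR R * measurableTypeR R) : \bar R :=
  (g (z + p.2) * normal_pdf 0 s (p.2 - p.1))%:E.
have mF : measurable_fun setT F.
  apply/measurable_EFinP; apply: measurable_funM.
    apply: (measurableT_comp mg); exact: measurable_funD.
  apply: (measurableT_comp (measurable_normal_pdf 0 s)).
  exact: measurable_funB.
have F0 p : (0 <= F p)%E by rewrite lee_fin mulr_ge0 ?normal_pdf_ge0.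
have inner (y : R) : (\int[normal_prob 0 s]_x (g (z + y + x))%:E =
    \int[lebesgue_measure]_u F (y, u))%E.
  rewrite integral_normal_prob; last 2 first.
  - apply/measurable_EFinP; apply: (measurableT_comp mg); exact: measurable_funD.
  - by move=> x; rewrite lee_fin.
  under eq_integral do rewrite -EFinM.
  rewrite (@integral_affine _ _ 1 (- y))//; first last.
  - by move=> x; rewrite mulr_ge0// normal_pdf_ge0.
  - move=> x; apply: cvgM.
      apply: (cvg_comp (fun x => z + y + x) g); last exact: cg.
      by apply: cvgD; [exact: cvg_cst|exact: cvg_id].
    by apply: continuous_normal_pdf; rewrite gt_eqF.
  apply: eq_integral => u _; rewrite /F/= mul1r mulr1; congr (g _ * _)%:E.
  by rewrite addrA addrAC addrK.
have mH : measurable_fun setT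
    (fun y : measurableTypeR R => \int[lebesgue_measure]_u F (y, u))%E.
  exact: (measurable_fun_fubini_tonelli_F F).
transitivity (\int[lebesgue_measure]_y
    ((\int[lebesgue_measure]_u F (y, u)) * (normal_pdf 0 t y)%:E))%E.
  under eq_integral do rewrite inner.
  rewrite integral_normal_prob//.
  by move=> y; exact: integral_ge0.
transitivity (\int[lebesgue_measure]_y \int[lebesgue_measure]_u
    (F (y, u) * (normal_pdf 0 t y)%:E))%E.
  apply: eq_integral => y _; rewrite ge0_integralZr//.
  - by apply: (measurableT_comp mF); exact: pair1_measurable.
  - by rewrite lee_fin normal_pdf_ge0.
rewrite (fubini_tonelli (fun p : measurableTypeR R * measurableTypeR R =>
  F p * (normal_pdf 0 t p.1)%:E)%E); last 2 first.
- apply: emeasurable_funM => //; apply/measurable_EFinP.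
  exact: (measurableT_comp (measurable_normal_pdf 0 t)).
- by move=> p; rewrite mule_ge0// lee_fin normal_pdf_ge0.
rewrite integral_normal_prob; last 2 first.
- by apply/measurable_EFinP; apply: (measurableT_comp mg); exact: measurable_funD.
- by move=> x; rewrite lee_fin.
apply: eq_integral => u _.
rewrite /F /=.
under eq_integral => y _.
  rewrite -EFinM -mulrA normal_pdf_conv// mulrA EFinM.
  over.
rewrite ge0_integralZl//; first last.
- by rewrite lee_fin mulr_ge0// normal_pdf_ge0.
- by move=> y _; rewrite lee_fin normal_pdf_ge0.
- by apply/measurable_EFinP; exact: measurable_normal_pdf.
by rewrite integral_normal_pdf mule1 EFinM.
Qed.

(** * Moments of the standard normal law *)

Lemma normal_mgf {R : realType} (h : R) :
  (\int[normal_prob 0 1]_x (expR (h * x))%:E = (expR (h ^+ 2 / 2))%:E)%E.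
Proof.
rewrite integral_normal_prob; last 2 first.
- by apply/measurable_EFinP; apply: measurableT_comp => //; exact: measurable_funM.
- by move=> x; rewrite lee_fin expR_ge0.
transitivity (\int[lebesgue_measure]_x
    ((expR (h ^+ 2 / 2))%:E * (normal_pdf h 1 x)%:E))%E; last first.
  rewrite ge0_integralZl ?integral_normal_pdf ?mule1//.
  - by apply/measurable_EFinP; exact: measurable_normal_pdf.
  - by move=> x _; rewrite lee_fin normal_pdf_ge0.
apply: eq_integral => x _; rewrite -!EFinM !normal_pdf_pos//; congr EFin.
rewrite mulrCA [RHS]mulrCA -!expRD; congr (_ * expR _).
by field.
Qed.

(** Multiplying the density by exp (h x^2 / 2) turns it, up to the factor s,
    into the density with standard deviation s = (1 - h)^(-1/2). *)
Lemma normal_mgf_sqr {R : realType} (h : R) : h < 1 ->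
  (\int[normal_prob 0 1]_x (expR (h * x ^+ 2 / 2))%:E =
   ((Num.sqrt (1 - h))^-1)%:E)%E.
Proof.
move=> h1; have h0 : 0 < 1 - h by rewrite subr_gt0.
set s := (Num.sqrt (1 - h))^-1.
have s0 : 0 < s by rewrite invr_gt0 sqrtr_gt0.
have s2 : s ^+ 2 = (1 - h)^-1 by rewrite exprVn sqr_sqrtr// ltW.
rewrite integral_normal_prob; last 2 first.
- apply/measurable_EFinP; apply: measurableT_comp => //.
  apply: measurable_funM => //; apply: measurable_funM => //.
- by move=> x; rewrite lee_fin expR_ge0.
transitivity (\int[lebesgue_measure]_x (s%:E * (normal_pdf 0 s x)%:E))%E; last first.
  rewrite ge0_integralZl ?integral_normal_pdf ?mule1//.
  - by apply/measurable_EFinP; exact: measurable_normal_pdf.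
  - by move=> x _; rewrite lee_fin normal_pdf_ge0.
  - by rewrite lee_fin ltW.
apply: eq_integral => x _; rewrite -!EFinM !normal_pdf_pos//; congr EFin.
rewrite mulrCA -expRD !mulrA mulfV ?gt_eqF// mul1r invr1 mul1r; congr (_ * expR _).
rewrite s2 subr0 expr1n.
by field; rewrite gt_eqF.
Qed.

(** Any finite bound would do: |x|^3 is dominated by 16 exp (x^2 / 4), which
    has integral 16 sqrt 2. *)
Lemma normal_moment3 {R : realType} :
  (\int[normal_prob 0 1]_x (`|x| ^+ 3)%:E <= (32 : R)%:E)%E.
Proof.
apply: (@le_trans _ _
  (\int[normal_prob 0 1]_x (16%:E * (expR (2^-1 * x ^+ 2 / 2))%:E))%E).
  apply: ge0_le_integral => //=.
  - by mfun.
  - by apply: emeasurable_funM => //; mfun.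
  - move=> x _; rewrite -EFinM lee_fin.
    (* with y = |x| / 4, exp (x^2 / 4) = exp (2 y^2)^2 >= (1 + 2 y^2)^2, which
       dominates 4 y^3 = |x|^3 / 16 *)
    have -> : 2^-1 * x ^+ 2 / 2 = (`|x| / 4) ^+ 2 + (`|x| / 4) ^+ 2 *+ 3.
      by rewrite -(ger0_norm (sqr_ge0 x)) normrX; field.
    set y := `|x| / 4; have -> : `|x| = 4 * y by rewrite /y; field.
    have y0 : 0 <= y by rewrite /y divr_ge0.
    rewrite (_ : _ + _ *+ 3 = 2 * y ^+ 2 + 2 * y ^+ 2); last by ring.
    rewrite expRD; have := expR_ge1Dx (2 * y ^+ 2).
    set e := expR _ => he.
    have : (1 + 2 * y ^+ 2) * (1 + 2 * y ^+ 2) <= e * e.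
      by apply: ler_pM => //; nra.
    nra.
rewrite ge0_integralZl//; last by mfun.
rewrite normal_mgf_sqr ?invf_lt1 ?ltr1n// -EFinM lee_fin.
rewrite (_ : 32 = 16 * 2); last by ring.
rewrite ler_pM2l// invf_ple ?posrE// ?sqrtr_gt0; last lra.
apply: (@le_trans _ _ (Num.sqrt ((2^-1) ^+ 2))); first by rewrite sqrtr_sqr ger0_norm.
have -> : (2^-1) ^+ 2 = 4^-1 :> R by field.
by apply: ler_wsqrtr; lra.
Qed.

Lemma integrable_le_moment3 {R : realType} d (T : measurableType d)
    (P : probability T R) (Y f : T -> R) (a b : R) :
  measurable_fun setT Y -> measurable_fun setT f ->
  (\int[P]_t (`|Y t| ^+ 3)%:E < +oo)%E ->
  (forall t, `|f t| <= a + b * `|Y t| ^+ 3) -> 0 <= a -> 0 <= b ->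
  P.-integrable setT (EFin \o f).
Proof.
move=> mY mf Y3 fab a0 b0; apply/integrableP; split; first exact/measurable_EFinP.
apply: (@le_lt_trans _ _ (\int[P]_t (a%:E + b%:E * (`|Y t| ^+ 3)%:E))%E).
  apply: ge0_le_integral => //=.
  - by mfun.
  - by rewrite -/(measurable_fun _ _); mfun.
  - by move=> t _; rewrite -EFinM -EFinD lee_fin.
rewrite ge0_integralD//; last first.
- by mfun.
- by move=> t _; rewrite -EFinM lee_fin mulr_ge0// exprn_ge0.
rewrite ge0_integralZl//; last first.
- by mfun.
rewrite integral_cst//= probability_setT mule1 lte_add_pinfty ?ltry//.
by rewrite lte_mul_pinfty.
Qed.

Lemma norm_le_cube {R : realType} (t : R) :
  `|t| <= 1 + 1 * `|t| ^+ 3 /\ `|t| ^+ 2 <= 1 + 1 * `|t| ^+ 3.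
Proof.
have := normr_ge0 t; move: `|t| => x x0.
have : 0 <= (x - 1) ^+ 2 * (x + 1) by rewrite mulr_ge0 ?sqr_ge0 ?addr_ge0.
have := sqr_ge0 x.
split; nra.
Qed.

Section normal_moments.
Context {R : realType}.
Local Notation N := (normal_prob (0:R) 1).

Lemma normal_integrable (f : _ -> R) (a b : R) : measurable_fun setT f ->
  (forall t : R, `|f t| <= a + b * `|t| ^+ 3) -> 0 <= a -> 0 <= b ->
  N.-integrable setT (EFin \o f).
Proof.
move=> mf fab a0 b0; apply: (@integrable_le_moment3 R _ _ N (fun x => x) f a b) => //.
by apply: (le_lt_trans normal_moment3); exact: ltry.
Qed.

Lemma normal_integrable_id : N.-integrable setT (EFin \o (fun x => x)).
Proof.
apply: (@normal_integrable _ 1 1) => // t.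
exact: (norm_le_cube t).1.
Qed.

Lemma normal_integrable_sqr : N.-integrable setT (EFin \o (fun x => x ^+ 2)).
Proof.
apply: (@normal_integrable _ 1 1) => //.
by move=> t; rewrite normrX; exact: (norm_le_cube t).2.
Qed.

(** The form in which the moments are read off generating functions: a bound
    m <= h K for all small h forces m <= 0. *)
Lemma tangent_le0 (m K : R) : 0 <= K ->
  (forall h, 0 < h < 1 -> m <= h * K) -> m <= 0.
Proof.
move=> K0 H; rewrite leNgt; apply/negP => m0.
have Km : 0 < 1 + K + m by lra.
have /H : 0 < m / (2 * (1 + K + m)) < 1.
  by rewrite divr_gt0 ?mulr_gt0//= ltr_pdivrMr ?mulr_gt0//; lra.
rewrite mulrAC ler_pdivlMr ?mulr_gt0//.
rewrite (_ : m * (2 * _) = m * K + m * (K + 2 + 2 * m)); last by ring.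
rewrite gerDl leNgt => /negP; apply.
by rewrite mulr_gt0//; lra.
Qed.

(** Since exp (h x) >= 1 + h x, the moment generating function gives
    1 + h m <= exp (h^2 / 2) for every h; comparing slopes at h = 0 from both
    sides gives m = 0, without integrating by parts. *)
Lemma normal_mean : \int[N]_x x = 0.
Proof.
set m := Rintegral _ _ _.
(* exp (h^2 / 2) <= 1 / (1 - h^2 / 2) makes the comparison algebraic *)
have key h : h ^+ 2 < 2 -> (1 + h * m) * (1 - h ^+ 2 / 2) <= 1.
  move=> h2.
  have le1 : 1 + h * m <= expR (h ^+ 2 / 2).
    have -> : expR (h ^+ 2 / 2) = \int[N]_x expR (h * x).
      by rewrite /Rintegral normal_mgf.
    have ihx : rintegrable N (fun x => h * x).
      by apply: rintegrableZ; exact: normal_integrable_id.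
    have -> : 1 + h * m = \int[N]_x (1 + h * x).
      rewrite RintegralD ?Rintegral_prob_cst//; last exact: rintegrable_cst.
      by rewrite RintegralZl//; exact: normal_integrable_id.
    apply: le_Rintegral => //.
    - by apply: rintegrableD => //; exact: rintegrable_cst.
    - apply: rintegrable_ge0; first by mfun.
        by move=> x; exact: expR_ge0.
      by rewrite normal_mgf ltry.
    - by move=> x _; exact: expR_ge1Dx.
  have h20 : 0 <= 1 - h ^+ 2 / 2 by lra.
  apply: (@le_trans _ _ (expR (h ^+ 2 / 2) * (1 - h ^+ 2 / 2))).
    by rewrite ler_wpM2r.
  rewrite mulrC -ler_pdivlMr ?expR_gt0// div1r -expRN.
  exact: expR_ge1Dx.
have bound (s : R) : s = 1 \/ s = -1 -> s * m <= 0.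
  move=> s1; apply: (@tangent_le0 _ (1 + `|m|)); first by rewrite addr_ge0.
  move=> h /andP[h0 h1]; have hh : h ^+ 2 < 2 by nra.
  have := @key (s * h); rewrite exprMn (_ : s ^+ 2 = 1); last first.
    by case: s1 => ->; rewrite ?sqrrN expr1n.
  rewrite mul1r => /(_ hh).
  have : s * m <= `|m|.
    case: s1 => ->; rewrite ?mul1r ?mulN1r ?ler_norm//.
    by rewrite -normrN ler_norm.
  rewrite -mulrA mulrCA; set b := s * m; set c := `|m| => bc H.
  have c0 : 0 <= c := normr_ge0 m.
  have : h * b <= h * (h / 2 * (1 + h * b)) by nra.
  rewrite ler_pM2l// => /le_trans; apply.
  have : h * b <= c by nra.
  by nra.
apply/eqP; rewrite eq_le.
have := bound 1 (or_introl erefl); rewrite mul1r => ->.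
by have := bound (-1) (or_intror erefl); rewrite mulN1r oppr_le0.
Qed.

(** The same comparison of slopes at h = 0, now in
    1 + h c / 2 <= E exp (h x^2 / 2) = (1 - h)^(-1/2). *)
Lemma normal_variance : \int[N]_x (x ^+ 2) = 1.
Proof.
set c := Rintegral _ _ _.
have c0 : 0 <= c by apply: Rintegral_ge0 => x _; exact: sqr_ge0.
have key h : h < 1 -> 0 <= 1 + h * c / 2 ->
    (1 + h * c / 2) ^+ 2 * (1 - h) <= 1.
  move=> h1 hc0.
  have le1 : 1 + h * c / 2 <= (Num.sqrt (1 - h))^-1.
    have -> : (Num.sqrt (1 - h))^-1 = \int[N]_x expR (h * x ^+ 2 / 2).
      by rewrite /Rintegral normal_mgf_sqr.
    have ihx : rintegrable N (fun x => (h / 2) * x ^+ 2).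
      by apply: rintegrableZ; exact: normal_integrable_sqr.
    have -> : 1 + h * c / 2 = \int[N]_x (1 + (h / 2) * x ^+ 2).
      rewrite RintegralD ?Rintegral_prob_cst//; last exact: rintegrable_cst.
      by rewrite RintegralZl//; [rewrite mulrAC|exact: normal_integrable_sqr].
    apply: le_Rintegral => //.
    - by apply: rintegrableD => //; exact: rintegrable_cst.
    - apply: rintegrable_ge0; first by mfun.
        by move=> x; exact: expR_ge0.
      by rewrite normal_mgf_sqr ?ltry.
    - by move=> x _; rewrite mulrAC; exact: expR_ge1Dx.
  have h0 : 0 < 1 - h by lra.
  rewrite -ler_pdivlMr// div1r.
  have -> : (1 - h)^-1 = (Num.sqrt (1 - h))^-1 ^+ 2.
    by rewrite exprVn sqr_sqrtr// ltW.
  by rewrite lerXn2r// nnegrE invr_ge0.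
apply/eqP; rewrite eq_le; apply/andP; split.
- rewrite -subr_le0; apply: (@tangent_le0 _ c) => // h /andP[h0 h1].
  have hc : 0 <= h * c by nra.
  have /(key _ h1) : 0 <= 1 + h * c / 2 by lra.
  move=> H.
  have : h * (c - 1) <= h * (h * (c - c ^+ 2 / 4) + h * h * c ^+ 2 / 4) by nra.
  rewrite ler_pM2l// => /le_trans; apply.
  have : h * h * c ^+ 2 <= h * c ^+ 2 by have := sqr_ge0 c; nra.
  nra.
- rewrite -subr_le0; apply: (@tangent_le0 _ c) => // k /andP[k0 k1].
  have [kc|kc] := leP (k * c) 2; last by lra.
  have H1 : - k < 1 by lra.
  have /(key _ H1) : 0 <= 1 + - k * c / 2 by lra.
  move=> H.
  have : k * (1 - c) <= k * (k * (c - c ^+ 2 / 4) - k * k * c ^+ 2 / 4) by nra.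
  rewrite ler_pM2l// => /le_trans; apply.
  have : 0 <= k * k * c ^+ 2 by rewrite !mulr_ge0 ?sqr_ge0// ltW.
  have : 0 <= k * c ^+ 2 by rewrite !mulr_ge0 ?sqr_ge0// ltW.
  nra.
Qed.

End normal_moments.

(** The third moment is bounded in \bar R because finiteness of that integral
    is what makes the first two moments meaningful. *)
Definition standardized {R : realType} d (T : measurableType d)
    (P : probability T R) (L : R) (Y : T -> R) :=
  [/\ measurable_fun setT Y, \int[P]_t Y t = 0, \int[P]_t (Y t ^+ 2) = 1 &
      (\int[P]_t (`|Y t| ^+ 3)%:E <= L%:E)%E].

(** The Gaussian itself is an admissible summand, so that one Taylor estimate
    serves both sides of a replacement. *)
Lemma standardized_normal {R : realType} :
  standardized (normal_prob (0:R) 1) 32 (fun x => x).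
Proof.
split => //; [exact: normal_mean|exact: normal_variance|exact: normal_moment3].
Qed.

Section standardized.
Context {R : realType} d (T : measurableType d).
Variables (P : probability T R) (L : R) (Y : T -> R).
Hypothesis sY : standardized P L Y.

Lemma standardized_integrable (f : T -> R) (a b : R) :
  measurable_fun setT f -> (forall t, `|f t| <= a + b * `|Y t| ^+ 3) ->
  0 <= a -> 0 <= b -> rintegrable P f.
Proof.
case: sY => mY _ _ Y3 mf fab a0 b0; apply: (integrable_le_moment3 mY mf) fab a0 b0.
exact: le_lt_trans Y3 (ltry _).
Qed.

Lemma standardized_integrable1 : rintegrable P Y.
Proof.
case: sY => mY _ _ _; apply: (@standardized_integrable _ 1 1) => // t.
exact: (norm_le_cube _).1.
Qed.

Lemma standardized_integrable2 : rintegrable P (fun t => Y t ^+ 2).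
Proof.
case: sY => mY _ _ _; apply: (@standardized_integrable _ 1 1) => // [|t].
  by mfun.
by rewrite normrX; exact: (norm_le_cube _).2.
Qed.

Lemma standardized_integrable3 : rintegrable P (fun t => `|Y t| ^+ 3).
Proof.
case: sY => mY _ _ _; apply: (@standardized_integrable _ 0 1) => // [|t].
  by mfun.
by rewrite normrX normr_id add0r mul1r.
Qed.

Lemma standardized_Rmoment3 : \int[P]_t (`|Y t| ^+ 3) <= L.
Proof.
by case: sY => _ _ _; rewrite -(fineK_rintegrable standardized_integrable3) lee_fin.
Qed.

End standardized.

(** * A piecewise cubic smooth step *)

Section spline.
Context {R : realType}.
Implicit Types x y c eta : R.

Definition cubic_plus x : R := Num.max x 0 ^+ 3.

(** A cubic equals its own Taylor polynomial up to y^3 exactly, and truncation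
    at 0 only decreases the remainder; the four cases are the signs of x and
    of x + y. *)
Lemma cubic_plus_taylor x y :
  `|cubic_plus (x + y) - cubic_plus x - 3 * Num.max x 0 ^+ 2 * y
    - 3 * Num.max x 0 * y ^+ 2| <= `|y| ^+ 3.
Proof.
rewrite /cubic_plus.
have y3 : `|y| ^+ 3 = `|y ^+ 3| by rewrite normrX.
have [x0|x0] := leP x 0; have [xy|xy] := leP (x + y) 0.
- by rewrite !expr0n/= !mulr0 !mul0r !subr0 normr0 exprn_ge0.
- have y0 : 0 <= y by lra.
  rewrite !expr0n/= !mulr0 !mul0r !subr0 y3.
  rewrite (ger0_norm (exprn_ge0 3 (ltW xy))) (ger0_norm (exprn_ge0 3 y0)).
  by rewrite lerXn2r ?nnegrE//; lra.
- rewrite expr0n/= sub0r y3.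
  have y0 : y <= 0 by lra.
  rewrite (ler0_norm (_ : y ^+ 3 <= 0)); last first.
    rewrite exprS; have := sqr_ge0 y; nra.
  set d := _ - _; have -> : d = y ^+ 3 - (x + y) ^+ 3 by rewrite /d; ring.
  have h : (x + y) ^+ 3 <= 0 by have := sqr_ge0 (x + y); rewrite exprS; nra.
  have h2 : y ^+ 3 <= (x + y) ^+ 3.
    by rewrite -subr_ge0 (_ : _ - _ = x * ((x + y) ^+ 2 + (x + y) * y + y ^+ 2));
      [apply: mulr_ge0; [exact: ltW|nra]|ring].
  by rewrite ler0_norm; lra.
- by rewrite y3 le_eqVlt (_ : _ - _ = y ^+ 3) ?eqxx//; ring.
Qed.

(** The distribution function of a sum of three independent uniform variables
    on [0, 1]: third difference of the truncated cubic, hence 0 before 0, 1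
    after 3 and piecewise cubic in between. *)
Definition spline x : R :=
  (cubic_plus x - 3 * cubic_plus (x - 1) + 3 * cubic_plus (x - 2)
   - cubic_plus (x - 3)) / 6.

Lemma cubic_plus_pos x : 0 <= x -> cubic_plus x = x ^+ 3.
Proof. by move=> x0; rewrite /cubic_plus max_l. Qed.

Lemma cubic_plus_neg x : x <= 0 -> cubic_plus x = 0.
Proof. by move=> x0; rewrite /cubic_plus max_r// expr0n. Qed.

Lemma spline_le0 x : x <= 0 -> spline x = 0.
Proof. by move=> x0; rewrite /spline !cubic_plus_neg; lra. Qed.

Lemma spline_ge3 x : 3 <= x -> spline x = 1.
Proof.
move=> x3; rewrite /spline !cubic_plus_pos; try lra.
Qed.

Lemma spline_ge0_le1 x : 0 <= spline x <= 1.
Proof.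
have [x0|x0] := leP x 0; first by rewrite spline_le0// lexx ler01.
have [x3|x3] := leP 3 x; first by rewrite spline_ge3// lexx ler01.
have cube (u v : R) : 0 <= u -> u <= v -> u ^+ 3 <= v ^+ 3.
  by move=> u0 uv; rewrite lerXn2r ?nnegrE//; lra.
have [x1|x1] := leP x 1.
  rewrite /spline (@cubic_plus_pos x) ?(ltW x0)// !cubic_plus_neg; try lra.
  have := cube 0 x (lexx _) (ltW x0); have := cube x 1 (ltW x0) x1.
  by rewrite expr1n expr0n/=; lra.
have [x2|x2] := leP x 2.
  rewrite /spline (@cubic_plus_pos x) ?(ltW x0)//.
  rewrite (@cubic_plus_pos (x - 1)); last lra.
  rewrite !cubic_plus_neg; try lra.
  (* with y = x - 1, the cubic is written with visibly nonnegative terms *)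
  set y := x - 1; have -> : x = y + 1 by rewrite /y; lra.
  have y0 : 0 <= y by rewrite /y; lra.
  have y1 : y <= 1 by rewrite /y; lra.
  have h : 0 <= y * (1 - y) by nra.
  have h2 : 0 <= y * (y * (1 - y)) by nra.
  apply/andP; split; rewrite (_ : _ / 6 =
    (1 + 3 * y + 3 * y * (y * (1 - y)) + y ^+ 3) / 6);
    try field; have := cube 0 y (lexx _) y0; have := cube y 1 y0 y1;
    rewrite expr1n expr0n/=; nra.
have -> : spline x = 1 - (3 - x) ^+ 3 / 6.
  rewrite /spline (@cubic_plus_neg (x - 3)); last lra.
  by rewrite !cubic_plus_pos; try lra; field.
have := cube 0 (3 - x) (lexx _); have := cube (3 - x) 1.
by rewrite expr1n expr0n/= => h1 h2; apply/andP; split;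
  have := h1 ltac:(lra) ltac:(lra); have := h2 ltac:(lra); lra.
Qed.

Lemma continuous_spline : continuous spline.
Proof.
have cp0 : continuous cubic_plus.
  move=> x; rewrite /cubic_plus.
  apply: (cvg_comp _ (fun y : R => y ^+ 3)); last exact: exprn_continuous.
  by apply: (@continuous_max _ _ (fun y : R => y) (fun=> 0)); [exact: cvg_id|exact: cvg_cst].
have cp (a : R) : continuous (fun x => cubic_plus (x - a)).
  move=> x; apply: (cvg_comp (fun y : R => y - a) cubic_plus); last exact: cp0.
  by apply: cvgB; [exact: cvg_id|exact: cvg_cst].
move=> x; rewrite /spline; apply: cvgM; last exact: cvg_cst.
apply: cvgB; last exact: cp.
apply: cvgD; last by apply: cvgM; [exact: cvg_cst|exact: cp].
apply: cvgB; last by apply: cvgM; [exact: cvg_cst|exact: cp].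
exact: cp0.
Qed.

Definition smooth_step c eta x := spline ((x - c) / eta).

Lemma smooth_step_ge0_le1 c eta x : 0 <= smooth_step c eta x <= 1.
Proof. exact: spline_ge0_le1. Qed.

Lemma continuous_smooth_step c eta : continuous (smooth_step c eta).
Proof.
move=> x; apply: (cvg_comp _ spline); last exact: continuous_spline.
apply: cvgM; last exact: cvg_cst.
by apply: cvgB; [exact: cvg_id|exact: cvg_cst].
Qed.

(** The coefficients g1 and g2 are the first derivative and half the second
    one; they are left existential because only the size of the remainder
    matters.  The constant is (1 + 3 + 3 + 1) / 6 <= 2. *)
Lemma smooth_step_taylor c eta : 0 < eta -> exists g1 g2 : R -> R,
  forall x y, `|smooth_step c eta (x + y) - smooth_step c eta x
    - g1 x * y - g2 x * y ^+ 2| <= 2 / eta ^+ 3 * `|y| ^+ 3.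
Proof.
move=> eta0; pose q a x := Num.max ((x - c) / eta - a) 0.
exists (fun x => (q 0 x ^+ 2 - 3 * q 1 x ^+ 2 + 3 * q 2 x ^+ 2 - q 3 x ^+ 2) / 2 / eta).
exists (fun x => (q 0 x - 3 * q 1 x + 3 * q 2 x - q 3 x) / 2 / eta ^+ 2) => x y.
set z := (x - c) / eta; set w := y / eta.
have T a := cubic_plus_taylor (z - a) w.
have w3 : 2 / eta ^+ 3 * `|y| ^+ 3 = 2 * `|w| ^+ 3.
  rewrite /w normrM normfV (gtr0_norm eta0) exprMn exprVn; field.
  by rewrite gt_eqF.
rewrite w3 /smooth_step.
have -> : (x + y - c) / eta = z + w by rewrite /z /w; field; rewrite gt_eqF.
rewrite -/z; have -> : y = w * eta by rewrite /w; field; rewrite gt_eqF.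
rewrite /q -/z /spline.
have D a : z + w - a = (z - a) + w by lra.
rewrite !D.
have := T 0; have := T 1; have := T 2; have := T 3.
rewrite !subr0.
set u := `|w| ^+ 3.
set p0 := Num.max z 0; set p1 := Num.max (z - 1) 0.
set p2 := Num.max (z - 2) 0; set p3 := Num.max (z - 3) 0.
set a0 := cubic_plus (z + w); set b0 := cubic_plus z.
set a1 := cubic_plus (z - 1 + w); set b1 := cubic_plus (z - 1).
set a2 := cubic_plus (z - 2 + w); set b2 := cubic_plus (z - 2).
set a3 := cubic_plus (z - 3 + w); set b3 := cubic_plus (z - 3).
set d3 := _ - _; move=> h3; set d2 := _ - _; move=> h2.
set d1 := _ - _; move=> h1; set d0 := _ - _; move=> h0.
rewrite (_ : _ - _ = (d0 - 3 * d1 + 3 * d2 - d3) / 6); last first.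
  by rewrite /d0 /d1 /d2 /d3; field; rewrite gt_eqF.
move: h0 h1 h2 h3; rewrite !ler_norml.
by move=> /andP[? ?] /andP[? ?] /andP[? ?] /andP[? ?]; apply/andP; split; lra.
Qed.

End spline.

(** * Integration against the law of an i.i.d. sample *)

Section iid_integral.
Context {R : realType} d {T : measurableType d} (P : probability T R).
Local Open Scope ereal_scope.

Lemma ge0_integral_iidS n (F : n.+1.-tuple T -> \bar R) :
  measurable_fun setT F -> (forall x, 0 <= F x) ->
  \int[iid_law P n.+1]_x F x =
  \int[P]_a \int[iid_law P n]_x F (cons_pair (a, x)).
Proof.
move=> mF F0; rewrite [LHS]ge0_integral_distribution//.
rewrite (fubini_tonelli1 (F \o @cons_pair _ _ n))//.
- by apply: measurableT_comp => //; exact: measurable_cons_pair.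
- by move=> p; exact: F0.
Qed.

Lemma integral_iid0 (F : 0.-tuple T -> \bar R) :
  measurable_fun setT F -> \int[iid_law P 0]_x F x = F [tuple].
Proof. by move=> mF; rewrite /= integral_dirac// diracT mul1e. Qed.

Definition cat_pair m k (p : m.-tuple T * k.-tuple T) : (m + k).-tuple T :=
  [tuple of p.1 ++ p.2].

Lemma measurable_cat_pair m k : measurable_fun setT (@cat_pair m k).
Proof.
apply/measurable_fun_tnthP => i; case: (split_ordP i) => j ->.
- rewrite (_ : _ \o _ = (fun x => tnth x j) \o fst); last first.
    by apply/funext => p; rewrite /= tnth_lshift.
  by apply: measurableT_comp => //; exact: measurable_tnth.
- rewrite (_ : _ \o _ = (fun x => tnth x j) \o snd); last first.
    by apply/funext => p; rewrite /= tnth_rshift.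
  by apply: measurableT_comp => //; exact: measurable_tnth.
Qed.

(** Independence of the two blocks: the law of m + k observations is the
    product of the laws of the first m and of the last k. *)
Lemma ge0_integral_iidD m k (F : (m + k).-tuple T -> \bar R) :
  measurable_fun setT F -> (forall x, 0 <= F x) ->
  \int[iid_law P (m + k)]_x F x =
  \int[iid_law P k]_y \int[iid_law P m]_x F (cat_pair (x, y)).
Proof.
elim: m F => [|m IH] F mF F0.
  apply: eq_integral => y _; rewrite integral_iid0.
    by congr F; exact/val_inj.
  apply: (measurableT_comp mF); apply: (measurableT_comp (@measurable_cat_pair 0 k)).
  exact: pair2_measurable.
have mcons : measurable_fun setT (@cons_pair _ T (m + k)) by exact: measurable_cons_pair.
rewrite [LHS](@ge0_integral_iidS (m + k) F)//.
transitivity (\int[P]_a \int[iid_law P k]_y \int[iid_law P m]_x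
    F (cons_pair (a, cat_pair (x, y)))).
  apply: eq_integral => a _.
  rewrite (IH (fun x => F (cons_pair (a, x))))//.
  by apply: (measurableT_comp mF); apply: (measurableT_comp mcons); exact: pair1_measurable.
have mG : measurable_fun [set: (T * k.-tuple T) * m.-tuple T]
    (fun q => F (cons_pair (q.1.1, cat_pair (q.2, q.1.2)))).
  apply: (measurableT_comp mF); apply: (measurableT_comp mcons).
  apply: measurable_fun_pair => /=.
    exact: (measurableT_comp measurable_fst).
  apply: (measurableT_comp (@measurable_cat_pair m k)).
  apply: measurable_fun_pair => //=.
  exact: (measurableT_comp measurable_snd).
rewrite (fubini_tonelli (fun p : T * k.-tuple T =>
    \int[iid_law P m]_x F (cons_pair (p.1, cat_pair (x, p.2)))))//; last 2 first.
- exact: (measurable_fun_fubini_tonelli_F _ mG).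
- by move=> p; exact: integral_ge0.
apply: eq_integral => y _.
rewrite ge0_integral_iidS//; last first.
  apply: (measurableT_comp mF); apply: (measurableT_comp (@measurable_cat_pair m.+1 k)).
  exact: pair2_measurable.
apply: eq_integral => a _; apply: eq_integral => x _; congr F.
exact/val_inj.
Qed.

End iid_integral.

(** * Integrals of bounded functions and of i.i.d. sums *)

Section bounded_integral.
Context {R : realType} d {T : measurableType d} (P : probability T R).
Implicit Types f g : T -> R.

Lemma rintegrable01 f : measurable_fun setT f -> (forall t, 0 <= f t <= 1) ->
  rintegrable P f.
Proof.
move=> mf f01; apply: (@rintegrable_bounded _ _ _ _ 1) => // t.
by have /andP[? ?] := f01 t; rewrite ger0_norm.
Qed.

Lemma dist_Rintegral f g (e : R) : rintegrable P f -> rintegrable P g ->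
  (forall t, `|f t - g t| <= e) -> `|\int[P]_t f t - \int[P]_t g t| <= e.
Proof.
move=> intf intg fge; rewrite -RintegralB//.
have intfg := rintegrableB intf intg.
apply: (le_trans (le_normr_Rintegral measurableT intfg)).
rewrite -[leRHS](Rintegral_prob_cst P); apply: le_Rintegral => //.
- exact: integrable_norm.
- exact: rintegrable_cst.
Qed.

Lemma Rintegral01 f : measurable_fun setT f -> (forall t, 0 <= f t <= 1) ->
  0 <= \int[P]_t f t <= 1.
Proof.
move=> mf f01; apply/andP; split.
  by apply: Rintegral_ge0 => t _; case/andP: (f01 t).
rewrite -[leRHS](Rintegral_prob_cst P); apply: le_Rintegral => //.
- exact: rintegrable01.
- exact: rintegrable_cst.
- by move=> t _; case/andP: (f01 t).
Qed.

Lemma Rintegral_indic (A : set T) : measurable A -> \int[P]_t \1_A t = fine (P A).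
Proof. by move=> mA; rewrite /Rintegral integral_indic// setIT. Qed.

End bounded_integral.

Section bounded_fubini.
Context {R : realType} d1 d2 {T1 : measurableType d1} {T2 : measurableType d2}.
Variables (P1 : probability T1 R) (P2 : probability T2 R) (f : T1 * T2 -> R).
Hypotheses (mf : measurable_fun setT f) (f01 : forall p, 0 <= f p <= 1).

Let f0 p : (0 <= (f p)%:E)%E. Proof. by rewrite lee_fin; case/andP: (f01 p). Qed.
Let mEf : measurable_fun setT (EFin \o f). Proof. exact/measurable_EFinP. Qed.

Lemma measurable_Rintegral2 : measurable_fun setT (fun x => \int[P2]_y f (x, y)).
Proof.
apply: (measurableT_comp (@fine_measurable R setT measurableT)).
exact: (measurable_fun_fubini_tonelli_F _ mEf).
Qed.

Lemma fineK_Rintegral2 x : (\int[P2]_y f (x, y))%:E = (\int[P2]_y (f (x, y))%:E)%E.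
Proof.
apply: fineK_rintegrable; apply: rintegrable01 => //.
by apply: (measurableT_comp mf); exact: pair1_measurable.
Qed.

Lemma fineK_Rintegral1 y : (\int[P1]_x f (x, y))%:E = (\int[P1]_x (f (x, y))%:E)%E.
Proof.
apply: fineK_rintegrable; apply: rintegrable01 => //.
by apply: (measurableT_comp mf); exact: pair2_measurable.
Qed.

Lemma Rfubini : \int[P1]_x \int[P2]_y f (x, y) = \int[P2]_y \int[P1]_x f (x, y).
Proof.
rewrite /Rintegral.
rewrite (eq_integral (fun x => \int[P2]_y (f (x, y))%:E)%E); last first.
  by move=> x _; rewrite -fineK_Rintegral2.
rewrite (fubini_tonelli (fun p => (f p)%:E))//; congr fine.
by apply: eq_integral => y _; rewrite -fineK_Rintegral1.
Qed.
End bounded_fubini.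

Section iid_moments.
Context {R : realType} d {T : measurableType d} (P : probability T R).

Lemma cons_pair_tnthS n (a : T) (x : n.-tuple T) i :
  tnth (cons_pair (a, x)) (lift ord0 i) = tnth x i.
Proof. by rewrite tnthS. Qed.

Lemma sum_cons_pair n (f : T -> R) (a : T) (x : n.-tuple T) :
  \sum_(i < n.+1) f (tnth (cons_pair (a, x)) i) = f a + \sum_(i < n) f (tnth x i).
Proof.
rewrite big_ord_recl; congr (_ + _).
by apply: eq_bigr => i _; rewrite cons_pair_tnthS.
Qed.

Lemma measurable_sum_tnth n (f : T -> R) : measurable_fun setT f ->
  measurable_fun setT (fun X : n.-tuple T => \sum_(i < n) f (tnth X i)).
Proof.
move=> mf; apply: measurable_sum => i.
by apply: (measurableT_comp mf); exact: measurable_tnth.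
Qed.

Lemma iid_second_moment n (Y : T -> R) (s a : R) :
  rintegrable P Y -> rintegrable P (fun t => Y t ^+ 2) ->
  \int[P]_t Y t = 0 -> \int[P]_t (Y t ^+ 2) = s ->
  (\int[iid_law P n]_X ((a + \sum_(i < n) Y (tnth X i)) ^+ 2)%:E =
   (a ^+ 2 + n%:R * s)%:E)%E.
Proof.
move=> iY iY2 Y0 Ys.
have mY := rintegrable_measurable iY.
have mF k (b : R) : measurable_fun [set: k.-tuple T]
    (fun X => ((b + \sum_(i < k) Y (tnth X i)) ^+ 2)%:E).
  by mfun; exact: measurable_sum_tnth.
elim: n a => [|n IH] a.
  by rewrite integral_iid0//= big_ord0 addr0 mul0r addr0.
rewrite ge0_integral_iidS//; last by move=> X; rewrite lee_fin sqr_ge0.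
under eq_integral => t _.
  under eq_integral => X _ do rewrite sum_cons_pair addrA.
  rewrite IH; over.
have -> : (\int[P]_t ((a + Y t) ^+ 2 + n%:R * s)%:E)%E =
    (\int[P]_t ((a ^+ 2 + n%:R * s) + (2 * a) * Y t + Y t ^+ 2))%:E.
  rewrite fineK_rintegrable; first by apply: eq_integral => t _; congr EFin; ring.
  apply: rintegrableD => //; apply: rintegrableD; first exact: rintegrable_cst.
  exact: rintegrableZ.
have i1 : rintegrable P (fun t => (2 * a) * Y t) by exact: rintegrableZ.
rewrite RintegralD//; last first.
  by apply: rintegrableD => //; exact: rintegrable_cst.
rewrite RintegralD//; last exact: rintegrable_cst.
rewrite Rintegral_prob_cst RintegralZl// Y0 Ys mulr0 addr0 -addrA.
by rewrite mulrS mulrDl mul1r [s + _]addrC.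
Qed.

Lemma iid_first_moment n (h : T -> R) (c : R) :
  measurable_fun setT h -> (forall t, 0 <= h t) -> 0 <= c ->
  (\int[iid_law P n]_X (c + \sum_(i < n) h (tnth X i))%:E =
   c%:E + n%:R%:E * \int[P]_t (h t)%:E)%E.
Proof.
move=> mh h0 c0.
have mF k (b : R) : measurable_fun [set: k.-tuple T]
    (fun X => (b + \sum_(i < k) h (tnth X i))%:E).
  by mfun; exact: measurable_sum_tnth.
elim: n c c0 => [|n IH] c c0.
  by rewrite integral_iid0//= big_ord0 addr0 mul0e adde0.
rewrite ge0_integral_iidS//; last first.
  by move=> X; rewrite lee_fin addr_ge0// sumr_ge0.
under eq_integral => t _.
  under eq_integral => X _ do rewrite sum_cons_pair addrA.
  rewrite IH ?addr_ge0//; over.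
have I0 : (0 <= \int[P]_t (h t)%:E)%E by apply: integral_ge0 => t _; rewrite lee_fin.
under eq_integral do rewrite EFinD.
rewrite ge0_integralD//; first last.
- by move=> t _; rewrite mule_ge0// lee_fin.
- by mfun.
- by move=> t _; rewrite adde_ge0// lee_fin.
rewrite ge0_integralD//; first last.
- by mfun.
- by move=> t _; rewrite lee_fin.
rewrite !integral_cst//= probability_setT !mule1 -addeA.
by congr (_ + _)%E; rewrite mulrS EFinD ge0_muleDl// ?lee_fin// mul1e.
Qed.

End iid_moments.

(** * The Lindeberg replacement argument *)

Section one_step.
Context {R : realType} d {T : measurableType d} (P : probability T R).
Variables (L : R) (Y : T -> R).
Hypothesis sY : standardized P L Y.
Variables (g g1 g2 : R -> R) (C : R).
Hypotheses (mg : measurable_fun setT g) (g01 : forall x, 0 <= g x <= 1).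
Hypotheses (C0 : 0 <= C)
  (gT : forall x y, `|g (x + y) - g x - g1 x * y - g2 x * y ^+ 2| <= C * `|y| ^+ 3).

(** Integrating the Taylor inequality: the first-order term vanishes since
    Y is centred and the second-order one only sees its variance 1, so the
    main term does not depend on the law of Y. *)
Lemma one_step (a x : R) : 0 <= a ->
  `|\int[P]_t g (x + a * Y t) - (g x + g2 x * a ^+ 2)| <= C * a ^+ 3 * L.
Proof.
move=> a0; have [mY Y0 Y1 _] := sY.
have i1 := standardized_integrable1 sY.
have i2 := standardized_integrable2 sY.
have i3 := standardized_integrable3 sY.
have ig : rintegrable P (fun t => g (x + a * Y t)).
  by apply: rintegrable01 => //; apply: (measurableT_comp mg); mfun.
have j1 : rintegrable P (fun t => (g1 x * a) * Y t) by exact: rintegrableZ.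
have j2 : rintegrable P (fun t => (g2 x * a ^+ 2) * Y t ^+ 2) by exact: rintegrableZ.
have jx : rintegrable P (fun=> g x) by exact: rintegrable_cst.
have jq : rintegrable P (fun t => g x + (g1 x * a) * Y t).
  exact: rintegrableD.
have -> : g x + g2 x * a ^+ 2 =
    \int[P]_t (g x + (g1 x * a) * Y t + (g2 x * a ^+ 2) * Y t ^+ 2).
  rewrite RintegralD// RintegralD// Rintegral_prob_cst !RintegralZl//.
  by rewrite Y0 Y1 mulr0 addr0 mulr1.
have jr := rintegrableD jq j2.
rewrite -RintegralB//; have jd := rintegrableB ig jr.
apply: (le_trans (le_normr_Rintegral measurableT jd)).
apply: (@le_trans _ _ (\int[P]_t ((C * a ^+ 3) * `|Y t| ^+ 3))).
  apply: le_Rintegral => //.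
  - exact: integrable_norm.
  - exact: rintegrableZ.
  - move=> t _; rewrite /= (_ : C * a ^+ 3 * _ = C * (a * `|Y t|) ^+ 3); last by ring.
    rewrite -[X in X * `|Y t|](ger0_norm a0) -normrM.
    rewrite (_ : _ - _ = g (x + a * Y t) - g x - g1 x * (a * Y t)
      - g2 x * (a * Y t) ^+ 2); last by ring.
    exact: gT.
rewrite RintegralZl// ler_wpM2l//; first by rewrite mulr_ge0// exprn_ge0.
exact: standardized_Rmoment3.
Qed.

End one_step.

Lemma Rintegral_normal_scale {R : realType} (f : R -> R) (s : R) : 0 < s ->
  continuous f -> (forall x, 0 <= f x) ->
  \int[normal_prob 0 s]_x f x = \int[normal_prob 0 1]_x f (s * x).
Proof. by move=> s0 cf f0; rewrite /Rintegral integral_normal_scale. Qed.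

Lemma continuous_shift {R : realType} (g : R -> R) (x : R) :
  continuous g -> continuous (fun u => g (x + u)).
Proof.
move=> cg u; apply: (cvg_comp (fun u => x + u) g); last exact: cg.
by apply: cvgD; [exact: cvg_cst|exact: cvg_id].
Qed.

Section lindeberg.
Context {R : realType} d {T : measurableType d} (P : probability T R).
Variables (L : R) (Y : T -> R).
Hypothesis sY : standardized P L Y.
Variables (g g1 g2 : R -> R) (C : R).
Hypotheses (cg : continuous g) (g01 : forall x, 0 <= g x <= 1).
Hypotheses (C0 : 0 <= C)
  (gT : forall x y, `|g (x + y) - g x - g1 x * y - g2 x * y ^+ 2| <= C * `|y| ^+ 3).

Let mg : measurable_fun setT g.
Proof. exact: continuous_measurable_fun. Qed.

(** Both integrals are within their Taylor error of g x + g2 x * a^2. *)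
Lemma swap_one (a x : R) : 0 < a ->
  `|\int[P]_t g (x + a * Y t) - \int[normal_prob 0 a]_v g (x + v)|
  <= C * a ^+ 3 * (L + 32).
Proof.
move=> a0.
rewrite Rintegral_normal_scale//; [|exact: continuous_shift|by move=> u; case/andP: (g01 (x + u))].
have h1 := one_step sY mg g01 C0 gT x (ltW a0).
have h2 := one_step standardized_normal mg g01 C0 gT x (ltW a0).
rewrite distrC in h2.
by rewrite mulrDr; apply: le_trans (ler_distD _ _ _) (lerD h1 h2).
Qed.

Lemma Rintegral_iidS n (F : n.+1.-tuple T -> R) :
  measurable_fun setT F -> (forall X, 0 <= F X <= 1) ->
  \int[iid_law P n.+1]_X F X =
  \int[P]_t \int[iid_law P n]_X F (cons_pair (t, X)).
Proof.
move=> mF F01; rewrite /Rintegral ge0_integral_iidS; last 2 first.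
- exact/measurable_EFinP.
- by move=> X; rewrite lee_fin; case/andP: (F01 X).
congr fine; apply: eq_integral => t _.
rewrite -(@fineK_Rintegral2 _ _ _ _ _ _ (F \o @cons_pair _ _ n))//.
- by apply: (measurableT_comp mF); exact: measurable_cons_pair.
- by move=> p; exact: F01.
Qed.

(** Induction on the number of summands, in Trotter's form: condition on the
    first summand and replace all the others by a single Gaussian (induction
    hypothesis), then replace the first one, conditionally on that Gaussian;
    the two Gaussians recombine by convolution.  The shift x is what the
    conditioning produces. *)
Lemma lindeberg (a : R) (k : nat) (x : R) : 0 < a ->
  `|\int[iid_law P k.+1]_X g (x + \sum_(i < k.+1) a * Y (tnth X i)) -
    \int[normal_prob 0 (a * Num.sqrt k.+1%:R)]_u g (x + u)|
  <= k.+1%:R * (C * a ^+ 3 * (L + 32)).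
Proof.
move=> a0; have [mY _ _ _] := sY.
set e := C * a ^+ 3 * (L + 32).
have mF n (z : R) : measurable_fun [set: n.-tuple T]
    (fun X => g (z + \sum_(i < n) a * Y (tnth X i))).
  apply: (measurableT_comp mg); mfun.
  by apply: (@measurable_sum_tnth _ _ _ n (fun t => a * Y t)); mfun.
elim: k x => [|k IH] x.
  rewrite Rintegral_iidS// sqrtr1 mulr1 mul1r.
  under eq_Rintegral => t _.
    rewrite /Rintegral integral_iid0; last first.
      apply/measurable_EFinP; apply: (measurableT_comp (mF 1%N x)).
      apply: (measurableT_comp (@measurable_cons_pair _ _ 0)).
      exact: pair1_measurable.
    rewrite /= (sum_cons_pair (fun t => a * Y t)) big_ord0 addr0; over.
  exact: swap_one.
set s := a * Num.sqrt k.+1%:R.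
have s0 : 0 < s by rewrite mulr_gt0// sqrtr_gt0.
have s2E : Num.sqrt (s ^+ 2 + a ^+ 2) = a * Num.sqrt k.+2%:R.
  have -> : s ^+ 2 + a ^+ 2 = a ^+ 2 * k.+2%:R.
    by rewrite /s exprMn sqr_sqrtr// -[k.+2%:R]natr1 mulrDr mulr1.
  by rewrite sqrtrM ?sqr_ge0// sqrtr_sqr gtr0_norm.
rewrite Rintegral_iidS//.
have mG : measurable_fun [set: T * k.+1.-tuple T]
    (fun p => g (x + a * Y p.1 + \sum_(i < k.+1) a * Y (tnth p.2 i))).
  apply: (measurableT_comp mg); apply: measurable_funD.
    apply: measurable_funD => //; apply: measurable_funM => //.
    exact: (measurableT_comp mY).
  have maY : measurable_fun setT (fun t => a * Y t) by mfun.
  exact: (measurableT_comp (measurable_sum_tnth maY)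
    (@measurable_snd _ _ T (k.+1.-tuple T))).
under eq_Rintegral => t _.
  under eq_Rintegral => X _ do rewrite (sum_cons_pair (fun t => a * Y t)) addrA.
  over.
have mH : measurable_fun [set: T * measurableTypeR R]
    (fun p => g (x + a * Y p.1 + p.2)).
  apply: (measurableT_comp mg); apply: measurable_funD => //.
  apply: measurable_funD => //; apply: measurable_funM => //.
  exact: (measurableT_comp mY).
have m1 := measurable_Rintegral2 (iid_law P k.+1) mG (fun p => g01 _).
have m2 := measurable_Rintegral2 (normal_prob 0 s) mH (fun p => g01 _).
have b1 : `|\int[P]_t \int[iid_law P k.+1]_X
      g (x + a * Y t + \sum_(i < k.+1) a * Y (tnth X i)) -
    \int[P]_t \int[normal_prob 0 s]_u g (x + a * Y t + u)| <= k.+1%:R * e.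
  apply: dist_Rintegral.
  - apply: rintegrable01 => // t; apply: Rintegral01 => //; exact: mF.
  - apply: rintegrable01 => // t; apply: Rintegral01 => //.
    by apply: (measurableT_comp mg); mfun.
  - by move=> t; exact: IH.
rewrite (Rfubini P (normal_prob 0 s) mH (fun p => g01 _)) in b1.
have -> : \int[normal_prob 0 (a * Num.sqrt k.+2%:R)]_u g (x + u) =
   \int[normal_prob 0 s]_u \int[normal_prob 0 a]_v g (x + u + v).
  rewrite -s2E addrC.
  transitivity (fine (\int[normal_prob 0 s]_y \int[normal_prob 0 a]_x0
      (g (x + y + x0))%:E)%E).
    rewrite integral_normal_conv//.
    by move=> u; case/andP: (g01 u).
  congr fine; apply: eq_integral => u _; rewrite fineK_rintegrable//.
  by apply: rintegrable01 => //; apply: (measurableT_comp mg); mfun.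
have mK : measurable_fun [set: measurableTypeR R * measurableTypeR R]
    (fun p => g (x + p.1 + p.2)).
  by apply: (measurableT_comp mg); mfun.
have mH' : measurable_fun [set: measurableTypeR R * T]
    (fun p => g (x + a * Y p.2 + p.1)).
  apply: (measurableT_comp mg); apply: measurable_funD => //.
  apply: measurable_funD => //; apply: measurable_funM => //.
  exact: (measurableT_comp mY).
have b2 : `|\int[normal_prob 0 s]_u \int[P]_t g (x + a * Y t + u) -
    \int[normal_prob 0 s]_u \int[normal_prob 0 a]_v g (x + u + v)| <= e.
  apply: dist_Rintegral.
  - apply: rintegrable01.
      exact: (measurable_Rintegral2 P mH' (fun p => g01 _)).
    move=> u; apply: Rintegral01 => //.
    by apply: (measurableT_comp mg); mfun.
  - apply: rintegrable01.
      exact: (measurable_Rintegral2 (normal_prob 0 a) mK (fun p => g01 _)).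
    move=> u; apply: Rintegral01 => //.
    by apply: (measurableT_comp mg); mfun.
  - move=> u; under eq_Rintegral do rewrite addrAC.
    exact: swap_one.
rewrite -[k.+2%:R]natr1 mulrDl mul1r.
exact: le_trans (ler_distD _ _ _) (lerD b1 b2).
Qed.

End lindeberg.

(** * The normal distribution function *)

Section Phi.
Context {R : realType}.
Local Notation N := (normal_prob (0:R) 1).

Lemma Phi_le (x y : R) : x <= y -> Phi x <= Phi y.
Proof.
move=> xy; rewrite /Phi fine_le ?fin_num_measure//.
by apply: le_measure; rewrite ?inE//; exact: subset_itvl.
Qed.

Lemma PhiB (x y : R) : x <= y -> Phi y - Phi x = fine (N `]x, y]).
Proof.
move=> xy; rewrite /Phi -fineB ?fin_num_measure//; congr fine.
rewrite (_ : `]-oo, y]%classic = `]-oo, x] `|` `]x, y]); last first.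
  by rewrite -itv_bndbnd_setU ?bnd_simp.
rewrite measureU//.
  by rewrite [X in (X - _)%E]addeC addeK// fin_num_measure.
by apply/seteqP; split => // z [] /=; rewrite !in_itv/= => ? /andP[]; lra.
Qed.

(** The density is at most (2 pi)^(-1/2) <= 1. *)
Lemma Phi_lipschitz (x y : R) : x <= y -> Phi y - Phi x <= y - x.
Proof.
move=> xy; rewrite PhiB// -lee_fin fineK ?fin_num_measure//.
have -> : (y - x)%:E = (lebesgue_measure `]x, y]%classic : \bar R).
  rewrite lebesgue_measure_itv/= lte_fin; case: ltP => // yx.
  by rewrite (_ : y = x) ?subrr//; apply/eqP; rewrite eq_le xy yx.
rewrite -[leRHS]mul1e -integral_cst//= /normal_prob.
apply: ge0_le_integral => //=.
- by move=> u _; rewrite lee_fin normal_pdf_ge0.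
- by apply/measurable_EFinP/measurable_funTS; exact: measurable_normal_pdf.
- move=> u _; rewrite lee_fin; apply: (le_trans (normal_pdf_ub _ _ (oner_neq0 _))).
  have p0 : 0 < (pi : R) *+ 2 by have := pi_gt0 R; rewrite mulr2n; lra.
  rewrite /normal_peak expr1n mul1r invf_le1 ?sqrtr_gt0//.
  rewrite -[leLHS]sqrtr1; apply: ler_wsqrtr.
  by have := pi_ge2 R; rewrite mulr2n; lra.
Qed.

Lemma Phi_ge0_le1 (x : R) : 0 <= Phi x <= 1.
Proof.
rewrite /Phi fine_ge0//= -lee_fin fineK ?fin_num_measure//.
exact: probability_le1.
Qed.

Lemma normal_tail (c : R) : fine (N `]c, +oo[) = 1 - Phi c.
Proof.
have -> : `]c, +oo[%classic = ~` `]-oo, c]%classic by rewrite setCitvl.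
rewrite probability_setC// fineB ?fin_num_measure//.
Qed.

Let idTR : measurableTypeR R -> R := fun x => x.

(* The limits of a distribution function are available for random variables;
   the identity plays that part here. *)
#[local] HB.instance Definition _ :=
  @isMeasurableFun.Build _ _ _ _ idTR (@measurable_id _ _ setT).

Lemma Phi_small (e : R) : 0 < e -> exists x, Phi x < e.
Proof.
move=> e0; have := @cvg_cdfNy0 _ _ _ N (idTR : {RV N >-> R}).
move=> /fine_cvg/cvgrPdist_lt/(_ e e0) [M [_ hM]].
exists (M - 1); have := hM (M - 1) ltac:(lra).
rewrite sub0r normrN => h; rewrite -[Phi _]ger0_norm; first exact: h.
by have /andP[] := Phi_ge0_le1 (M - 1).
Qed.

Lemma Phi_large (e : R) : 0 < e -> exists x, 1 - e < Phi x.
Proof.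
move=> e0; have := @cvg_cdfy1 _ _ _ N (idTR : {RV N >-> R}).
move=> /fine_cvg/cvgrPdist_lt/(_ e e0) [M [_ hM]].
exists (M + 1); have := hM (M + 1) ltac:(lra).
move=> h; have {h} : `|1 - Phi (M + 1)| < e by exact: h.
by have /andP[_ h] := Phi_ge0_le1 (M + 1); rewrite ger0_norm; lra.
Qed.

(** The infimum is attained and exact because Phi is continuous, here in the
    quantitative form of [Phi_lipschitz]. *)
Lemma Phi_zquantile (b : R) : 0 < b < 1 -> Phi (zquantile b) = b.
Proof.
move=> /andP[b0 b1]; rewrite /zquantile; set S := [set x | b <= Phi x].
have S0 : S !=set0.
  have [x hx] := @Phi_large (1 - b) ltac:(lra).
  by exists x; rewrite /S /=; lra.
have Slb : has_lbound S.
  have [x hx] := Phi_small b0; exists x => y; rewrite /S /= => hy.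
  by rewrite leNgt; apply/negP => /ltW/Phi_le; lra.
apply/eqP; rewrite eq_le; apply/andP; split; apply/ler_addgt0Pr => e e0.
- have : ~ S (inf S - e).
    by move=> /(ge_inf Slb); lra.
  move=> /negP; rewrite -ltNge => h.
  by have := @Phi_lipschitz (inf S - e) (inf S) ltac:(lra); lra.
- have [x Sx xe] := inf_adherent e0 (conj S0 Slb).
  have ix : inf S <= x by exact: ge_inf.
  have := Phi_lipschitz ix; move: Sx; rewrite /S /=; lra.
Qed.

Lemma measurable_Phi : measurable_fun setT (@Phi R).
Proof. by apply: nondecreasing_measurable => // x y; exact: Phi_le. Qed.

End Phi.

(** * A central limit theorem with an explicit error *)

Section clt.
Context {R : realType} d {T : measurableType d} (P : probability T R).
Variables (L : R) (Y : T -> R).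
Hypothesis sY : standardized P L Y.

Definition nsum n (X : n.-tuple T) : R := \sum_(i < n) (Num.sqrt n%:R)^-1 * Y (tnth X i).

Lemma measurable_nsum n : measurable_fun setT (@nsum n).
Proof.
have [mY _ _ _] := sY.
by apply: (@measurable_sum_tnth _ _ _ n (fun t => (Num.sqrt n%:R)^-1 * Y t)); mfun.
Qed.

(** n replacements with a = n^(-1/2), each costing C a^3 (L + 32). *)
Lemma clt_smooth n (c eta : R) : (0 < n)%N -> 0 < eta ->
  `|\int[iid_law P n]_X smooth_step c eta (nsum X) -
    \int[normal_prob 0 1]_u smooth_step c eta u|
  <= 2 / eta ^+ 3 * (L + 32) / Num.sqrt n%:R.
Proof.
case: n => // k _ eta0; have [g1 [g2 gT]] := smooth_step_taylor c eta0.
have s0 : 0 < Num.sqrt (k.+1%:R : R) by rewrite sqrtr_gt0.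
have a0 : 0 < (Num.sqrt (k.+1%:R : R))^-1 by rewrite invr_gt0.
have C0 : 0 <= 2 / eta ^+ 3 by rewrite divr_ge0// exprn_ge0// ltW.
have := lindeberg sY (@continuous_smooth_step _ c eta)
  (@smooth_step_ge0_le1 _ c eta) C0 gT k 0 a0.
rewrite mulVf ?gt_eqF//.
under eq_Rintegral do rewrite add0r.
under [X in _ - X]eq_Rintegral do rewrite add0r.
move=> /le_trans; apply; rewrite -[X in X * _]sqr_sqrtr//.
have E (s C : R) : 0 < s ->
    s ^+ 2 * (C * s^-1 ^+ 3 * (L + 32)) = C * (L + 32) / s.
  by move=> ?; field; rewrite gt_eqF.
by rewrite E.
Qed.

Let mstep c eta : measurable_fun setT (@smooth_step R c eta).
Proof. by apply: continuous_measurable_fun; exact: continuous_smooth_step. Qed.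

Lemma smooth_step_le_indic (c eta x : R) : 0 < eta ->
  smooth_step c eta x <= \1_`]c, +oo[ x.
Proof.
move=> eta0; rewrite indicE; have [xc|xc] := leP x c.
  by rewrite /smooth_step spline_le0// pmulr_lle0 ?invr_gt0//; lra.
rewrite mem_set/= ?in_itv/= ?xc//.
by have /andP[] := smooth_step_ge0_le1 c eta x.
Qed.

Lemma indic_le_smooth_step (c eta x : R) : 0 < eta ->
  \1_`[c + 3 * eta, +oo[ x <= smooth_step c eta x.
Proof.
move=> eta0; rewrite indicE; have [xc|xc] := leP (c + 3 * eta) x.
  rewrite /smooth_step spline_ge3 ?ler_pdivlMr//; last by lra.
  by rewrite lern1; case: (_ \in _).
rewrite memNset; last by rewrite /= in_itv/= andbT; apply/negP; rewrite -ltNge.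
by have /andP[] := smooth_step_ge0_le1 c eta x.
Qed.

Lemma normal_smooth_step_le (c eta : R) : 0 < eta ->
  \int[normal_prob 0 1]_u smooth_step c eta u <= 1 - Phi c.
Proof.
move=> eta0; rewrite -normal_tail -Rintegral_indic//.
apply: le_Rintegral => //.
- apply: rintegrable01 => [|t]; [exact: mstep|exact: smooth_step_ge0_le1].
- exact: integrable_indic.
- by move=> x _; exact: smooth_step_le_indic.
Qed.

Lemma normal_smooth_step_ge (c eta : R) : 0 < eta ->
  1 - Phi (c + 3 * eta) <= \int[normal_prob 0 1]_u smooth_step c eta u.
Proof.
move=> eta0; rewrite -normal_tail -Rintegral_indic//.
apply: le_Rintegral => //.
- exact: integrable_indic.
- apply: rintegrable01 => [|t]; [exact: mstep|exact: smooth_step_ge0_le1].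
- move=> x _; apply: le_trans (indic_le_smooth_step c x eta0).
  rewrite !indicE ler_nat; case: (boolP (_ \in _)) => // /set_mem/= h.
  by rewrite mem_set//=; move: h; rewrite !in_itv/= !andbT => /ltW.
Qed.

(** The step that climbs from 0 to 1 on [c - 3 eta, c] dominates the indicator
    of [c, +oo[ and is dominated by that of ]c - 3 eta, +oo[; symmetrically for
    [clt_lower]. *)
Lemma clt_upper n (c eta : R) : (0 < n)%N -> 0 < eta ->
  fine (iid_law P n [set X | c <= nsum X]) <=
  1 - Phi (c - 3 * eta) + 2 / eta ^+ 3 * (L + 32) / Num.sqrt n%:R.
Proof.
move=> n0 eta0.
have mA : measurable [set X : n.-tuple T | c <= nsum X].
  rewrite (_ : [set _ | _] = @nsum n @^-1` `[c, +oo[); last first.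
    by apply/seteqP; split => X /=; rewrite in_itv/= andbT.
  by rewrite -[X in measurable X]setTI; apply: measurable_nsum.
rewrite -Rintegral_indic//.
apply: (@le_trans _ _ (\int[iid_law P n]_X smooth_step (c - 3 * eta) eta (nsum X))).
  apply: le_Rintegral => //.
  - exact: integrable_indic.
  - apply: rintegrable01 => [|t]; last exact: smooth_step_ge0_le1.
    by apply: (measurableT_comp (mstep _ _)); exact: measurable_nsum.
  - move=> X _; have := indic_le_smooth_step (c - 3 * eta) (nsum X) eta0.
    apply: le_trans; rewrite subrK !indicE ler_nat.
    case: (boolP (_ \in _)) => // /set_mem/= h.
    by rewrite mem_set//= in_itv/= h.
have := clt_smooth (c - 3 * eta) n0 eta0; rewrite ler_norml => /andP[_].
by have := normal_smooth_step_le (c - 3 * eta) eta0; lra.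
Qed.

Lemma clt_lower n (c eta : R) : (0 < n)%N -> 0 < eta ->
  1 - Phi (c + 3 * eta) - 2 / eta ^+ 3 * (L + 32) / Num.sqrt n%:R <=
  fine (iid_law P n [set X | c < nsum X]).
Proof.
move=> n0 eta0.
have mA : measurable [set X : n.-tuple T | c < nsum X].
  rewrite (_ : [set _ | _] = @nsum n @^-1` `]c, +oo[); last first.
    by apply/seteqP; split => X /=; rewrite in_itv/= andbT.
  by rewrite -[X in measurable X]setTI; apply: measurable_nsum.
rewrite -Rintegral_indic//.
apply: (@le_trans _ _ (\int[iid_law P n]_X smooth_step c eta (nsum X))); last first.
  apply: le_Rintegral => //.
  - apply: rintegrable01 => [|t]; last exact: smooth_step_ge0_le1.
    by apply: (measurableT_comp (mstep _ _)); exact: measurable_nsum.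
  - exact: integrable_indic.
  - move=> X _; apply: (le_trans (smooth_step_le_indic c (nsum X) eta0)).
    rewrite !indicE ler_nat; case: (boolP (_ \in _)) => // /set_mem/=.
    by rewrite in_itv/= andbT => h; rewrite mem_set.
have := clt_smooth c n0 eta0; rewrite ler_norml => /andP[+ _].
by have := normal_smooth_step_ge c eta0; lra.
Qed.

End clt.

(** * Probability inequalities *)

Section prob_tools.
Context {R : realType} d {T : measurableType d} (P : probability T R).

Lemma fine_probability_le (A B : set T) : measurable A -> measurable B ->
  A `<=` B -> fine (P A) <= fine (P B).
Proof.
move=> mA mB AB; rewrite fine_le ?fin_num_measure//.
by apply: le_measure; rewrite ?inE.
Qed.

Lemma fine_probability_leU (A B C : set T) :
  measurable A -> measurable B -> measurable C ->
  A `<=` B `|` C -> fine (P A) <= fine (P B) + fine (P C).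
Proof.
move=> mA mB mC ABC; rewrite -fineD ?fin_num_measure// fine_le ?fin_num_measure//.
  by rewrite fin_numD !fin_num_measure.
apply: (le_trans _ (measureU2 _ mB mC)).
by apply: le_measure; rewrite ?inE//; exact: measurableU.
Qed.

Lemma markov_fine (F : T -> R) (c t : R) : measurable_fun setT F ->
  (forall x, 0 <= F x) -> (\int[P]_x (F x)%:E <= c%:E)%E -> 0 < t ->
  measurable [set x | t <= F x] /\ fine (P [set x | t <= F x]) <= c / t.
Proof.
move=> mF F0 Fc t0; set A := [set _ | _].
have mA : measurable A.
  rewrite (_ : A = F @^-1` `[t, +oo[).
    by rewrite -[X in measurable X]setTI; exact: mF.
  by apply/seteqP; split => x; rewrite /A /= in_itv/= andbT.
split => //; rewrite ler_pdivlMr// mulrC -lee_fin EFinM fineK ?fin_num_measure//.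
apply: le_trans Fc.
have -> : (P A = \int[P]_x (\1_A x)%:E)%E by rewrite integral_indic// setIT.
rewrite -ge0_integralZl//; last first.
- by rewrite lee_fin ltW.
- by apply/measurable_EFinP; exact: measurable_indic.
apply: ge0_le_integral => //.
- by move=> x _; rewrite -EFinM lee_fin mulr_ge0// ltW.
- apply: emeasurable_funM => //; apply/measurable_EFinP; exact: measurable_indic.
- exact/measurable_EFinP.
move=> x _; rewrite -EFinM lee_fin indicE; case: (boolP (_ \in _)) => [/set_mem|_].
  by rewrite mulr1.
by rewrite mulr0.
Qed.

End prob_tools.

(** * Sample mean, sample variance and studentized mean *)

Section sample_statistics.
Context {R : realType} d {T : measurableType d}.
Implicit Types (h : T -> R).

Definition smean n h (X : n.-tuple T) : R := n%:R^-1 * \sum_(i < n) h (tnth X i).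

Definition svar n h (X : n.-tuple T) : R :=
  n%:R^-1 * \sum_(i < n) (h (tnth X i) - smean h X) ^+ 2.

Definition tstat n h (X : n.-tuple T) : R :=
  Num.sqrt n%:R * smean h X / Num.sqrt (svar h X).

Lemma svarE n h (X : n.-tuple T) : (0 < n)%N ->
  svar h X = smean (fun t => h t ^+ 2) X - smean h X ^+ 2.
Proof.
move=> n0; have n0' : n%:R != 0 :> R by rewrite pnatr_eq0 -lt0n.
rewrite /svar; set m := smean h X.
have mE : \sum_(i < n) h (tnth X i) = n%:R * m.
  by rewrite /m /smean mulrA divff// mul1r.
under eq_bigr => i _ do rewrite sqrrB -mulr_natr.
rewrite big_split sumrB /= -!mulr_suml mE sumr_const card_ord -mulr_natr /smean.
by field.
Qed.

Lemma smean_affine n h (X : n.-tuple T) (a b : R) : (0 < n)%N ->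
  smean (fun t => a + b * h t) X = a + b * smean h X.
Proof.
move=> n0; have n0' : n%:R != 0 :> R by rewrite pnatr_eq0 -lt0n.
rewrite /smean big_split/= sumr_const card_ord -mulr_sumr -mulr_natr.
by field.
Qed.

Lemma svar_affine n h (X : n.-tuple T) (a b : R) : (0 < n)%N ->
  svar (fun t => a + b * h t) X = b ^+ 2 * svar h X.
Proof.
move=> n0; rewrite /svar smean_affine// [RHS]mulrCA; congr (_ * _).
rewrite mulr_sumr; apply: eq_bigr => i _; ring.
Qed.

(** Studentization removes the scale b and turns the location a into the
    additive shift sqrt n a / b of the numerator. *)
Lemma tstat_affine n h (X : n.-tuple T) (a b : R) : (0 < n)%N -> 0 < b ->
  tstat (fun t => a + b * h t) X =
  (Num.sqrt n%:R * a / b + Num.sqrt n%:R * smean h X) / Num.sqrt (svar h X).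
Proof.
move=> n0 b0; rewrite /tstat smean_affine// svar_affine//.
rewrite sqrtrM ?sqr_ge0// sqrtr_sqr gtr0_norm// invfM.
set s := (Num.sqrt (svar h X))^-1; set q : R := Num.sqrt _.
by field; rewrite gt_eqF.
Qed.

Lemma measurable_smean n h : measurable_fun setT h ->
  measurable_fun setT (@smean n h).
Proof. by move=> mh; rewrite /smean; mfun; exact: measurable_sum_tnth. Qed.

Lemma measurable_svar n h : measurable_fun setT h ->
  measurable_fun setT (@svar n h).
Proof.
move=> mh; rewrite /svar; apply: measurable_funM => //.
apply: measurable_sum => i; apply: measurable_funX.
apply: measurable_funB; last exact: measurable_smean.
by apply: (measurableT_comp mh); exact: measurable_tnth.
Qed.

Lemma measurable_inv_sqrt : measurable_fun setT (fun x : R => (Num.sqrt x)^-1).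
Proof.
rewrite (_ : (fun x => _) = (fun x : R => (Num.max x 0) `^ (- 2^-1))).
  apply: (measurableT_comp (measurable_powR _)).
  by apply: measurable_maxr.
apply/funext => x; rewrite powRN powR12_sqrt ?le_max ?lexx ?orbT//.
have [x0|x0] := leP x 0; last by [].
by rewrite sqrtr0 ler0_sqrtr.
Qed.

Lemma measurable_sqrt : measurable_fun setT (@Num.sqrt R).
Proof.
rewrite (_ : @Num.sqrt R = (fun x => ((Num.sqrt x)^-1)^-1)); last first.
  by apply/funext => x; rewrite invrK.
rewrite (_ : (fun x => _) = (fun x : R => (Num.max x 0) `^ 2^-1)).
  by apply: (measurableT_comp (measurable_powR _)); exact: measurable_maxr.
apply/funext => x; rewrite invrK powR12_sqrt ?le_max ?lexx ?orbT//.
by have [x0|x0] := leP x 0; [rewrite sqrtr0 ler0_sqrtr|].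
Qed.

Lemma measurable_tstat_gen n (b : R) h : measurable_fun setT h ->
  measurable_fun setT (fun X : n.-tuple T =>
    (b + Num.sqrt n%:R * smean h X) / Num.sqrt (svar h X)).
Proof.
move=> mh; apply: measurable_funM.
  by apply: measurable_funD => //; apply: measurable_funM => //; exact: measurable_smean.
exact: (measurableT_comp measurable_inv_sqrt (measurable_svar mh)).
Qed.

Lemma measurable_tstat n h : measurable_fun setT h ->
  measurable_fun setT (@tstat n h).
Proof.
move=> /(measurable_tstat_gen (n := n) 0).
by under eq_fun do rewrite add0r.
Qed.

End sample_statistics.

(** * Concentration of the sample variance *)

Section lln.
Context {R : realType} d {T : measurableType d} (P : probability T R).
Variables (L : R) (Y : T -> R).
Hypothesis sY : standardized P L Y.

Lemma smean_second_moment n (Z : T -> R) : (0 < n)%N ->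
  rintegrable P Z -> rintegrable P (fun t => Z t ^+ 2) ->
  \int[P]_t Z t = 0 ->
  (\int[iid_law P n]_X (smean Z X ^+ 2)%:E =
   (\int[P]_t (Z t ^+ 2) / n%:R)%:E)%E.
Proof.
move=> n0 iZ iZ2 Z0; have n0' : 0 < n%:R :> R by rewrite ltr0n.
have mZ := rintegrable_measurable iZ.
have -> : (\int[iid_law P n]_X (smean Z X ^+ 2)%:E =
    \int[iid_law P n]_X ((n%:R^-1 ^+ 2)%:E *
      ((0 + \sum_(i < n) Z (tnth X i)) ^+ 2)%:E))%E.
  by apply: eq_integral => X _; rewrite add0r -EFinM -exprMn.
rewrite ge0_integralZl//; last first.
- by move=> X _; rewrite lee_fin sqr_ge0.
- by mfun; exact: measurable_sum_tnth.
rewrite (iid_second_moment n 0 iZ iZ2 Z0 erefl) -EFinM expr0n/= add0r; congr EFin.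
by field; rewrite gt_eqF.
Qed.

Lemma smean_chebyshev n (Z : T -> R) (s t : R) : (0 < n)%N ->
  rintegrable P Z -> rintegrable P (fun t => Z t ^+ 2) ->
  \int[P]_t Z t = 0 -> \int[P]_t (Z t ^+ 2) <= s -> 0 < t ->
  measurable [set X : n.-tuple T | t <= smean Z X ^+ 2] /\
  fine (iid_law P n [set X | t <= smean Z X ^+ 2]) <= s / n%:R / t.
Proof.
move=> n0 iZ iZ2 Z0 Zs t0; have n0' : 0 < n%:R :> R by rewrite ltr0n.
have mZ := rintegrable_measurable iZ.
apply: markov_fine => //.
- by apply: measurable_funX; exact: measurable_smean.
- by move=> X; exact: sqr_ge0.
rewrite smean_second_moment// lee_fin ler_wpM2r// invr_ge0 ler0n//.
Qed.

(** Only third moments are available, so Y^2 may have infinite variance.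
    Truncate it at M^2: Z = min (Y^2, M^2) has E Z^2 <= M L, so Chebyshev
    applies to Z, and Y^2 - Z <= |Y|^3 / M has mean at most L / M, so Markov
    applies to the remainder.  The three terms of the bound come from the
    square of the sample mean, from Z and from the remainder. *)
Lemma svar_concentration n (M delta : R) : (0 < n)%N -> 0 < M -> 0 < delta ->
  0 <= L -> L / M <= delta / 8 ->
  measurable [set X : n.-tuple T | delta <= `|svar Y X - 1|] /\
  fine (iid_law P n [set X | delta <= `|svar Y X - 1|]) <=
  2 / (delta * n%:R) + 16 * M * L / (n%:R * delta ^+ 2) + 8 * L / (delta * M).
Proof.
move=> n0 M0 d0 L0 LM; have [mY Y0 Y1 Y3] := sY.
have n0' : 0 < n%:R :> R by rewrite ltr0n.
have i1 := standardized_integrable1 sY.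
have i2 := standardized_integrable2 sY.
have i3 := standardized_integrable3 sY.
pose Z t := Num.min (Y t ^+ 2) (M ^+ 2).
have mZ : measurable_fun setT Z.
  by apply: measurable_minr => //; exact: measurable_funX.
have Z0 t : 0 <= Z t by rewrite /Z le_min !sqr_ge0.
have ZY t : Z t <= Y t ^+ 2 by rewrite /Z ge_min lexx.
have ZM t : Z t <= M ^+ 2 by rewrite /Z ge_min lexx orbT.
have tail t : Y t ^+ 2 - Z t <= M^-1 * `|Y t| ^+ 3.
  have y0 := normr_ge0 (Y t).
  have yE : Y t ^+ 2 = `|Y t| ^+ 2 by rewrite -normrX ger0_norm ?sqr_ge0.
  rewrite /Z yE; have [h|h] := leP (`|Y t| ^+ 2) (M ^+ 2).
    by rewrite subrr mulr_ge0 ?exprn_ge0// invr_ge0 ltW.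
  rewrite ler_pdivlMl//; move: h y0; set y := `|Y t| => h y0.
  have My : M <= y by rewrite leNgt; apply/negP => yM; nra.
  have := sqr_ge0 M; have := sqr_ge0 y; nra.
have Zsq t : Z t ^+ 2 <= M * `|Y t| ^+ 3.
  have y0 := normr_ge0 (Y t).
  have yE : Y t ^+ 2 = `|Y t| ^+ 2 by rewrite -normrX ger0_norm ?sqr_ge0.
  rewrite /Z yE; set y := `|Y t| in y0 *.
  have [h|h] := leP (y ^+ 2) (M ^+ 2).
    have yM : y <= M by rewrite leNgt; apply/negP => yM; nra.
    rewrite (_ : (y ^+ 2) ^+ 2 = y * y ^+ 3); last by ring.
    by rewrite ler_wpM2r// exprn_ge0.
  have My : M <= y by rewrite leNgt; apply/negP => yM; nra.
  rewrite (_ : (M ^+ 2) ^+ 2 = M * M ^+ 3); last by ring.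
  by rewrite ler_pM2l// lerXn2r ?nnegrE// ltW.
have iZ : rintegrable P Z.
  apply: (rintegrable_le mZ _ i2) => t.
  by rewrite ger0_norm.
have iZ2 : rintegrable P (fun t => Z t ^+ 2).
  apply: (rintegrable_le _ _ (rintegrableZ M i3)); first exact: measurable_funX.
  by move=> t; rewrite ger0_norm ?sqr_ge0.
set e := \int[P]_t Z t.
have e0 : 0 <= e by apply: Rintegral_ge0 => t _.
have tail_int : 1 - e <= L / M.
  rewrite -Y1 /e -RintegralB//.
  apply: (@le_trans _ _ (\int[P]_t (M^-1 * `|Y t| ^+ 3))).
    apply: le_Rintegral => //; first exact: rintegrableB.
    exact: rintegrableZ.
  rewrite RintegralZl// mulrC ler_wpM2r ?invr_ge0 ?(ltW M0)//.
  exact: standardized_Rmoment3.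
have tail_int0 : 0 <= 1 - e.
  rewrite -Y1 /e -RintegralB//; apply: Rintegral_ge0 => t _.
  by rewrite subr_ge0.
pose V t := Z t - e.
have iV : rintegrable P V by apply: rintegrableB => //; exact: rintegrable_cst.
have mV := rintegrable_measurable iV.
have VE t : V t ^+ 2 = Z t ^+ 2 + ((- (2 * e)) * Z t + e ^+ 2).
  by rewrite /V; ring.
have iW : rintegrable P (fun t => (- (2 * e)) * Z t + e ^+ 2).
  by apply: rintegrableD; [exact: rintegrableZ|exact: rintegrable_cst].
have iV2 : rintegrable P (fun t => V t ^+ 2).
  by under eq_fun do rewrite VE; exact: rintegrableD.
have V0 : \int[P]_t V t = 0.
  rewrite RintegralB ?Rintegral_prob_cst ?subrr//; exact: rintegrable_cst.
have V2 : \int[P]_t (V t ^+ 2) <= M * L.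
  under eq_Rintegral do rewrite VE.
  rewrite RintegralD// RintegralD//; last 2 first.
  - exact: rintegrableZ.
  - exact: rintegrable_cst.
  rewrite Rintegral_prob_cst RintegralZl// -/e.
  have h : \int[P]_t (Z t ^+ 2) <= M * L.
    apply: (@le_trans _ _ (\int[P]_t (M * `|Y t| ^+ 3))).
      by apply: le_Rintegral => //; exact: rintegrableZ.
    by rewrite RintegralZl// ler_pM2l//; exact: standardized_Rmoment3.
  have := sqr_ge0 e; nra.
have d2 : 0 < delta / 2 by lra.
have d4 : 0 < (delta / 4) ^+ 2 by rewrite exprn_gt0//; lra.
have d8 : 0 < delta / 8 by lra.
have Y1' : \int[P]_t (Y t ^+ 2) <= 1 by rewrite Y1.
have [mA1 PA1] := smean_chebyshev n0 i1 i2 Y0 Y1' d2.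
have [mA2 PA2] := smean_chebyshev n0 iV iV2 V0 V2 d4.
have mD : measurable_fun setT (fun t => Y t ^+ 2 - Z t) by mfun.
have Dint : (\int[iid_law P n]_X (smean (fun t => Y t ^+ 2 - Z t) X)%:E
    <= (L / M)%:E)%E.
  have -> : (\int[iid_law P n]_X (smean (fun t => Y t ^+ 2 - Z t) X)%:E =
    \int[iid_law P n]_X ((n%:R^-1)%:E *
      (0 + \sum_(i < n) (Y (tnth X i) ^+ 2 - Z (tnth X i)))%:E))%E.
    by apply: eq_integral => X _; rewrite add0r -EFinM.
  rewrite ge0_integralZl//; last first.
  - by move=> X _; rewrite lee_fin add0r sumr_ge0// => i _; rewrite subr_ge0.
  - by mfun; exact: (measurable_sum_tnth mD).
  rewrite (@iid_first_moment _ _ _ P n (fun t => Y t ^+ 2 - Z t))//; last first.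
    by move=> t; rewrite subr_ge0.
  rewrite -fineK_rintegrable; last exact: rintegrableB.
  rewrite RintegralB// Y1 -/e add0e -!EFinM lee_fin mulrA mulVf ?gt_eqF// mul1r.
  exact: tail_int.
have D0 (X : n.-tuple T) : 0 <= smean (fun t => Y t ^+ 2 - Z t) X.
  rewrite /smean mulr_ge0 ?invr_ge0 ?ler0n// sumr_ge0// => i _.
  by rewrite subr_ge0.
have [mA3 PA3] := markov_fine (measurable_smean mD) D0 Dint d8.
have mS : measurable_fun setT (fun X : n.-tuple T => `|svar Y X - 1|).
  apply: (measurableT_comp (@normr_measurable _ setT)).
  by apply: measurable_funB => //; exact: measurable_svar.
have mA : measurable [set X : n.-tuple T | delta <= `|svar Y X - 1|].
  rewrite (_ : [set _ | _] = (fun X => `|svar Y X - 1|) @^-1` `[delta, +oo[).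
    by rewrite -[X in measurable X]setTI; exact: mS.
  by apply/seteqP; split => x; rewrite /= in_itv/= andbT.
split => //.
have incl : [set X : n.-tuple T | delta <= `|svar Y X - 1|] `<=`
   [set X | delta / 2 <= smean Y X ^+ 2] `|`
   ([set X | (delta / 4) ^+ 2 <= smean V X ^+ 2] `|`
    [set X | delta / 8 <= smean (fun t => Y t ^+ 2 - Z t) X]).
  move=> X /=; have [|h1] := leP (delta / 2) (smean Y X ^+ 2); first by left.
  have [|h2] := leP ((delta / 4) ^+ 2) (smean V X ^+ 2); first by right; left.
  have [|h3] := leP (delta / 8) (smean (fun t => Y t ^+ 2 - Z t) X).
    by right; right.
  have Vm : `|smean V X| < delta / 4.
    rewrite ltNge; apply/negP => h; move: h2; rewrite ltNge => /negP; apply.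
    rewrite -(ger0_norm (sqr_ge0 (smean V X))) normrX lerXn2r ?nnegrE//; lra.
  rewrite svarE//.
  (* svar - 1 is the bias e - 1 of the truncation plus three small terms *)
  have dec : smean (fun t => Y t ^+ 2) X =
      e + smean V X + smean (fun t => Y t ^+ 2 - Z t) X.
    rewrite (_ : e + smean V X = smean (fun t => e + 1 * V t) X).
      rewrite /smean -mulrDr -big_split; congr (_ * _); apply: eq_bigr => i _.
      by rewrite /V /=; ring.
    by rewrite smean_affine// mul1r.
  rewrite leNgt => /negP; case; rewrite dec.
  have := D0 X; have := sqr_ge0 (smean Y X); move: Vm; rewrite !ltr_norml.
  set a := smean V X; set b := smean Y X ^+ 2 in h1 *; set c := smean _ X in h3 *.
  by move=> /andP[? ?] ? ?; apply/andP; split; lra.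
apply: (le_trans (fine_probability_leU _ mA mA1 (measurableU _ _ mA2 mA3) incl)).
have := fine_probability_leU (iid_law P n) (measurableU _ _ mA2 mA3) mA2 mA3 (@subset_refl _ _).
move: PA1 PA2 PA3.
rewrite (_ : 1 / n%:R / (delta / 2) = 2 / (delta * n%:R)); last first.
  by field; rewrite !gt_eqF.
rewrite (_ : M * L / n%:R / (delta / 4) ^+ 2 = 16 * M * L / (n%:R * delta ^+ 2)); last first.
  by field; rewrite !gt_eqF.
rewrite (_ : L / M / (delta / 8) = 8 * L / (delta * M)); last first.
  by field; rewrite !gt_eqF.
lra.
Qed.

End lln.

(** * Limits of the studentized mean, uniformly in the law *)

Lemma eventually_div_le {R : realType} (c e : R) : 0 < e ->
  exists N : nat, forall n, (N <= n)%N -> (0 < n)%N /\ c / n%:R <= e.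
Proof.
move=> e0; exists (Num.bound `|c / e|).+1 => n hn.
have n0 : (0 < n)%N by exact: leq_trans hn.
split => //; rewrite ler_pdivrMr ?ltr0n// mulrC -ler_pdivrMr//.
apply: (le_trans (ler_norm _)).
apply: ltW; apply: (lt_le_trans (archi_boundP (normr_ge0 _))).
by rewrite ler_nat; apply: ltnW.
Qed.

Lemma eventually_div_sqrt_le {R : realType} (c e : R) : 0 < e -> 0 <= c ->
  exists N : nat, forall n, (N <= n)%N -> (0 < n)%N /\ c / Num.sqrt n%:R <= e.
Proof.
move=> e0 c0; have [N hN] := eventually_div_le (c ^+ 2) (exprn_gt0 2 e0).
exists N => n /hN[n0 h]; split => //.
have s0 : 0 < Num.sqrt (n%:R : R) by rewrite sqrtr_gt0 ltr0n.
have : (c / Num.sqrt n%:R) ^+ 2 <= e ^+ 2 by rewrite exprMn exprVn sqr_sqrtr.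
by rewrite ler_pXn2r ?nnegrE ?(ltW e0) ?divr_ge0 ?sqrtr_ge0.
Qed.

(** M is chosen first, to make the truncation bias and the remainder small;
    n then only has to beat M. *)
Lemma uniform_svar_lln {R : realType} (L delta e : R) :
  0 <= L -> 0 < delta -> 0 < e ->
  exists N : nat, forall n, (N <= n)%N -> forall d (T : measurableType d)
    (P : probability T R) (Y : T -> R), standardized P L Y ->
  [/\ (0 < n)%N, measurable [set X : n.-tuple T | delta <= `|svar Y X - 1|] &
  fine (iid_law P n [set X : n.-tuple T | delta <= `|svar Y X - 1|]) <= e].
Proof.
move=> L0 d0 e0.
pose M := 1 + 8 * L / delta + 16 * L / (delta * e).
have a0 : 0 <= 8 * L / delta by rewrite divr_ge0 ?mulr_ge0 ?(ltW d0).
have b0 : 0 <= 16 * L / (delta * e) by rewrite divr_ge0 ?mulr_ge0 ?(ltW d0) ?(ltW e0).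
have M0 : 0 < M by rewrite /M; lra.
have LM : L / M <= delta / 8.
  rewrite ler_pdivrMr//; apply: (@le_trans _ _ (delta / 8 * (8 * L / delta))).
    by rewrite le_eqVlt; apply/orP; left; apply/eqP; field; rewrite gt_eqF.
  by rewrite ler_pM2l /M; lra.
have LM2 : 8 * L / (delta * M) <= e / 2.
  rewrite ler_pdivrMr ?mulr_gt0//.
  apply: (@le_trans _ _ (e / 2 * (delta * (16 * L / (delta * e))))).
    by rewrite le_eqVlt; apply/orP; left; apply/eqP; field; rewrite !gt_eqF.
  by rewrite ler_pM2l ?ler_pM2l /M//; lra.
have e2 : 0 < e / 2 by lra.
have [N hN] := eventually_div_le (2 / delta + 16 * M * L / delta ^+ 2) e2.
exists N => n /hN[n0 hn] d T P Y sY.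
have [mA PA] := svar_concentration sY n0 M0 d0 L0 LM.
split => //; apply: (le_trans PA).
have n0' : 0 < n%:R :> R by rewrite ltr0n.
have <- : (2 / delta + 16 * M * L / delta ^+ 2) / n%:R =
  2 / (delta * n%:R) + 16 * M * L / (n%:R * delta ^+ 2).
  by field; rewrite !gt_eqF.
lra.
Qed.

Lemma sqrt_close {R : realType} (s delta : R) : 0 < delta -> delta < 1 ->
  `|s - 1| < delta -> 0 < Num.sqrt s /\ `|Num.sqrt s - 1| <= delta.
Proof.
move=> d0 d1 h; have s0 : 0 < s by move: h; rewrite ltr_norml => /andP[]; lra.
have q0 : 0 < Num.sqrt s by rewrite sqrtr_gt0.
split => //; have : (Num.sqrt s - 1) * (Num.sqrt s + 1) = s - 1.
  by rewrite -subr_sqr sqr_sqrtr ?expr1n// ltW.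
move: h; set q := Num.sqrt s in q0 *; move=> h E.
move: h; rewrite -E normrM (ger0_norm (_ : 0 <= q + 1)); last lra.
have := normr_ge0 (q - 1); nra.
Qed.

Lemma nsumE {R : realType} d (T : measurableType d) n (Y : T -> R) (X : n.-tuple T) :
  (0 < n)%N -> nsum Y X = Num.sqrt n%:R * smean Y X.
Proof.
move=> n0; rewrite /nsum /smean -mulr_sumr mulrA; congr (_ * _).
have s0 : 0 < Num.sqrt (n%:R : R) by rewrite sqrtr_gt0 ltr0n.
rewrite -[X in _ = _ * X^-1]sqr_sqrtr ?ler0n//.
by field; rewrite gt_eqF.
Qed.

(** Outside an event of small probability the denominator q is within delta
    of 1, so z < T is z q < [nsum] and is squeezed between events for the
    thresholds z + |z| delta and z - |z| delta.  The error is shared in parts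
    of e / 5: sample variance, replacement error, smoothing width 3 eta, and
    |z| delta. *)
Theorem uniform_studentized_clt {R : realType} (L z e : R) :
  0 <= L -> 0 < e ->
  exists N : nat, forall n, (N <= n)%N -> forall d (T : measurableType d)
    (P : probability T R) (Y : T -> R), standardized P L Y ->
  `|fine (iid_law P n [set X | z < tstat Y X]) - (1 - Phi z)| <= e.
Proof.
move=> L0 e0; pose delta := e / (5 * (1 + `|z|) + e).
have z1 := normr_ge0 z.
have D0 : 0 < 5 * (1 + `|z|) + e by lra.
have d0 : 0 < delta by rewrite divr_gt0.
have d1 : delta < 1 by rewrite ltr_pdivrMr//; lra.
have zd : `|z| * delta <= e / 5.
  rewrite /delta mulrA ler_pdivrMr//; nra.
pose eta := e / 15.
have eta0 : 0 < eta by rewrite /eta; lra.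
have e5 : 0 < e / 5 by lra.
have [N1 hN1] := uniform_svar_lln L0 d0 e5.
have C0 : 0 <= 2 / eta ^+ 3 * (L + 32).
  by rewrite mulr_ge0// ?divr_ge0 ?exprn_ge0 ?(ltW eta0)//; lra.
have [N2 hN2] := eventually_div_sqrt_le e5 C0.
exists (maxn N1 N2) => n; rewrite geq_max => /andP[/hN1 H1 /hN2[n0 H2]].
move=> d T P Y sY; have [mY _ _ _] := sY.
have [_ mB PB] := H1 d T P Y sY.
set B := [set X : n.-tuple T | delta <= `|svar Y X - 1|] in mB PB *.
have mW := @measurable_nsum _ _ _ P L Y sY n.
have mA : measurable [set X : n.-tuple T | z < tstat Y X].
  by apply: measurable_gt_set; exact: measurable_tstat.
have good (X : n.-tuple T) : ~ B X ->
    exists2 q, 0 < q & `|q - 1| <= delta /\ tstat Y X = nsum Y X / q.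
  move=> /negP; rewrite -ltNge => /(sqrt_close d0 d1)[q0 q1].
  exists (Num.sqrt (svar Y X)) => //; split => //.
  by rewrite /tstat nsumE.
have zq (q : R) : `|q - 1| <= delta -> `|z * q - z| <= `|z| * delta.
  by move=> h; rewrite -[X in _ - X]mulr1 -mulrBr normrM ler_wpM2l.
set a := `|z| * delta in zd zq *.
have upper : fine (iid_law P n [set X | z < tstat Y X]) <=
    fine (iid_law P n [set X : n.-tuple T | z - a <= nsum Y X]) + fine (iid_law P n B).
  apply: fine_probability_leU => //; first exact: measurable_ge_set.
  move=> X /= zX; have [BX|BX] := pselect (B X); [by right|left].
  have [q q0 [q1 tE]] := good X BX; move: zX; rewrite tE ltr_pdivlMr//.
  by have := zq q q1; rewrite ler_norml => /andP[]; lra.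
have lower : fine (iid_law P n [set X : n.-tuple T | z + a < nsum Y X]) <=
    fine (iid_law P n [set X | z < tstat Y X]) + fine (iid_law P n B).
  apply: fine_probability_leU => //; first exact: measurable_gt_set.
  move=> X /= zX; have [BX|BX] := pselect (B X); [by right|left].
  have [q q0 [q1 tE]] := good X BX; rewrite tE ltr_pdivlMr//.
  by have := zq q q1; rewrite ler_norml => /andP[]; lra.
have U := clt_upper sY (z - a) n0 eta0.
have Lo := clt_lower sY (z + a) n0 eta0.
have a0 : 0 <= a by rewrite /a mulr_ge0// ltW.
have p1 : Phi z - Phi (z - a - 3 * eta) <= a + 3 * eta.
  by have := @Phi_lipschitz R (z - a - 3 * eta) z ltac:(lra); lra.
have p2 : Phi (z + a + 3 * eta) - Phi z <= a + 3 * eta.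
  by have := @Phi_lipschitz R z (z + a + 3 * eta) ltac:(lra); lra.
have eE : 3 * eta = e / 5 by rewrite /eta; field.
rewrite ler_norml; apply/andP; split; lra.
Qed.

(** With a deviation at most 2, the statistic can fall below z only if
    sqrt n W <= 2 |z| - b, which for large b is excluded by Chebyshev.  The
    constant makes 2 |z| - B = - (1 + 2 / e), whose square exceeds 2 / e. *)
Theorem uniform_shifted_power {R : realType} (L z e : R) :
  0 <= L -> 0 < e ->
  exists (N : nat) (B : R), forall n, (N <= n)%N ->
  forall d (T : measurableType d)
    (P : probability T R) (Y : T -> R), standardized P L Y ->
  forall b, B <= b ->
  fine (iid_law P n [set X |
    (b + Num.sqrt n%:R * smean Y X) / Num.sqrt (svar Y X) <= z]) <= e.
Proof.
move=> L0 e0; have e2 : 0 < e / 2 by lra.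
have h0 : 0 < 2^-1 :> R by [].
have [N hN] := uniform_svar_lln L0 h0 e2.
exists N, (2 * `|z| + 1 + 2 / e) => n /hN H d T P Y sY b hb.
have [mY Y0 Y1 _] := sY.
have [n0 mB PB] := H d T P Y sY.
have n0' : 0 < n%:R :> R by rewrite ltr0n.
have i1 := standardized_integrable1 sY.
have i2 := standardized_integrable2 sY.
have Y1' : \int[P]_t (Y t ^+ 2) <= 1 by rewrite Y1.
have ei : 0 < 2 / e by rewrite divr_gt0.
have c0 : 0 < 1 + 2 / e by lra.
have c1 : 0 < (1 + 2 / e) ^+ 2 / n%:R by rewrite divr_gt0// exprn_gt0.
have [mC PC] := smean_chebyshev n0 i1 i2 Y0 Y1' c1.
have mA : measurable [set X : n.-tuple T |
    (b + Num.sqrt n%:R * smean Y X) / Num.sqrt (svar Y X) <= z].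
  by apply: measurable_le_set; exact: measurable_tstat_gen.
have incl : [set X : n.-tuple T |
    (b + Num.sqrt n%:R * smean Y X) / Num.sqrt (svar Y X) <= z] `<=`
  [set X | (1 + 2 / e) ^+ 2 / n%:R <= smean Y X ^+ 2] `|`
  [set X | 2^-1 <= `|svar Y X - 1|].
  move=> X /= hX; have [|hs] := leP 2^-1 `|svar Y X - 1|; first by right.
  left; have h1 : 2^-1 < 1 :> R by rewrite invf_lt1// ltr1n.
  have [q0 q1] := sqrt_close h0 h1 hs.
  move: hX; rewrite ler_pdivrMr// => hX.
  rewrite ler_pdivrMr// -[X in _ <= _ * X]sqr_sqrtr ?ler0n// [X in _ <= X]mulrC -exprMn.
  set w := _ * smean Y X in hX *.
  have zq : z * Num.sqrt (svar Y X) <= `|z| * 2.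
    apply: (le_trans (ler_norm _)); rewrite normrM ler_wpM2l//.
    by move: q1; rewrite ler_norml ger0_norm ?(ltW q0)// => /andP[]; lra.
  rewrite -[X in _ <= X]sqrrN lerXn2r ?nnegrE//; lra.
apply: (le_trans (fine_probability_leU (iid_law P n) mA mC mB incl)).
suff : 1 / n%:R / ((1 + 2 / e) ^+ 2 / n%:R) <= e / 2 by lra.
rewrite (_ : _ / _ = ((1 + 2 / e) ^+ 2)^-1); last first.
  by field; rewrite !gt_eqF//; lra.
rewrite -[leRHS]invrK lef_pV2 ?posrE ?invr_gt0 ?exprn_gt0//.
rewrite invf_div; nra.
Qed.

(** * Linear forms and their second moments *)

Section linear_forms.
Context {R : realType} {d : nat}.
Implicit Types (w : 'rV[R]_d) (x mu u : d.-tuple R).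

(** Observations are tuples while linear algebra is done on row vectors; [dotr]
    and [clin] below pair a row vector of coefficients with an observation,
    the latter centred at mu. *)
Definition rv u : 'rV[R]_d := \row_i tnth u i.

Definition dotr w x : R := \sum_(i < d) w 0 i * tnth x i.

Definition clin w mu x : R := \sum_(i < d) w 0 i * (tnth x i - tnth mu i).

Definition sqnorm w : R := \sum_(i < d) w 0 i ^+ 2.

Lemma clinE w mu x : clin w mu x = dotr w x - dotr w mu.
Proof. by rewrite /clin /dotr -sumrB; apply: eq_bigr => i _; rewrite mulrBr. Qed.

Lemma dot_rv u x : dot u x = dotr (rv u) x.
Proof. by apply: eq_bigr => i _; rewrite mxE. Qed.

Lemma dot_vsub u mu x : dot u (vsub x mu) = clin (rv u) mu x.
Proof. by apply: eq_bigr => i _; rewrite !mxE tnth_mktuple. Qed.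

Lemma sqnorm_ge0 w : 0 <= sqnorm w.
Proof. by apply: sumr_ge0 => i _; exact: sqr_ge0. Qed.

Lemma dot_sqnorm u : dot u u = sqnorm (rv u).
Proof. by apply: eq_bigr => i _; rewrite mxE expr2. Qed.

Lemma norm2_sqr u : norm2 u ^+ 2 = sqnorm (rv u).
Proof. by rewrite /norm2 sqr_sqrtr dot_sqnorm ?sqnorm_ge0. Qed.

Lemma clinZ a w mu x : clin (a *: w) mu x = a * clin w mu x.
Proof. by rewrite /clin mulr_sumr; apply: eq_bigr => i _; rewrite mxE mulrA. Qed.

Lemma clinD w1 w2 mu x : clin (w1 + w2) mu x = clin w1 mu x + clin w2 mu x.
Proof. by rewrite /clin -big_split; apply: eq_bigr => i _; rewrite mxE mulrDl. Qed.

Lemma measurable_clin w mu : measurable_fun setT (clin w mu).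
Proof. by apply: measurable_sum => i; mfun. Qed.

Lemma measurable_dotr w : measurable_fun setT (dotr w).
Proof. by apply: measurable_sum => i; mfun. Qed.

End linear_forms.

Section second_moments.
Context {R : realType} {d : nat} (P : probability (d.-tuple R) R) (mu : d.-tuple R).
Hypothesis X2 : forall i, (@coordinate R d i) \in Lfun P 2%:E.
Hypothesis Xmu : forall i, 'E_P[coordinate i]%E = (tnth mu i)%:E.
Implicit Types (w : 'rV[R]_d) (x u : d.-tuple R).

Let c i x : R := tnth x i - tnth mu i.

(** Real-valued form of the covariance matrix; see [covariance_mxE]. *)
Definition scatter : 'M[R]_d := \matrix_(i, j) \int[P]_x (c i x * c j x).

Definition qform w : R := \int[P]_x (clin w mu x ^+ 2).

Let c2 i : c i \in Lfun P 2%:E.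
Proof.
have h : (coordinate i \- cst (tnth mu i))%R \in Lfun P 2%:E.
  by rewrite rpredB ?lee1n//= => _; rewrite Lfun_cst.
exact: h.
Qed.

Let c1 i : rintegrable P (c i).
Proof.
by apply/Lfun1_integrable; apply: Lfun_subset12; rewrite ?fin_num_measure.
Qed.

Let cc i j : rintegrable P (fun x => c i x * c j x).
Proof. by apply/Lfun1_integrable; exact: Lfun2_mul_Lfun1. Qed.

Let c0 i : \int[P]_x c i x = 0.
Proof.
have Xi : rintegrable P (coordinate i).
  by apply/Lfun1_integrable; apply: Lfun_subset12; rewrite ?fin_num_measure.
rewrite RintegralB ?Rintegral_prob_cst//; last exact: rintegrable_cst.
by have := Xmu i; rewrite unlock /Rintegral => ->; rewrite subrr.
Qed.

Lemma rintegrable_sum n (f : 'I_n -> d.-tuple R -> R) :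
  (forall i, rintegrable P (f i)) ->
  rintegrable P (fun x => \sum_(i < n) f i x) /\
  \int[P]_x (\sum_(i < n) f i x) = \sum_(i < n) \int[P]_x f i x.
Proof.
elim: n f => [|n IH] f intf.
  have -> : (fun x => \sum_(i < 0) f i x) = (fun=> 0).
    by apply/funext => x; rewrite big_ord0.
  by rewrite big_ord0 Rintegral_prob_cst; split => //; exact: rintegrable_cst.
have [I1 I2] := IH (fun i => f (lift ord0 i)) (fun i => intf _).
have -> : (fun x => \sum_(i < n.+1) f i x) =
    (fun x => f ord0 x + \sum_(i < n) f (lift ord0 i) x).
  by apply/funext => x; rewrite big_ord_recl.
split; first exact: rintegrableD.
by rewrite RintegralD// I2 big_ord_recl.
Qed.

Lemma rintegrable_clin w : rintegrable P (clin w mu).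
Proof.
by apply: (rintegrable_sum (f := fun i x => w 0 i * c i x) _).1 => i; exact: rintegrableZ.
Qed.

Lemma clin_mean w : \int[P]_x clin w mu x = 0.
Proof.
have H i : rintegrable P (fun x => w 0 i * c i x) by exact: rintegrableZ.
rewrite (rintegrable_sum H).2 big1// => i _.
by rewrite RintegralZl// c0 mulr0.
Qed.

Lemma clin_prod w1 w2 :
  rintegrable P (fun x => clin w1 mu x * clin w2 mu x) /\
  \int[P]_x (clin w1 mu x * clin w2 mu x) = (w1 *m scatter *m w2^T) 0 0.
Proof.
have E x : clin w1 mu x * clin w2 mu x =
    \sum_(j < d) \sum_(i < d) (w1 0 i * w2 0 j) * (c i x * c j x).
  rewrite /clin mulrC mulr_suml; apply: eq_bigr => j _.
  by rewrite mulr_sumr; apply: eq_bigr => i _; rewrite /c; ring.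
have H j i : rintegrable P (fun x => (w1 0 i * w2 0 j) * (c i x * c j x)).
  exact: rintegrableZ.
have Hj j := rintegrable_sum (H j).
split.
  rewrite (_ : (fun x => _) = (fun x => \sum_(j < d) \sum_(i < d)
    (w1 0 i * w2 0 j) * (c i x * c j x))); last exact/funext.
  by apply: (rintegrable_sum (f := fun j x => \sum_(i < d) (w1 0 i * w2 0 j) * (c i x * c j x)) _).1 => j; exact: (Hj j).1.
under eq_Rintegral do rewrite E.
rewrite (rintegrable_sum (f := fun j x => \sum_(i < d) (w1 0 i * w2 0 j) * (c i x * c j x)) _).2; last by move=> j; exact: (Hj j).1.
rewrite mxE; apply: eq_bigr => j _; rewrite (Hj j).2 !mxE mulr_suml.
apply: eq_bigr => i _; rewrite RintegralZl// !mxE.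
by rewrite mulrAC.
Qed.

Lemma rintegrable_clin2 w : rintegrable P (fun x => clin w mu x ^+ 2).
Proof. by have := (clin_prod w w).1; under eq_fun do rewrite -expr2. Qed.

Lemma qformE w : qform w = (w *m scatter *m w^T) 0 0.
Proof. by rewrite -(clin_prod w w).2; apply: eq_Rintegral => x _; rewrite expr2. Qed.

Lemma qform_ge0 w : 0 <= qform w.
Proof. by apply: Rintegral_ge0 => x _; exact: sqr_ge0. Qed.

Lemma scatter_sym : scatter^T = scatter.
Proof.
by apply/matrixP => i j; rewrite !mxE; apply: eq_Rintegral => x _; rewrite mulrC.
Qed.

Lemma covariance_mxE : covariance_mx P = scatter.
Proof.
apply/matrixP => i j; rewrite !mxE !unlock; congr fine.
apply: eq_integral => x _ /=.
by have := Xmu i; have := Xmu j; rewrite !unlock => -> ->.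
Qed.

Lemma qformZ a w : qform (a *: w) = a ^+ 2 * qform w.
Proof.
rewrite /qform -RintegralZl//; last exact: rintegrable_clin2.
by apply: eq_Rintegral => x _; rewrite clinZ exprMn.
Qed.

Lemma qformD_le w1 w2 : qform (w1 + w2) <= 2 * qform w1 + 2 * qform w2.
Proof.
rewrite /qform -!RintegralZl//; try exact: rintegrable_clin2.
rewrite -RintegralD//; try by apply: rintegrableZ; exact: rintegrable_clin2.
apply: le_Rintegral => //.
- exact: rintegrable_clin2.
- by apply: rintegrableD; apply: rintegrableZ; exact: rintegrable_clin2.
- move=> x _; rewrite clinD; have := sqr_ge0 (clin w1 mu x - clin w2 mu x); nra.
Qed.

Lemma qform0_clin w : qform w = 0 -> P [set x | clin w mu x != 0] = 0%E.
Proof.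
move=> q0.
have : (\int[P]_x (clin w mu x ^+ 2)%:E = 0)%E.
  by rewrite -fineK_rintegrable; [rewrite -/(qform w) q0|exact: rintegrable_clin2].
have mf : measurable_fun setT (fun x => (clin w mu x ^+ 2)%:E).
  by apply/measurable_EFinP; apply: measurable_funX; exact: measurable_clin.
have -> : (\int[P]_x (clin w mu x ^+ 2)%:E = \int[P]_x `|(clin w mu x ^+ 2)%:E|)%E.
  by apply: eq_integral => x _; rewrite gee0_abs// lee_fin sqr_ge0.
move=> /(ae_eq_integral_abs P measurableT mf)[N [mN PN hN]].
apply/eqP; rewrite eq_le measure_ge0 andbT -PN; apply: le_measure; rewrite ?inE//.
  rewrite (_ : [set _ | _] = ~` [set x | clin w mu x == 0]); last first.
    by apply/seteqP; split => x /= /negP.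
  apply: measurableC; rewrite -[X in measurable X]setTI.
  have := measurable_fun_eqr (@measurable_clin _ _ w mu) (measurable_cst (0 : R)).
  by move=> /(_ measurableT [set true]); apply.
move=> x /= hx; apply: hN => /= /(_ I)[] /eqP.
by rewrite sqrf_eq0 (negbTE hx).
Qed.

End second_moments.

(** * The Rayleigh bound *)

Section rayleigh.
Context {R : realType} {d : nat}.
Implicit Types (w c : 'rV[R]_d) (S M : 'M[R]_d).

Definition qf M w : R := (w *m M *m w^T) 0 0.

Lemma sqnormE w : sqnorm w = (w *m w^T) 0 0.
Proof. by rewrite mxE; apply: eq_bigr => i _; rewrite mxE expr2. Qed.

Lemma sqnorm_eq0 w : sqnorm w = 0 -> w = 0.
Proof.
move=> /eqP; rewrite psumr_eq0; last by move=> i _; exact: sqr_ge0.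
move=> /allP h; apply/rowP => i; rewrite mxE.
by apply/eqP; rewrite -sqrf_eq0; apply: h; rewrite mem_index_enum.
Qed.

Lemma qfD M w c t : M^T = M ->
  qf M (c + t *: w) = qf M c + 2 * t * (c *m M *m w^T) 0 0 + t ^+ 2 * qf M w.
Proof.
move=> sM; rewrite /qf linearD linearZ/= mulmxDl mulmxDl mulmxDr mulmxDr.
rewrite -!scalemxAl -!scalemxAr !mxE.
have -> : \sum_j (w *m M) 0 j * c^T j 0 = \sum_j (c *m M) 0 j * w^T j 0.
  have E : (w *m M *m c^T)^T = c *m M *m w^T.
    by rewrite !trmx_mul trmxK sM mulmxA.
  by have := congr1 (fun A : 'M[R]_1 => A 0 0) E; rewrite !mxE.
ring.
Qed.

(** Perturb c in the direction - c M: if c M were nonzero, the first-order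
    term - 2 t |c M|^2 would make the form negative for small t. *)
Lemma psd_kernel M c : M^T = M -> (forall w, 0 <= qf M w) -> qf M c = 0 ->
  c *m M = 0.
Proof.
move=> sM psd c0; apply: sqnorm_eq0; set w := c *m M.
have b0 := sqnorm_ge0 w; have q0 := psd w.
set b := sqnorm w in b0 *; set q := qf M w in q0 *.
(* t = b / (q + 1) is small enough for the linear term to win *)
have : 0 <= qf M (c + (- (b / (q + 1))) *: w) by exact: psd.
rewrite qfD// c0 -/w -sqnormE -/b -/q.
have q1 : 0 < q + 1 by lra.
have -> : 0 + 2 * (- (b / (q + 1))) * b + (- (b / (q + 1))) ^+ 2 * q =
   - (b ^+ 2 * (q + 2) / (q + 1) ^+ 2).
  by field; rewrite gt_eqF.
rewrite oppr_ge0 pmulr_lle0 ?invr_gt0 ?exprn_gt0//.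
rewrite pmulr_lle0; last lra.
by move=> h; apply/eqP; rewrite -sqrf_eq0 eq_le h sqr_ge0.
Qed.

Lemma continuous_bigsum (T : topologicalType) n (f : 'I_n -> T -> R) :
  (forall i, continuous (f i)) -> continuous (fun x => \sum_(i < n) f i x).
Proof.
elim: n f => [|n IH] f cf.
  rewrite (_ : (fun x => _) = (fun=> 0)); first by move=> x; exact: cvg_cst.
  by apply/funext => x; rewrite big_ord0.
rewrite (_ : (fun x => _) =
    (fun x => f ord0 x + \sum_(i < n) f (lift ord0 i) x)).
  move=> x; apply: cvgD; first exact: cf.
  by apply: (IH (fun i => f (lift ord0 i))) => i; exact: cf.
by apply/funext => x; rewrite big_ord_recl.
Qed.

Lemma continuous_sqnorm : continuous (@sqnorm R d).
Proof.
apply: continuous_bigsum => i w.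
apply: (cvg_comp (fun w : 'rV[R]_d => w 0 i) (fun y : R => y ^+ 2)).
  exact: coord_continuous.
exact: exprn_continuous.
Qed.

Lemma continuous_qf M : continuous (qf M).
Proof.
rewrite (_ : qf M = fun w => \sum_(j < d) \sum_(i < d) w 0 i * M i j * w 0 j).
  apply: continuous_bigsum => j; apply: continuous_bigsum => i w.
  have cc l : continuous (fun w : 'rV[R]_d => w 0 l).
    by move=> v; exact: coord_continuous.
  apply: (@continuousM _ _ (fun w => w 0 i * M i j) (fun w => w 0 j)); last exact: cc.
  by apply: (@continuousM _ _ (fun w => w 0 i) (fun=> M i j)); [exact: cc|exact: cst_continuous].
apply/funext => w; rewrite /qf mxE; apply: eq_bigr => j _.
by rewrite !mxE mulr_suml.
Qed.

Lemma compact_unit_sphere : compact [set w : 'rV[R]_d | sqnorm w = 1].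
Proof.
have cbox := @rV_compact R d (fun=> `[(-1), 1]%classic)
  (fun=> @segment_compact R (-1) 1).
apply: (subclosed_compact _ cbox).
  apply: (@closed_comp _ _ (@sqnorm R d) [set 1]); last exact: closed_eq.
  by move=> w _; exact: continuous_sqnorm.
move=> w /= w1 i; rewrite in_itv/= -ler_norml.
have : `|w ord0 i| ^+ 2 <= 1.
  rewrite -w1 /sqnorm (bigD1 i)//= -normrX ger0_norm ?sqr_ge0//.
  by rewrite lerDl sumr_ge0// => j _; exact: sqr_ge0.
by rewrite -[X in _ <= X](expr1n _ 2) ler_pXn2r// nnegrE.
Qed.

Lemma qfZ M a w : qf M (a *: w) = a ^+ 2 * qf M w.
Proof. by rewrite /qf linearZ/= -!scalemxAl -scalemxAr !mxE mulrA. Qed.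

Lemma sqnormZ a w : sqnorm (a *: w) = a ^+ 2 * sqnorm w.
Proof. by rewrite /sqnorm mulr_sumr; apply: eq_bigr => i _; rewrite mxE exprMn. Qed.

(** The quadratic form attains its maximum a over the unit sphere at some c;
    by [psd_kernel] applied to a%:M - S, c is an eigenvector, so a is an
    eigenvalue.  Since [lambda_max] is a supremum, one also needs that the
    eigenvalues are bounded, which a itself provides. *)
Theorem rayleigh_bound S w : (0 < d)%N -> S^T = S ->
  qf S w <= lambda_max S * sqnorm w.
Proof.
move=> d0 sS.
have [c] : exists2 c, c \in [set w : 'rV[R]_d | sqnorm w = 1] &
    forall t, t \in [set w : 'rV[R]_d | sqnorm w = 1] -> qf S t <= qf S c.
  apply: compact_EVT_max; last 2 first.
  - exact: compact_unit_sphere.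
  - by apply: continuous_subspaceT; exact: continuous_qf.
  exists (delta_mx 0 (Ordinal d0)); rewrite /= /sqnorm (bigD1 (Ordinal d0))//=.
  rewrite mxE !eqxx expr1n big1 ?addr0// => i /negPf h.
  by rewrite mxE h andbF expr0n.
rewrite inE /= => c1 cmax; set a := qf S c in cmax.
have bound v : qf S v <= a * sqnorm v.
  have [->|v0] := eqVneq v 0.
    by rewrite /qf /sqnorm !mul0mx mxE big1 ?mulr0// => i _; rewrite mxE expr0n.
  have n0 : 0 < sqnorm v.
    rewrite lt_neqAle sqnorm_ge0 andbT eq_sym; apply: contra_neq v0.
    exact: sqnorm_eq0.
  have s0 : 0 < Num.sqrt (sqnorm v) by rewrite sqrtr_gt0.
  have := cmax ((Num.sqrt (sqnorm v))^-1 *: v).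
  rewrite inE /= sqnormZ qfZ exprVn (sqr_sqrtr (sqnorm_ge0 v)) (mulVf (lt0r_neq0 n0)) => /(_ erefl).
  by rewrite ler_pdivrMl// mulrC.
have a_eig : eigenvalue S a.
  apply/eigenvalueP; exists c; last first.
    apply/eqP => c0; move: c1; rewrite c0 /sqnorm big1.
      by move=> /eqP; rewrite eq_sym oner_eq0.
    by move=> i _; rewrite mxE expr0n.
  have qfa v : qf (a%:M - S) v = a * sqnorm v - qf S v.
    rewrite /qf mulmxBr mulmxBl mul_mx_scalar -scalemxAl sqnormE.
    by rewrite [LHS]mxE [X in X + _]mxE [X in _ + X = _]mxE.
  have : c *m (a%:M - S) = 0.
    apply: psd_kernel.
    - by rewrite linearB/= tr_scalar_mx sS.
    - by move=> v; rewrite qfa subr_ge0.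
    - by rewrite qfa c1 mulr1 subrr.
  by rewrite mulmxBr mul_mx_scalar => /eqP; rewrite subr_eq0 => /eqP.
have a_le : a <= lambda_max S.
  apply: ub_le_sup => //; exists a => b /eigenvalueP[v vb v0].
  have n0 : 0 < sqnorm v.
    rewrite lt_neqAle sqnorm_ge0 andbT eq_sym; apply: contra_neq v0.
    exact: sqnorm_eq0.
  have := bound v; rewrite {1}/qf vb -scalemxAl mxE -sqnormE.
  by rewrite ler_pM2r.
apply: (le_trans (bound w)); rewrite ler_wpM2r//.
exact: sqnorm_ge0.
Qed.

End rayleigh.

(** * One-dimensional projections of a law in the class *)

Section Pclass_facts.
Context {R : realType} {d : nat} (P : probability (d.-tuple R) R).
Variables (L : R) (mu : d.-tuple R).
Hypothesis HP : Pclass L mu P.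
Hypothesis L0 : 0 <= L.
Implicit Types (w : 'rV[R]_d) (x : d.-tuple R).

Let X2 i : (@coordinate R d i) \in Lfun P 2%:E.
Proof. by case: HP => _ h _ _; exact: h. Qed.

Let Xmu i : 'E_P[coordinate i]%E = (tnth mu i)%:E.
Proof. by case: HP => _ _ h _; exact: h. Qed.

Let atomless x : P [set x] = 0%E.
Proof. by case: HP => h _ _ _; exact: h. Qed.

Notation q := (qform P mu).

(** Unfolds the ratio of norms; strict positivity of q excludes the degenerate
    directions, where the ratio carries no information. *)
Lemma third_moment_unit w : sqnorm w = 1 -> 0 < q w ->
  (\int[P]_x (`|clin w mu x| ^+ 3)%:E <= (L * Num.sqrt (q w) ^+ 3)%:E)%E.
Proof.
move=> w1 q0; have [_ _ _ hr] := HP.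
pose u : d.-tuple R := [tuple w 0 i | i < d].
have ru : rv u = w by apply/rowP => i; rewrite mxE tnth_mktuple.
have us : sphere u by rewrite /sphere /= /norm2 dot_sqnorm ru w1 sqrtr1.
have := ereal_sup_ubound (ex_intro2 _ _ u us erefl : [set moment_ratio P mu u | u in sphere] (moment_ratio P mu u)).
move=> /le_trans/(_ hr); rewrite /moment_ratio.
have -> : (fun x => (dot u (vsub x mu))%:E) = (fun x => (clin w mu x)%:E).
  by apply/funext => x; rewrite dot_vsub ru.
set s := Num.sqrt (q w).
have s0 : 0 < s by rewrite sqrtr_gt0.
have N2 : (Lnorm P 2%:E (fun x => (clin w mu x)%:E) = s%:E)%E.
  rewrite unlock.
  under eq_integral do rewrite /= powR_mulrn// -normrX ger0_norm ?sqr_ge0//.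
  rewrite -fineK_rintegrable; last exact: rintegrable_clin2.
  by rewrite -/(q w) poweR_EFin powR12_sqrt// ltW.
rewrite N2 inver gt_eqF// lee_pdivrMr//.
set I3 := (\int[P]_x (`|clin w mu x| ^+ 3)%:E)%E.
have I30 : (0 <= I3)%E by apply: integral_ge0 => x _; rewrite lee_fin exprn_ge0.
have N3 : (Lnorm P 3%:E (fun x => (clin w mu x)%:E) = I3 `^ 3^-1)%E.
  rewrite unlock; congr (_ `^ _)%E; apply: eq_integral => x _.
  by rewrite /= powR_mulrn.
rewrite N3 -EFinM => h.
have -> : I3 = ((I3 `^ 3^-1) `^ 3)%E by rewrite -poweRrM mulVf// poweRe1.
apply: (@le_trans _ _ ((L `^ 3^-1 * s)%:E `^ 3)%E).
  apply: gt0_ler_poweR => //.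
  - by rewrite in_itv/= leey poweR_ge0.
  - by rewrite in_itv/= leey lee_fin mulr_ge0 ?powR_ge0 ?ltW.
have cs0 : 0 <= L `^ 3^-1 * s by rewrite mulr_ge0 ?powR_ge0// ltW.
rewrite poweR_EFin lee_fin powR_mulrn// exprMn.
by rewrite -[(L `^ _) ^+ 3]powR_mulrn ?powR_ge0// -powRrM mulVf// powRr1.
Qed.

(** The moment ratio is scale invariant, so the bound passes from the sphere
    to every direction. *)
Lemma Pclass_standardized w : 0 < q w ->
  standardized P L (fun x => (Num.sqrt (q w))^-1 * clin w mu x).
Proof.
move=> q0; set s := Num.sqrt (q w).
have s0 : 0 < s by rewrite sqrtr_gt0.
split.
- by apply: measurable_funM => //; exact: measurable_clin.
- rewrite RintegralZl//; first by rewrite clin_mean// mulr0.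
  exact: rintegrable_clin.
- under eq_Rintegral do rewrite exprMn.
  rewrite RintegralZl//; last exact: rintegrable_clin2.
  by rewrite exprVn sqr_sqrtr ?(ltW q0)// mulVf// gt_eqF.
have w0 : 0 < sqnorm w.
  rewrite lt_neqAle sqnorm_ge0 andbT eq_sym; apply/eqP => /sqnorm_eq0 w0.
  move: q0; rewrite w0 qformE// !mul0mx mxE ltxx//.
set r := Num.sqrt (sqnorm w).
have r0 : 0 < r by rewrite sqrtr_gt0.
pose w' := r^-1 *: w.
have w'1 : sqnorm w' = 1.
  by rewrite sqnormZ exprVn sqr_sqrtr ?(ltW w0)// mulVf// gt_eqF.
have q'E : q w' = (r^-1) ^+ 2 * q w by exact: qformZ.
have q'0 : 0 < q w' by rewrite q'E mulr_gt0// exprn_gt0// invr_gt0.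
have s'E : Num.sqrt (q w') = r^-1 * s.
  by rewrite q'E sqrtrM ?sqr_ge0// sqrtr_sqr ger0_norm// invr_ge0 ltW.
have := third_moment_unit w'1 q'0; rewrite s'E => h.
have -> : (\int[P]_x (`|s^-1 * clin w mu x| ^+ 3)%:E =
    \int[P]_x (((r / s) ^+ 3)%:E * (`|clin w' mu x| ^+ 3)%:E))%E.
  apply: eq_integral => x _; rewrite -EFinM -exprMn clinZ; congr ((_ ^+ 3)%:E).
  rewrite -[r / s]ger0_norm ?divr_ge0 ?ltW// -normrM; congr (`| _ |).
  by field; rewrite !gt_eqF.
rewrite ge0_integralZl//; first last.
- by rewrite lee_fin exprn_ge0// divr_ge0// ltW.
- by apply/measurable_EFinP; apply: measurable_funX; apply: (measurableT_comp (@normr_measurable _ setT)); exact: measurable_clin.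
apply: (@le_trans _ _ (((r / s) ^+ 3)%:E * (L * (r^-1 * s) ^+ 3)%:E)%E).
  by apply: lee_wpmul2l => //; rewrite lee_fin exprn_ge0// divr_ge0// ltW.
by rewrite -EFinM lee_fin le_eqVlt; apply/orP; left; apply/eqP; field; rewrite !gt_eqF.
Qed.

(** Let S be the covariance.  If q(x + s) = 0 = q(x' + s) then y = x - x' is
    in the kernel of S, i.e. y = D K with K = kermx S.  Every row of K has
    q = 0, so outside a null set B the corresponding linear forms of X are
    constant, whence K y^T = 0 and |y|^2 = D K y^T = 0.  Thus outside B there
    is at most one such x, and a single point has probability 0. *)
Lemma degenerate_shift_null (s : 'rV[R]_d) :
  measurable [set x | q (rv x + s) <= 0] -> P [set x | q (rv x + s) <= 0] = 0%E.
Proof.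
move=> mA; set A := [set x | _] in mA *.
pose S := scatter P mu; pose K := kermx S.
have SE w : q w = qf S w by exact: qformE.
have sS : S^T = S by exact: scatter_sym.
have psd w : 0 <= qf S w by rewrite -SE; exact: qform_ge0.
pose B := \big[setU/set0]_(i < d) [set x | clin (row i K) mu x != 0].
have mBi i : measurable [set x | clin (row i K) mu x != 0].
  rewrite (_ : [set _ | _] = ~` [set x | clin (row i K) mu x == 0]); last first.
    by apply/seteqP; split => x /= /negP.
  apply: measurableC; rewrite -[X in measurable X]setTI.
  have := measurable_fun_eqr (@measurable_clin _ _ (row i K) mu) (measurable_cst (0 : R)).
  by move=> /(_ measurableT [set true]); apply.
have PBi i : P [set x | clin (row i K) mu x != 0] = 0%E.
  apply: qform0_clin => //; rewrite SE /qf -row_mul.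
  have -> : K *m S = 0 by rewrite /K; exact: mulmx_ker.
  by rewrite row0 mul0mx mxE.
have [mB PB] : measurable B /\ P B = 0%E.
  rewrite /B; elim/big_ind: _ => [|A1 A2 [m1 p1] [m2 p2]|i _].
  - by split => //; exact: measure0.
  - split; first exact: measurableU.
    apply/eqP; rewrite eq_le measure_ge0 andbT.
    by apply: (le_trans (measureU2 _ m1 m2)); rewrite [X in (X + _)%E]p1 [X in (_ + X)%E]p2 adde0.
  - by split; [exact: mBi|exact: PBi].
have uniqA x x' : A x -> A x' -> ~ B x -> ~ B x' -> x = x'.
  move=> Ax Ax' Bx Bx'.
  have ker y : A y -> (rv y + s) *m S = 0.
    move=> Ay; apply: psd_kernel => //.
    by apply/eqP; rewrite eq_le psd andbT -SE; exact: Ay.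
  pose y := rv x - rv x'.
  have yS : y *m S = 0.
    have -> : y = (rv x + s) - (rv x' + s) by rewrite /y opprD addrACA subrr addr0.
    by rewrite mulmxBl !ker// subrr.
  have /submxP[D yE] : (y <= K)%MS by apply/sub_kermxP.
  have off z i : ~ B z -> clin (row i K) mu z = 0.
    move=> Bz; apply/eqP/negPn/negP => h; apply: Bz.
    by rewrite /B (bigD1 i)//=; left.
  have Ky : K *m y^T = 0.
    apply/matrixP => i j; rewrite (ord1 j) !mxE.
    transitivity (clin (row i K) mu x - clin (row i K) mu x').
      have -> : clin (row i K) mu x - clin (row i K) mu x' =
          dotr (row i K) x - dotr (row i K) x' by rewrite !clinE; ring.
      rewrite /dotr -sumrB.
      by apply: eq_bigr => l _; rewrite !mxE mulrBr.
    by rewrite !off// subrr.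
  have : sqnorm y = 0 by rewrite sqnormE {1}yE -mulmxA Ky mulmx0 mxE.
  move=> /sqnorm_eq0/eqP; rewrite subr_eq0 => /eqP/rowP h.
  by apply: eq_from_tnth => i; have := h i; rewrite !mxE.
have mAB : measurable (A `\` B) by exact: measurableD.
have PAB : P (A `\` B) = 0%E.
  have [[x [Ax Bx]]|no] := pselect (exists x, (A `\` B) x); last first.
    rewrite (_ : A `\` B = set0) ?measure0//.
    by apply/seteqP; split => // x hx; apply: no; exists x.
  rewrite (_ : A `\` B = [set x]) ?atomless//.
  apply/seteqP; split => [y [Ay By]|y ->]; last by split.
  exact: uniqA.
apply/eqP; rewrite eq_le measure_ge0 andbT.
apply: (@le_trans _ _ (P ((A `\` B) `|` B))).
  apply: le_measure; rewrite ?inE//; first exact: measurableU.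
  by move=> x Ax; have [Bx|Bx] := pselect (B x); [right|left].
by apply: (le_trans (measureU2 _ mAB mB)); rewrite [X in (X + _)%E]PAB [X in (_ + X)%E]PB adde0.
Qed.

End Pclass_facts.

(** * Splitting the sample *)

Section split_sample.
Context {R : realType} {d : nat}.
Local Notation X := (d.-tuple R).

Definition vbar k (y : k.-tuple X) : 'rV[R]_d :=
  \row_i smean (fun x : X => tnth x i) y.

Lemma measurable_sum_cond d' (T : measurableType d') n (p : pred 'I_n)
    (f : 'I_n -> T -> R) :
  (forall i, measurable_fun setT (f i)) ->
  measurable_fun setT (fun t => \sum_(i < n | p i) f i t).
Proof.
move=> mf; rewrite (_ : (fun t => _) =
    (fun t => \sum_(i < n) if p i then f i t else 0)).
  by apply: measurable_sum => i; case: (p i).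
by apply/funext => t; rewrite big_mkcond.
Qed.

Lemma f_mean_cat m k (x : m.-tuple X) (y : k.-tuple X) (t : X) :
  f_mean m (cat_pair (x, y)) t = dotr (vbar y) t.
Proof.
rewrite /f_mean addKn big_split_ord/= big1 ?add0r; last first.
  by move=> i; rewrite leqNgt ltn_ord.
under eq_bigl do rewrite leq_addr.
under eq_bigr do rewrite tnth_rshift.
rewrite /dot exchange_big/= mulr_sumr; apply: eq_bigr => i _.
by rewrite mxE /smean -mulr_suml mulrA.
Qed.

Lemma T_mean_cat m k (x : m.-tuple X) (y : k.-tuple X) :
  T_mean m (cat_pair (x, y)) = tstat (dotr (vbar y)) x.
Proof.
have first_block (F : X -> R) :
    \sum_(i < m + k | (i < m)%N) F (tnth (cat_pair (x, y)) i) =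
    \sum_(i < m) F (tnth x i).
  rewrite big_split_ord/= [X in _ + X]big1 ?addr0; last first.
    by move=> i; rewrite ltnNge leq_addr.
  under eq_bigl do rewrite ltn_ord.
  by apply: eq_bigr => i _; rewrite tnth_lshift.
have fb : fbar_mean m (cat_pair (x, y)) = smean (dotr (vbar y)) x.
  rewrite /fbar_mean /smean (first_block (f_mean m (cat_pair (x, y)))).
  by congr (_ * _); apply: eq_bigr => i _; rewrite f_mean_cat.
rewrite /T_mean /tstat /svar fb.
rewrite (first_block (fun t => (f_mean m (cat_pair (x, y)) t - smean (dotr (vbar y)) x) ^+ 2)).
by under eq_bigr do rewrite f_mean_cat.
Qed.

Lemma measurable_T_mean n m : measurable_fun setT (@T_mean R d n m).
Proof.
have mc (i : 'I_n) (l : 'I_d) :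
    measurable_fun setT (fun Z : n.-tuple X => tnth (tnth Z i) l).
  exact: (measurableT_comp (@measurable_tnth _ R d l) (@measurable_tnth _ X n i)).
have mf i : measurable_fun setT (fun Z : n.-tuple X => f_mean m Z (tnth Z i)).
  apply: measurable_funM => //; apply: measurable_sum_cond => j.
  by apply: measurable_sum => l; apply: measurable_funM.
have mfb : measurable_fun setT (@fbar_mean R d n m).
  by apply: measurable_funM => //; exact: measurable_sum_cond.
apply: measurable_funM; first exact: measurable_funM.
apply: (measurableT_comp measurable_inv_sqrt); apply: measurable_funM => //.
apply: measurable_sum_cond => j.
by apply: measurable_funX; exact: measurable_funB.
Qed.

Lemma measurable_qf_comp d' (T : measurableType d') (M : 'M[R]_d) (V : T -> 'rV[R]_d) :
  (forall i, measurable_fun setT (fun t => V t 0 i)) ->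
  measurable_fun setT (fun t => qf M (V t)).
Proof.
move=> mV; rewrite (_ : (fun t => _) =
    (fun t => \sum_(j < d) \sum_(i < d) V t 0 i * M i j * V t 0 j)).
  apply: measurable_sum => j; apply: measurable_sum => i.
  by apply: measurable_funM => //; apply: measurable_funM.
apply/funext => t; rewrite /qf mxE; apply: eq_bigr => j _.
by rewrite !mxE mulr_suml.
Qed.

Lemma measurable_vbar k i : measurable_fun setT (fun y : k.-tuple X => vbar y 0 i).
Proof.
under eq_fun do rewrite mxE.
by apply: measurable_smean; exact: measurable_tnth.
Qed.

End split_sample.

Lemma probability_integral_indic {R : realType} dT (T : measurableType dT)
    (P : probability T R) (A : set T) : measurable A ->
  P A = (\int[P]_x (\1_A x)%:E)%E.
Proof. by move=> mA; rewrite integral_indic// setIT. Qed.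

Section conditioning.
Context {R : realType} dT {T : measurableType dT} (P : probability T R).

(** Used with a bad event on which nothing is known and off which the
    conditional probability given the second block is at most c. *)
Lemma split_conditional_le m k (A : set ((m + k).-tuple T)) (Bad : set (k.-tuple T)) (c : R) :
  measurable A -> measurable Bad -> 0 <= c ->
  (forall y, ~ Bad y ->
    fine (iid_law P m [set x | A (cat_pair (x, y))]) <= c) ->
  fine (iid_law P (m + k) A) <= c + fine (iid_law P k Bad).
Proof.
move=> mA mBad c0 h.
have mA1 : measurable_fun setT (fun X => (\1_A X)%:E : \bar R).
  by apply/measurable_EFinP; exact: measurable_indic.
have sec y : measurable [set x | A (cat_pair (x, y))].
  have := measurableT_comp (@measurable_cat_pair _ T m k) (pair2_measurable y).
  by move=> /(_ measurableT A mA); rewrite setTI.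
rewrite -lee_fin EFinD !fineK ?fin_num_measure//.
rewrite (probability_integral_indic _ mA) ge0_integral_iidD//.
apply: (@le_trans _ _ (\int[iid_law P k]_y (c%:E + (\1_Bad y)%:E))%E).
  apply: ge0_le_integral => //.
  - by move=> y _; apply: integral_ge0 => x _; rewrite lee_fin.
  - apply: (measurable_fun_fubini_tonelli_G (fun p => (\1_A (cat_pair p))%:E)).
      exact: (measurableT_comp mA1 (@measurable_cat_pair _ T m k)).
    by move=> p; rewrite lee_fin.
  - by apply: emeasurable_funD => //; apply/measurable_EFinP; exact: measurable_indic.
  move=> y _.
  have -> : (\int[iid_law P m]_x (\1_A (cat_pair (x, y)))%:E =
      iid_law P m [set x | A (cat_pair (x, y))])%E.
    rewrite (probability_integral_indic _ (sec y)).
    apply: eq_integral => x _; congr EFin; rewrite !indicE; congr (nat_of_bool _)%:R.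
  rewrite indicE; case: (boolP (y \in Bad)) => [_|/negP yB].
    apply: (@le_trans _ _ 1%E); first exact: probability_le1.
    by rewrite -EFinD lee_fin lerDr.
  rewrite adde0 -[leLHS]fineK ?fin_num_measure// lee_fin; apply: h => By.
  by apply: yB; rewrite inE.
rewrite ge0_integralD//; last first.
- by apply/measurable_EFinP; exact: measurable_indic.
by rewrite integral_cst//= probability_setT mule1 -probability_integral_indic.
Qed.

End conditioning.

Section degenerate.
Context {R : realType} {d : nat} (P : probability (d.-tuple R) R).
Variables (L : R) (mu : d.-tuple R).
Hypothesis HP : Pclass L mu P.

Let X2 i : (@coordinate R d i) \in Lfun P 2%:E.
Proof. by case: HP => _ h _ _; exact: h. Qed.

Lemma measurable_qform_vbar k :
  measurable_fun setT (fun y : k.-tuple (d.-tuple R) => qform P mu (vbar y)).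
Proof.
under eq_fun do rewrite qformE//.
by apply: measurable_qf_comp => i; exact: measurable_vbar.
Qed.

(** Given all but one observation of the block, the remaining one has to
    satisfy the condition of [degenerate_shift_null]. *)
Lemma vbar_degenerate_null k : (0 < k)%N ->
  iid_law P k [set y | qform P mu (vbar y) <= 0] = 0%E.
Proof.
case: k => // k _.
set A := [set y | _].
have mA : measurable A by apply: measurable_le_set; exact: measurable_qform_vbar.
have mA1 : measurable_fun setT (fun y => (\1_A y)%:E : \bar R).
  by apply/measurable_EFinP; exact: measurable_indic.
rewrite (probability_integral_indic _ mA) ge0_integral_iidS//.
have mc : measurable_fun setT (fun p => (\1_A (@cons_pair _ (d.-tuple R) k p))%:E : \bar R).
  exact: (measurableT_comp mA1 (@measurable_cons_pair _ _ k)).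
rewrite (fubini_tonelli (fun p => (\1_A (@cons_pair _ (d.-tuple R) k p))%:E))//.
apply: integral0_eq => w _ /=.
pose s : 'rV[R]_d := \sum_(j < k) rv (tnth w j).
have vE a : vbar (cons_pair (a, w)) = k.+1%:R^-1 *: (rv a + s).
  apply/rowP => i; rewrite !mxE /smean (sum_cons_pair (fun x : d.-tuple R => tnth x i)) summxE; congr (_ * (_ + _)).
  by apply: eq_bigr => j _; rewrite mxE.
have AE a : A (cons_pair (a, w)) <-> qform P mu (rv a + s) <= 0.
  rewrite /A /= vE qformZ//.
  by rewrite pmulr_rle0// exprn_gt0// invr_gt0.
have mS : measurable [set a | qform P mu (rv a + s) <= 0].
  apply: measurable_le_set; under eq_fun do rewrite qformE//.
  apply: measurable_qf_comp => i; under eq_fun do rewrite !mxE.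
  by apply: measurable_funD => //; exact: measurable_tnth.
rewrite -(degenerate_shift_null HP mS) (probability_integral_indic _ mS).
apply: eq_integral => a _; congr EFin; rewrite !indicE; congr (nat_of_bool _)%:R.
apply/idP/idP => /set_mem.
  by move=> /(AE a).1 /mem_set.
by move=> /(AE a).2 /mem_set.
Qed.

End degenerate.

(** * Level and power, uniformly in the law and the dimension *)

Section conditional_tests.
Context {R : realType}.

(** Exhibits w.X as an affine function of a standardized variable. *)
Lemma dotr_standardize d (P : probability (d.-tuple R) R) mu (v : 'rV[R]_d) :
  0 < qform P mu v ->
  dotr v = fun t => dotr v mu + Num.sqrt (qform P mu v) *
    ((Num.sqrt (qform P mu v))^-1 * clin v mu t).
Proof.
move=> q0; apply/funext => t; rewrite mulrA mulfV ?gt_eqF ?sqrtr_gt0// mul1r.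
by rewrite clinE addrC subrK.
Qed.

(** The upper bound is the conditional estimate integrated; the lower one is
    the same applied to the complement, so that the bad event is always added
    and never subtracted. *)
Theorem uniform_null_level (L z e : R) : 0 <= L -> 0 < e ->
  exists N : nat, forall m k d (P : probability (d.-tuple R) R),
  (N <= m)%N -> (0 < m)%N -> (0 < k)%N -> Pclass L (@vec0 R d) P ->
  `|fine (iid_law P (m + k) [set X | z < T_mean m X]) - (1 - Phi z)| <= e.
Proof.
move=> L0 e0; have [N hN] := uniform_studentized_clt z L0 e0.
exists N => m k d P /hN H m0 k0 HP.
pose Bad := [set y : k.-tuple (d.-tuple R) | qform P (@vec0 R d) (vbar y) <= 0].
have mBad : measurable Bad.
  exact: (measurable_le_set 0 (measurable_qform_vbar (k := k) HP)).
have Bad0 : fine (iid_law P k Bad) = 0 by rewrite (vbar_degenerate_null HP k0).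
have T0 (v : 'rV[R]_d) (x : m.-tuple (d.-tuple R)) : 0 < qform P (@vec0 R d) v ->
    tstat (dotr v) x =
    tstat (fun t => (Num.sqrt (qform P (@vec0 R d) v))^-1 * clin v (@vec0 R d) t) x.
  move=> q0; rewrite {1}(dotr_standardize q0) tstat_affine// ?sqrtr_gt0//.
  have -> : dotr v (@vec0 R d) = 0.
    by rewrite /dotr big1// => i _; rewrite tnth_mktuple mulr0.
  by rewrite mulr0 mul0r add0r.
have inner y : ~ Bad y ->
    `|fine (iid_law P m [set x | z < T_mean m (cat_pair (x, y))]) - (1 - Phi z)| <= e.
  move=> /negP; rewrite -ltNge => q0.
  have := H _ _ _ _ (Pclass_standardized HP L0 q0).
  by under [in X in _ -> X]eq_set do rewrite T_mean_cat T0//.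
have mA : measurable [set X : (m + k).-tuple (d.-tuple R) | z < T_mean m X].
  by apply: measurable_gt_set; exact: measurable_T_mean.
have /andP[P0 P1] := Phi_ge0_le1 z.
rewrite ler_norml; apply/andP; split.
- have : fine (iid_law P (m + k) (~` [set X | z < T_mean m X])) <= Phi z + e + fine (iid_law P k Bad).
    apply: split_conditional_le => //; first exact: measurableC.
      by rewrite addr_ge0// ltW.
    move=> y /inner.
    have -> : [set x : m.-tuple (d.-tuple R) | (~` [set X | z < T_mean m X]) (cat_pair (x, y))] =
      ~` [set x | z < T_mean m (cat_pair (x, y))] by [].
    rewrite probability_setC; last first.
      under eq_set do rewrite T_mean_cat.
      by apply: measurable_gt_set; apply: measurable_tstat; exact: measurable_dotr.
    rewrite fineB ?fin_num_measure//; last first.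
      under eq_set do rewrite T_mean_cat.
      by apply: measurable_gt_set; apply: measurable_tstat; exact: measurable_dotr.
    by rewrite ler_norml => /andP[/= h _]; lra.
  rewrite Bad0 probability_setC// fineB ?fin_num_measure//= => h; lra.
- have : fine (iid_law P (m + k) [set X | z < T_mean m X]) <=
      1 - Phi z + e + fine (iid_law P k Bad).
    apply: split_conditional_le => //; first by rewrite addr_ge0 ?subr_ge0 ?(ltW e0).
    by move=> y /inner; rewrite ler_norml => /andP[_ h]; lra.
  by rewrite Bad0; lra.
Qed.

(** The second blocks for which the drift sqrt m (v.mu) / sqrt q(v) does not
    exceed B, written without division, together with the degenerate ones. *)
Definition weak_signal d m k (P : probability (d.-tuple R) R) mu (B : R) :
    set (k.-tuple (d.-tuple R)) :=
  [set y | qform P mu (vbar y) <= 0] `|`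
  [set y | Num.sqrt m%:R * dotr (vbar y) mu <= B * Num.sqrt (qform P mu (vbar y))].

Lemma measurable_dotr_vbar d k mu :
  measurable_fun setT (fun y : k.-tuple (d.-tuple R) => dotr (vbar y) mu).
Proof.
apply: measurable_sum => i; apply: measurable_funM => //; exact: measurable_vbar.
Qed.

Lemma measurable_weak_signal d m k (P : probability (d.-tuple R) R) L mu B :
  Pclass L mu P -> measurable (@weak_signal d m k P mu B).
Proof.
move=> HP; have mq := measurable_qform_vbar (k := k) HP.
apply: measurableU; first exact: measurable_le_set.
rewrite (_ : [set _ | _] = [set y | Num.sqrt m%:R * dotr (vbar y) mu -
    B * Num.sqrt (qform P mu (vbar y)) <= 0]); last first.
  by apply/seteqP; split => y /=; rewrite subr_le0.
apply: measurable_le_set; apply: measurable_funB; apply: measurable_funM => //.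
  exact: measurable_dotr_vbar.
exact: (measurableT_comp measurable_sqrt).
Qed.

Theorem uniform_power (L z e : R) : 0 <= L -> 0 < e ->
  exists (N : nat) (B : R), 0 < B /\
  forall m k d (P : probability (d.-tuple R) R) mu,
  (N <= m)%N -> (0 < m)%N -> (0 < k)%N -> Pclass L mu P ->
  fine (iid_law P (m + k) [set X | T_mean m X <= z]) <=
  e + fine (iid_law P k (weak_signal m P mu B)).
Proof.
move=> L0 e0; have [N [B hN]] := uniform_shifted_power z L0 e0.
exists N, (`|B| + 1); split; first by rewrite ltr_wpDl.
move=> m k d P mu /hN H m0 k0 HP.
have mA : measurable [set X : (m + k).-tuple (d.-tuple R) | T_mean m X <= z].
  by apply: measurable_le_set; exact: measurable_T_mean.
apply: split_conditional_le => //; [exact: measurable_weak_signal HP|exact: ltW|].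
move=> y /= Wy.
have q0 : 0 < qform P mu (vbar y).
  by rewrite ltNge; apply/negP => h; apply: Wy; left.
have s0 : 0 < Num.sqrt (qform P mu (vbar y)) by rewrite sqrtr_gt0.
have hB : B <= Num.sqrt m%:R * dotr (vbar y) mu / Num.sqrt (qform P mu (vbar y)).
  rewrite ler_pdivlMr// leNgt; apply/negP => h; apply: Wy; right => /=.
  apply: (le_trans (ltW h)); rewrite ler_pM2r//.
  by apply: (le_trans (ler_norm B)); rewrite lerDl.
have := H _ _ _ _ (Pclass_standardized HP L0 q0) _ hB.
have tE (x : m.-tuple (d.-tuple R)) : T_mean m (cat_pair (x, y)) =
    (Num.sqrt m%:R * dotr (vbar y) mu / Num.sqrt (qform P mu (vbar y)) +
    Num.sqrt m%:R * smean (fun x => (Num.sqrt (qform P mu (vbar y)))^-1 *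
      clin (vbar y) mu x) x) /
    Num.sqrt (svar (fun x => (Num.sqrt (qform P mu (vbar y)))^-1 *
      clin (vbar y) mu x) x).
  by rewrite T_mean_cat {1}(dotr_standardize q0) tstat_affine.
by under [in X in _ -> X]eq_set do rewrite tE.
Qed.

(** * The probability of a weak signal *)

Section weak_signal_bound.
Context {d : nat} (P : probability (d.-tuple R) R).
Variables (L : R) (mu : d.-tuple R) (lambda : R).
Hypothesis HP : Pclass L mu P.
Hypothesis qle : forall w, qform P mu w <= lambda * sqnorm w.
Hypothesis lambda0 : 0 <= lambda.

Let X2 i : (@coordinate R d i) \in Lfun P 2%:E.
Proof. by case: HP => _ h _ _; exact: h. Qed.

Let Xmu i : 'E_P[coordinate i]%E = (tnth mu i)%:E.
Proof. by case: HP => _ _ h _; exact: h. Qed.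

Notation r := (sqnorm (rv mu)).

Lemma smean_dotr k (y : k.-tuple (d.-tuple R)) (u : d.-tuple R) :
  smean (dotr (rv u)) y = dotr (vbar y) u.
Proof.
rewrite /smean /dotr exchange_big/= mulr_sumr; apply: eq_bigr => i _.
by rewrite -mulr_sumr !mxE /smean; ring.
Qed.

Lemma smean_clin k (y : k.-tuple (d.-tuple R)) (w : 'rV[R]_d) : (0 < k)%N ->
  smean (clin w mu) y = smean (dotr w) y - dotr w mu.
Proof.
move=> k0.
have -> : clin w mu = fun t => - dotr w mu + 1 * dotr w t.
  by apply/funext => t; rewrite clinE mul1r addrC.
by rewrite smean_affine// mul1r addrC.
Qed.

Lemma dotr_rvC (u x : d.-tuple R) : dotr (rv u) x = dotr (rv x) u.
Proof. by apply: eq_bigr => i _; rewrite !mxE mulrC. Qed.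

Lemma dotr_rv_sqnorm : dotr (rv mu) mu = r.
Proof. by rewrite -dot_sqnorm dot_rv. Qed.

(** Exchanging the two arguments of the scalar product makes v - mu, a mean of
    k i.i.d. terms, the sample mean of a linear form with coefficients x - mu. *)
Lemma clin_vbar_swap k (y : k.-tuple (d.-tuple R)) (x : d.-tuple R) : (0 < k)%N ->
  clin (vbar y - rv mu) mu x = smean (clin (rv x - rv mu) mu) y.
Proof.
move=> k0; rewrite smean_clin// clinE.
have E (w1 w2 : 'rV[R]_d) t : dotr (w1 - w2) t = dotr w1 t - dotr w2 t.
  by rewrite /dotr -sumrB; apply: eq_bigr => i _; rewrite !mxE mulrBl.
have -> : dotr (rv x - rv mu) = fun t => dotr (rv x) t - dotr (rv mu) t.
  by apply/funext => t; exact: E.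
have -> : smean (fun t => dotr (rv x) t - dotr (rv mu) t) y =
    smean (dotr (rv x)) y - smean (dotr (rv mu)) y.
  by rewrite /smean -mulrBr -sumrB.
by rewrite !E !smean_dotr (dotr_rvC mu x); ring.
Qed.

Lemma sqnorm_centered_int :
  (\int[P]_x (sqnorm (rv x - rv mu))%:E <= (d%:R * lambda)%:E)%E.
Proof.
have cE i x : (rv x - rv mu) 0 i = clin (delta_mx 0 i : 'rV[R]_d) mu x.
  rewrite !mxE /clin (bigD1 i)//= mxE !eqxx mul1r big1 ?addr0// => j /negPf h.
  by rewrite mxE h andbF mul0r.
have E x : sqnorm (rv x - rv mu) =
    \sum_(i < d) clin (delta_mx 0 i : 'rV[R]_d) mu x ^+ 2.
  by apply: eq_bigr => i _; rewrite cE.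
have I i : rintegrable P (fun x => clin (delta_mx 0 i : 'rV[R]_d) mu x ^+ 2).
  exact: rintegrable_clin2.
have [I1 I2] := rintegrable_sum I.
under eq_integral do rewrite E.
rewrite -fineK_rintegrable// I2 lee_fin.
rewrite -[d in leRHS]card_ord -sumr_const mulr_suml.
apply: ler_sum => i _; rewrite mul1r.
apply: (le_trans (qle (delta_mx 0 i))).
have -> : sqnorm (delta_mx 0 i : 'rV[R]_d) = 1; last by rewrite mulr1.
rewrite /sqnorm (bigD1 i)//= mxE !eqxx expr1n big1 ?addr0// => j /negPf h.
by rewrite mxE h andbF expr0n.
Qed.

(** With X an independent copy, q(v - mu) = E [((v - mu).(X - mu))^2]; by
    Tonelli the expectation over v is taken first, giving q(X - mu) / k, at
    most lambda |X - mu|^2 / k, and E |X - mu|^2 is a sum of d terms at most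
    lambda.  In other words E q(v - mu) = tr(S^2) / k. *)
Lemma qform_vbar_centered_int k : (0 < k)%N ->
  (\int[iid_law P k]_y (qform P mu (vbar y - rv mu))%:E <=
   (lambda ^+ 2 * d%:R / k%:R)%:E)%E.
Proof.
move=> k0; have k0' : 0 < k%:R :> R by rewrite ltr0n.
pose F (p : k.-tuple (d.-tuple R) * d.-tuple R) : \bar R :=
  (clin (vbar p.1 - rv mu) mu p.2 ^+ 2)%:E.
have mF : measurable_fun setT F.
  apply/measurable_EFinP; apply: measurable_funX; apply: measurable_sum => i.
  apply: measurable_funM; last first.
    by apply: measurable_funB => //; exact: (measurableT_comp (measurable_tnth i) measurable_snd).
  under eq_fun do rewrite !mxE.
  apply: measurable_funB => //.
  apply: (measurableT_comp _ measurable_fst).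
  by apply: measurable_smean; exact: measurable_tnth.
have F0 p : (0 <= F p)%E by rewrite lee_fin sqr_ge0.
have -> : (\int[iid_law P k]_y (qform P mu (vbar y - rv mu))%:E =
    \int[iid_law P k]_y \int[P]_x F (y, x))%E.
  by apply: eq_integral => y _; rewrite fineK_rintegrable//; exact: rintegrable_clin2.
rewrite (fubini_tonelli F)//.
have -> : (\int[P]_x \int[iid_law P k]_y F (y, x) =
    \int[P]_x (qform P mu (rv x - rv mu) / k%:R)%:E)%E.
  apply: eq_integral => x _.
  rewrite -(@smean_second_moment _ _ _ P k (clin (rv x - rv mu) mu))//.
  - by apply: eq_integral => y _; rewrite /F /= clin_vbar_swap.
  - exact: rintegrable_clin.
  - exact: rintegrable_clin2.
  - exact: clin_mean.
have mS : measurable_fun setT (fun x : d.-tuple R => sqnorm (rv x - rv mu)).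
  apply: measurable_sum => i; apply: measurable_funX; under eq_fun do rewrite !mxE.
  by apply: measurable_funB => //; exact: measurable_tnth.
apply: (@le_trans _ _ (\int[P]_x ((lambda / k%:R)%:E * (sqnorm (rv x - rv mu))%:E))%E).
  apply: ge0_le_integral => //.
  - by move=> x _; rewrite lee_fin divr_ge0 ?qform_ge0// ltW.
  - apply/measurable_EFinP; apply: measurable_funM => //.
    under eq_fun do rewrite qformE//.
    apply: measurable_qf_comp => i; under eq_fun do rewrite !mxE.
    by apply: measurable_funB => //; exact: measurable_tnth.
  - by apply: emeasurable_funM => //; exact/measurable_EFinP.
  - by move=> x _; rewrite -EFinM lee_fin mulrAC ler_pM2r ?invr_gt0.
rewrite ge0_integralZl//; last 3 first.
- exact/measurable_EFinP.
- by move=> x _; rewrite lee_fin sqnorm_ge0.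
- by rewrite lee_fin divr_ge0// ltW.
apply: (@le_trans _ _ ((lambda / k%:R)%:E * (d%:R * lambda)%:E)%E).
  apply: lee_wpmul2l; first by rewrite lee_fin divr_ge0// ltW.
  exact: sqnorm_centered_int.
rewrite -EFinM lee_fin le_eqVlt; apply/orP; left; apply/eqP; field.
by rewrite gt_eqF.
Qed.

(** If v.mu > r / 2 and q(v) < t = m r^2 / (4 B^2) then the drift exceeds B.
    Chebyshev bounds the failure of the first condition and Markov that of
    the second. *)
Theorem weak_signal_bound m k (B : R) : (0 < m)%N -> (0 < k)%N -> 0 < B -> 0 < r ->
  fine (iid_law P k (weak_signal m P mu B)) <=
  4 * lambda / (k%:R * r) + 8 * B ^+ 2 * lambda / (m%:R * r) +
  8 * B ^+ 2 * lambda ^+ 2 * d%:R / (k%:R * m%:R * r ^+ 2).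
Proof.
move=> m0 k0 B0 r0.
have m0' : 0 < m%:R :> R by rewrite ltr0n.
have k0' : 0 < k%:R :> R by rewrite ltr0n.
pose Z := clin (rv mu) mu.
have r2 : 0 < (r / 2) ^+ 2 by rewrite exprn_gt0// divr_gt0.
have i1 : rintegrable P Z by exact: rintegrable_clin.
have i2 : rintegrable P (fun t => Z t ^+ 2) by exact: rintegrable_clin2.
have c0 : \int[P]_t Z t = 0 by exact: clin_mean.
have c2 : \int[P]_t (Z t ^+ 2) <= lambda * r := qle (rv mu).
have [mA1 PA1] := smean_chebyshev k0 i1 i2 c0 c2 r2.
have mq := measurable_qform_vbar (k := k) HP.
have mqc : measurable_fun setT
    (fun y : k.-tuple (d.-tuple R) => qform P mu (vbar y - rv mu)).
  under eq_fun do rewrite qformE//.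
  apply: measurable_qf_comp => i; under eq_fun do rewrite !mxE.
  by apply: measurable_funB => //; apply: measurable_smean; exact: measurable_tnth.
have qint : (\int[iid_law P k]_y (qform P mu (vbar y))%:E <=
    (2 * lambda * r + 2 * (lambda ^+ 2 * d%:R / k%:R))%:E)%E.
  apply: (@le_trans _ _ (\int[iid_law P k]_y ((2 * lambda * r)%:E +
      2%:E * (qform P mu (vbar y - rv mu))%:E))%E).
    apply: ge0_le_integral => //.
    - by move=> y _; rewrite lee_fin qform_ge0.
    - exact/measurable_EFinP.
    - by apply: emeasurable_funD => //; apply: emeasurable_funM => //; exact/measurable_EFinP.
    - move=> y _; rewrite -EFinM -EFinD lee_fin.
      rewrite -{1}(subrK (rv mu) (vbar y)).
      apply: (le_trans (qformD_le mu X2 _ _)); rewrite addrC lerD2r -mulrA ler_pM2l//.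
  rewrite ge0_integralD//; last 3 first.
  - by move=> y _; rewrite lee_fin !mulr_ge0// ltW.
  - by move=> y _; rewrite mule_ge0// lee_fin qform_ge0.
  - by apply: emeasurable_funM => //; exact/measurable_EFinP.
  rewrite ge0_integralZl//; last 2 first.
  - exact/measurable_EFinP.
  - by move=> y _; rewrite lee_fin qform_ge0.
  rewrite integral_cst//= probability_setT mule1 [in leRHS]EFinD; apply: leeD2l.
  rewrite EFinM.
  by apply: lee_wpmul2l => //; exact: qform_vbar_centered_int.
pose t := m%:R * r ^+ 2 / (4 * B ^+ 2).
have t0 : 0 < t by rewrite divr_gt0 ?mulr_gt0 ?exprn_gt0.
have [mA2 PA2] := markov_fine mq (fun y => qform_ge0 P mu (vbar y)) qint t0.
have mA0 : measurable [set y : k.-tuple (d.-tuple R) | qform P mu (vbar y) <= 0].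
  exact: measurable_le_set.
have incl : weak_signal m P mu B `<=`
   [set y : k.-tuple (d.-tuple R) | qform P mu (vbar y) <= 0] `|`
   ([set y | (r / 2) ^+ 2 <= smean Z y ^+ 2] `|` [set y | t <= qform P mu (vbar y)]).
  move=> y [h|/= h]; first by left.
  have [|h1] := leP ((r / 2) ^+ 2) (smean Z y ^+ 2); first by right; left.
  have [|h2] := leP t (qform P mu (vbar y)); first by right; right.
  have [|q0] := leP (qform P mu (vbar y)) 0; first by left.
  exfalso; move: h; apply/negP; rewrite -ltNge.
  have st : Num.sqrt t = Num.sqrt m%:R * r / (2 * B).
    have -> : t = (Num.sqrt m%:R * r / (2 * B)) ^+ 2.
      rewrite !exprMn exprVn sqr_sqrtr ?ler0n// /t; field.
      by rewrite gt_eqF.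
    by rewrite sqrtr_sqr ger0_norm// divr_ge0 ?mulr_ge0 ?sqrtr_ge0 ?ltW.
  have Zm : `|smean Z y| < r / 2.
    rewrite ltNge; apply/negP => h; move: h1; rewrite ltNge => /negP; apply.
    rewrite -(ger0_norm (sqr_ge0 (smean Z y))) normrX lerXn2r ?nnegrE//; lra.
  have th : r / 2 < dotr (vbar y) mu.
    move: Zm; rewrite /Z smean_clin// smean_dotr dotr_rv_sqnorm ltr_norml.
    by move=> /andP[]; lra.
  apply: (@lt_trans _ _ (B * Num.sqrt t)).
    by rewrite ltr_pM2l// ltr_sqrt.
  rewrite st (_ : B * _ = Num.sqrt m%:R * (r / 2)); last first.
    by field; rewrite gt_eqF.
  by rewrite ltr_pM2l// sqrtr_gt0.
have mW := @measurable_weak_signal d m k P L mu B HP.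
apply: (le_trans (fine_probability_leU _ mW mA0 (measurableU _ _ mA1 mA2) incl)).
rewrite (vbar_degenerate_null HP k0) add0r.
have := fine_probability_leU (iid_law P k) (measurableU _ _ mA1 mA2) mA1 mA2 (@subset_refl _ _).
move=> /le_trans; apply.
have -> : 4 * lambda / (k%:R * r) + 8 * B ^+ 2 * lambda / (m%:R * r) +
  8 * B ^+ 2 * lambda ^+ 2 * d%:R / (k%:R * m%:R * r ^+ 2) =
  lambda * r / k%:R / (r / 2) ^+ 2 +
  (2 * lambda * r + 2 * (lambda ^+ 2 * d%:R / k%:R)) / t.
  by rewrite /t; field; rewrite !gt_eqF.
exact: lerD.
Qed.

End weak_signal_bound.
End conditional_tests.

(** * A bounded variable of nearly constant modulus *)

Section zeta.
Context {R : realType}.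
Variable L : R.
Hypothesis L1 : 1 < L.
Local Notation N := (normal_prob (0:R) 1).
Local Notation RM := (measurableTypeR R).

Definition median : R := zquantile (2^-1).

Definition sgn_median (w : RM) : R := 1 - 2 * \1_`]-oo, median] w.

Definition logistic (w : RM) : R := (1 + expR (- w))^-1.

Lemma logistic01 w : 0 <= logistic w <= 1.
Proof.
rewrite /logistic invr_ge0 addr_ge0 ?expR_ge0//=.
by rewrite invf_le1 ?ltr_pwDl ?expR_ge0// lerDl expR_ge0.
Qed.

Lemma logistic_inj : injective logistic.
Proof. by move=> x y /invr_inj/addrI/expR_inj/oppr_inj. Qed.

Lemma measurable_logistic : measurable_fun setT logistic.
Proof.
apply: (@nondecreasing_measurable R setT) => // x y xy.
rewrite /logistic lef_pV2 ?posrE ?ltr_pwDl ?expR_ge0//.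
by rewrite lerD2l ler_expR lerN2.
Qed.

Lemma measurable_sgn_median : measurable_fun setT sgn_median.
Proof. by apply: measurable_funB => //; apply: measurable_funM. Qed.

Lemma integral_sgn_median : \int[N]_w sgn_median w = 0.
Proof.
have mI : measurable (`]-oo, median]%classic : set RM) by exact: measurable_itv.
have I : rintegrable N (fun w : RM => \1_`]-oo, median] w : R).
  exact: integrable_indic.
rewrite /sgn_median RintegralB//; last 2 first.
- exact: rintegrable_cst.
- exact: rintegrableZ.
rewrite Rintegral_prob_cst RintegralZl// Rintegral_indic//.
have := @Phi_zquantile R (2^-1); rewrite /Phi -/median => ->.
  by rewrite divff ?subrr.
by rewrite invr_gt0 ltr0n/= invf_lt1// ltr1n.
Qed.

(** Chosen so that (1 + delta) / (1 - delta) = L. *)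
Definition zeta_slope : R := (L - 1) / (L + 1).
Definition logistic_mean : R := \int[N]_w logistic w.
Local Notation delta := zeta_slope.
Local Notation Eh := logistic_mean.

(** The aim is a variable whose ratio of third to second moments is below any
    given L > 1.  A random sign has ratio 1 but atoms; adding delta times a
    bounded, centred injective function of the underlying Gaussian removes the
    atoms and keeps the modulus between 1 - delta and 1 + delta. *)
Definition zeta (w : RM) : R := sgn_median w + delta * (logistic w - Eh).

Lemma L_gt0 : 0 < L. Proof. exact: lt_trans ltr01 L1. Qed.
Lemma Lp1_gt0 : 0 < L + 1. Proof. by rewrite addr_gt0// L_gt0. Qed.

Lemma zeta_slope_gt0 : 0 < delta.
Proof. by rewrite /zeta_slope divr_gt0 ?subr_gt0 ?Lp1_gt0. Qed.

Lemma zeta_slope_lt1 : delta < 1.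
Proof. by rewrite /zeta_slope ltr_pdivrMr ?Lp1_gt0// mul1r ltrD2l; lra. Qed.

Lemma logistic_mean01 : 0 <= Eh <= 1.
Proof. by apply: Rintegral01; [exact: measurable_logistic|exact: logistic01]. Qed.

Lemma sgn_median_cases w : sgn_median w = 1 \/ sgn_median w = -1.
Proof.
rewrite /sgn_median indicE; case: (_ \in _); [right|left].
  by rewrite mulr1 (_ : 2 = 1 + 1 :> R)// opprD addrA subrr add0r.
by rewrite mulr0 subr0.
Qed.

Lemma zeta_bounds w : 1 - delta <= `|zeta w| <= 1 + delta.
Proof.
have d0 := zeta_slope_gt0; have d2 := zeta_slope_lt1; have := logistic01 w; have := logistic_mean01; rewrite /zeta; set h := logistic w.
move=> /andP[e0 e1] /andP[h0 h1].
have d1 : - delta <= delta * (h - Eh) <= delta by apply/andP; split; nra.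
case: (sgn_median_cases w) => ->; move: d1 => /andP[? ?].
  by rewrite ger0_norm; [apply/andP; split|]; lra.
by rewrite ler0_norm; [apply/andP; split|]; lra.
Qed.

Lemma measurable_zeta : measurable_fun setT zeta.
Proof.
apply: measurable_funD; first exact: measurable_sgn_median.
by apply: measurable_funM => //; apply: measurable_funB => //; exact: measurable_logistic.
Qed.

Lemma zeta_le2 w : `|zeta w| <= 2.
Proof. by have := zeta_slope_lt1; have /andP[_] := zeta_bounds w; lra. Qed.

Lemma rintegrable_zeta : rintegrable N zeta.
Proof. exact: (rintegrable_bounded _ measurable_zeta zeta_le2). Qed.

Lemma zeta_mean : \int[N]_w zeta w = 0.
Proof.
have Is : rintegrable N sgn_median.
  apply: (@rintegrable_bounded _ _ _ _ 1); first exact: measurable_sgn_median.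
  by move=> w; case: (sgn_median_cases w) => ->; rewrite ?normrN normr1.
have Ih : rintegrable N logistic.
  by apply: rintegrable01; [exact: measurable_logistic|exact: logistic01].
have Ic : rintegrable N (fun=> Eh) by exact: rintegrable_cst.
have Id : rintegrable N (fun w => logistic w - Eh) by exact: rintegrableB.
have Iz := rintegrableZ delta Id.
rewrite RintegralD// integral_sgn_median RintegralZl// RintegralB//.
by rewrite Rintegral_prob_cst subrr mulr0 addr0.
Qed.

Definition zeta_var : R := \int[N]_w (zeta w ^+ 2).

Lemma rintegrable_zeta2 : rintegrable N (fun w => zeta w ^+ 2).
Proof.
apply: (@rintegrable_bounded _ _ _ _ 4).
  by apply: measurable_funX; exact: measurable_zeta.
move=> w; rewrite normrX; have := zeta_le2 w; have := normr_ge0 (zeta w); nra.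
Qed.

Lemma rintegrable_zeta3 : rintegrable N (fun w => `|zeta w| ^+ 3).
Proof.
apply: (@rintegrable_bounded _ _ _ _ 8).
  by apply: measurable_funX; apply: (measurableT_comp (@normr_measurable _ setT)); exact: measurable_zeta.
move=> w; rewrite normrX normr_id (_ : 8 = 2 ^+ 3); last by ring.
by rewrite lerXn2r ?nnegrE//; exact: zeta_le2.
Qed.

Lemma zeta_var_ge : (1 - delta) ^+ 2 <= zeta_var.
Proof.
rewrite -[leLHS](Rintegral_prob_cst N); apply: le_Rintegral => //.
- exact: rintegrable_cst.
- exact: rintegrable_zeta2.
- move=> w _; have /andP[h _] := zeta_bounds w.
  rewrite -(ger0_norm (sqr_ge0 (zeta w))) normrX.
  by rewrite lerXn2r ?nnegrE ?normr_ge0// subr_ge0 ltW// zeta_slope_lt1.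
Qed.

Lemma zeta_var_gt0 : 0 < zeta_var.
Proof. by apply: lt_le_trans zeta_var_ge; rewrite exprn_gt0// subr_gt0 zeta_slope_lt1. Qed.

(** |zeta|^3 <= (1 + delta) zeta^2, and the standard deviation of zeta is at
    least 1 - delta = (1 + delta) / L. *)
Lemma zeta_third_moment :
  \int[N]_w (`|zeta w| ^+ 3) <= L * Num.sqrt zeta_var ^+ 3.
Proof.
apply: (@le_trans _ _ ((1 + delta) * zeta_var)).
  rewrite /zeta_var -RintegralZl//; last exact: rintegrable_zeta2.
  apply: le_Rintegral => //.
  - exact: rintegrable_zeta3.
  - by apply: rintegrableZ; exact: rintegrable_zeta2.
  - move=> w _; have /andP[_ h] := zeta_bounds w.
    rewrite -(ger0_norm (sqr_ge0 (zeta w))) normrX exprS.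
    by apply: ler_wpM2r => //; exact: sqr_ge0.
have v0 := zeta_var_gt0.
rewrite exprS (sqr_sqrtr (ltW v0)) mulrA ler_pM2r//.
have h1 : 1 - delta <= Num.sqrt zeta_var.
  rewrite -[leLHS](@ger0_norm _ (1 - delta)) ?subr_ge0 ?(ltW zeta_slope_lt1)//.
  by rewrite -sqrtr_sqr; apply: ler_wsqrtr; exact: zeta_var_ge.
apply: (@le_trans _ _ (L * (1 - delta))); last by rewrite ler_wpM2l// ltW// L_gt0.
by rewrite le_eqVlt; apply/orP; left; apply/eqP; rewrite /zeta_slope; field; rewrite gt_eqF// Lp1_gt0.
Qed.

Lemma subsingleton_null (B : set RM) : (forall u v, B u -> B v -> u = v) ->
  measurable B /\ N B = 0%E.
Proof.
move=> h; have [[w Bw]|no] := pselect (exists w, B w); last first.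
  have -> : B = set0 by apply/seteqP; split => // x Bx; apply: no; exists x.
  by split => //; exact: measure0.
have -> : B = [set w] by apply/seteqP; split => [x Bx|x ->//]; exact: h.
split; first exact: measurable_set1.
have /null_content_dominatesP := normal_prob_dominates (0:R) 1; apply.
  exact: measurable_set1.
exact: lebesgue_measure_set1.
Qed.

(** Where the sign is constant zeta is injective, so a level set has at most
    two points. *)
Lemma zeta_level_null t : measurable [set w | zeta w = t] /\ N [set w | zeta w = t] = 0%E.
Proof.
set A := [set w | _].
have inj (e : R) : forall u v, (A `&` [set w | sgn_median w = e]) u ->
    (A `&` [set w | sgn_median w = e]) v -> u = v.
  move=> u v [/= Au su] [/= Av sv]; apply: logistic_inj.
  have : zeta u = zeta v by rewrite Au Av.
  rewrite /zeta su sv => /addrI/(mulfI (lt0r_neq0 zeta_slope_gt0)).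
  by move=> /addIr.
have [m1 n1] := subsingleton_null (inj 1).
have [m2 n2] := subsingleton_null (inj (-1)).
have -> : A = (A `&` [set w | sgn_median w = 1]) `|` (A `&` [set w | sgn_median w = -1]).
  apply/seteqP; split => [w Aw|w [[]|[]]//].
  by case: (sgn_median_cases w) => h; [left|right].
split; first exact: measurableU.
apply/eqP; rewrite eq_le measure_ge0 andbT.
by apply: (le_trans (measureU2 _ m1 m2)); rewrite [X in (X + _)%E]n1 [X in (_ + X)%E]n2 adde0.
Qed.

End zeta.

(** * The classes are nonempty *)

Section axis_law.
Context {R : realType} {d : nat}.
Variables (L : R) (i0 : 'I_d) (a c : R).
Local Notation N := (normal_prob (0:R) 1).
Local Notation RM := (measurableTypeR R).

Definition axis_point (x : R) : d.-tuple R := [tuple if i == i0 then x else 0 | i < d].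

Definition axis_map (w : RM) : d.-tuple R := axis_point (a + c * zeta L w).

Lemma measurable_axis_map : measurable_fun setT axis_map.
Proof.
apply/measurable_fun_tnthP => i.
rewrite (_ : _ \o _ = fun w => if i == i0 then a + c * zeta L w else 0).
  case: (i == i0) => //; apply: measurable_funD => //; apply: measurable_funM => //.
  exact: measurable_zeta.
by apply/funext => w; rewrite /= tnth_mktuple.
Qed.

HB.instance Definition _ := isMeasurableFun.Build _ _ _ _ axis_map measurable_axis_map.

(** The law of (0, .., a + c zeta, .., 0).  It has no atoms and its covariance
    has rank one, so that a moment bound in one direction suffices. *)
Definition axis_law : probability (d.-tuple R) R := distribution N axis_map.

Hypothesis L1 : 1 < L.
Hypothesis c0 : 0 < c.

Lemma axis_law_atomless x : axis_law [set x] = 0%E.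
Proof.
have [mA NA] := zeta_level_null L1 ((tnth x i0 - a) / c).
apply/eqP; rewrite eq_le measure_ge0 andbT -NA /axis_law /= /distribution /pushforward.
apply: le_measure; rewrite ?inE//.
- rewrite -[X in measurable X]setTI; apply: measurable_axis_map => //.
  rewrite (_ : [set x] = \bigcap_(i in [set: 'I_d]) (@tnth _ R ^~ i) @^-1` [set tnth x i]).
    apply: fin_bigcap_measurable => // i _; rewrite -[X in measurable X]setTI.
    by apply: measurable_tnth => //; exact: measurable_set1.
  apply/seteqP; split => [y -> //|y h].
  by apply: eq_from_tnth => i; exact: h.
- move=> w /= <-; rewrite tnth_mktuple eqxx.
  by rewrite addrC addKr mulrAC divff ?mul1r ?gt_eqF.
Qed.

Lemma clin_axis_map (w : 'rV[R]_d) (t : RM) :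
  clin w (axis_point a) (axis_map t) = w 0 i0 * c * zeta L t.
Proof.
rewrite /clin (bigD1 i0)//= !tnth_mktuple eqxx big1 ?addr0.
  by rewrite addrC addKr mulrA.
by move=> i /negPf ii0; rewrite !tnth_mktuple ii0 subrr mulr0.
Qed.

Lemma ge0_integral_axis_law (f : d.-tuple R -> \bar R) :
  measurable_fun setT f -> (forall x, (0 <= f x)%E) ->
  (\int[axis_law]_x f x = \int[N]_w f (axis_map w))%E.
Proof. by move=> mf f0; rewrite ge0_integral_distribution. Qed.

Lemma axis_map_bounded i w : `|tnth (axis_map w) i| <= `|a| + c * 2.
Proof.
rewrite tnth_mktuple; case: ifP => _; last first.
  by rewrite normr0 addr_ge0// mulr_ge0// ltW.
apply: (le_trans (ler_normD _ _)); rewrite lerD2l normrM (gtr0_norm c0) ler_pM2l//.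
exact: (zeta_le2 L1).
Qed.

Lemma measurable_axis_coordinate i : measurable_fun setT (fun w => tnth (axis_map w) i).
Proof. exact: (measurableT_comp (measurable_tnth i) measurable_axis_map). Qed.

Lemma axis_law_L2 i : (@coordinate R d i) \in Lfun axis_law 2%:E.
Proof.
have mi : measurable_fun setT (@coordinate R d i) by exact: measurable_tnth.
rewrite inE; apply/andP; split; first by rewrite inE.
rewrite inE /= /finite_norm unlock; apply: poweR_lty.
rewrite ge0_integral_axis_law//; last 2 first.
- have : measurable_fun setT (fun x => (`|coordinate i x| `^ 2)%:E : \bar R).
    apply/measurable_EFinP; apply: (measurableT_comp (measurable_powR _)).
    exact: (measurableT_comp (@normr_measurable _ setT) mi).
  by move=> h; exact: h.
- by move=> x; exact: poweR_ge0.
apply: (@le_lt_trans _ _ (\int[N]_w ((`|a| + c * 2) ^+ 2)%:E)%E); last first.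
  by rewrite integral_cst//= probability_setT mule1 ltry.
apply: ge0_le_integral => //.
- by move=> w _; exact: poweR_ge0.
- have : measurable_fun setT (fun w => (`|tnth (axis_map w) i| `^ 2)%:E : \bar R).
    apply/measurable_EFinP; apply: (measurableT_comp (measurable_powR _)).
    exact: (measurableT_comp (@normr_measurable _ setT) (measurable_axis_coordinate i)).
  by move=> h; exact: h.
- move=> w _ /=; rewrite lee_fin powR_mulrn// lerXn2r ?nnegrE//.
    by rewrite addr_ge0// mulr_ge0// ltW.
  exact: axis_map_bounded.
Qed.

Lemma axis_law_mean i : 'E_axis_law[coordinate i]%E = (tnth (axis_point a) i)%:E.
Proof.
have mi : measurable_fun setT (@coordinate R d i) by exact: measurable_tnth.
have I : rintegrable N (fun w => tnth (axis_map w) i).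
  exact: (rintegrable_bounded _ (measurable_axis_coordinate i) (axis_map_bounded i)).
rewrite unlock integral_distribution//; last exact/measurable_EFinP.
rewrite -(fineK_rintegrable I); congr EFin.
rewrite tnth_mktuple; under eq_Rintegral do rewrite tnth_mktuple.
case: ifP => _; last by rewrite Rintegral_prob_cst.
rewrite RintegralD//; last 2 first.
- exact: rintegrable_cst.
- by apply: rintegrableZ; exact: (rintegrable_zeta L1).
rewrite Rintegral_prob_cst RintegralZl//; last exact: (rintegrable_zeta L1).
by rewrite zeta_mean// mulr0 addr0.
Qed.

(** Off the coordinate hyperplane the ratio is that of zeta; on it both norms
    vanish and the ratio is 0. *)
Lemma axis_law_moment_ratio u :
  (moment_ratio axis_law (axis_point a) u <= (L `^ 3^-1)%:E)%E.
Proof.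
rewrite /moment_ratio.
have -> : (fun x => (dot u (vsub x (axis_point a)))%:E) =
    (fun x => (clin (rv u) (axis_point a) x)%:E).
  by apply/funext => x; rewrite dot_vsub.
set b := rv u 0 i0 * c.
have mc : measurable_fun setT (clin (rv u) (axis_point a)) by exact: measurable_clin.
have mp (p : R) : measurable_fun setT
    (fun x => (`|clin (rv u) (axis_point a) x| `^ p)%:E : \bar R).
  apply/measurable_EFinP; apply: (measurableT_comp (measurable_powR _)).
  exact: (measurableT_comp (@normr_measurable _ setT) mc).
have N3 : (Lnorm axis_law 3%:E (fun x => (clin (rv u) (axis_point a) x)%:E) =
    ((`|b| ^+ 3 * \int[N]_w (`|zeta L w| ^+ 3)) `^ 3^-1)%:E)%E.
  rewrite unlock ge0_integral_axis_law; [|exact: (mp 3)|by move=> x; exact: poweR_ge0].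
  rewrite -RintegralZl//; last exact: (rintegrable_zeta3 L1).
  rewrite -poweR_EFin fineK_rintegrable; last first.
    by apply: rintegrableZ; exact: (rintegrable_zeta3 L1).
  congr (_ `^ _)%E; apply: eq_integral => w _ /=; rewrite clin_axis_map.
  by rewrite powR_mulrn// normrM exprMn.
have N2 : (Lnorm axis_law 2%:E (fun x => (clin (rv u) (axis_point a) x)%:E) =
    (`|b| * Num.sqrt (zeta_var L))%:E)%E.
  rewrite unlock ge0_integral_axis_law; [|exact: (mp 2)|by move=> x; exact: poweR_ge0].
  have -> : `|b| * Num.sqrt (zeta_var L) = (b ^+ 2 * zeta_var L) `^ 2^-1.
    have v0 := zeta_var_gt0 L1.
    rewrite powR12_sqrt; last by apply: mulr_ge0; [exact: sqr_ge0|exact: ltW].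
    by rewrite sqrtrM ?sqr_ge0// sqrtr_sqr.
  rewrite /zeta_var -RintegralZl//; last exact: (rintegrable_zeta2 L1).
  rewrite -poweR_EFin fineK_rintegrable; last first.
    by apply: rintegrableZ; exact: (rintegrable_zeta2 L1).
  congr (_ `^ _)%E; apply: eq_integral => w _ /=; rewrite clin_axis_map.
  by rewrite powR_mulrn// -normrX ger0_norm ?sqr_ge0// exprMn.
rewrite N3 N2.
have v0 : 0 < Num.sqrt (zeta_var L) by rewrite sqrtr_gt0 zeta_var_gt0.
have L0 : 0 <= L by apply: ltW; exact: lt_trans ltr01 L1.
have [b0|b0] := eqVneq b 0.
  rewrite b0 normr0 expr0n/= mul0r powR0 ?invr_neq0// mul0e lee_fin.
  exact: powR_ge0.
have nb0 : 0 < `|b| by rewrite normr_gt0.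
have D0 : 0 < `|b| * Num.sqrt (zeta_var L) by rewrite mulr_gt0.
rewrite inver gt_eqF// lee_pdivrMr// -EFinM lee_fin.
apply: (@le_trans _ _ ((L * (`|b| * Num.sqrt (zeta_var L)) ^+ 3) `^ 3^-1)).
  apply: ge0_ler_powR.
  - by rewrite invr_ge0.
  - rewrite nnegrE; apply: mulr_ge0; first by rewrite exprn_ge0.
    by apply: Rintegral_ge0 => w _; rewrite exprn_ge0.
  - by rewrite nnegrE; apply: mulr_ge0 => //; apply: exprn_ge0; exact: ltW.
  - rewrite exprMn mulrCA ler_pM2l ?exprn_gt0//.
    exact: (zeta_third_moment L1).
rewrite powRM ?exprn_ge0 ?(ltW D0)//.
by rewrite -[(_ * _) ^+ 3]powR_mulrn ?(ltW D0)// -powRrM mulfV// powRr1// ltW.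
Qed.

Lemma axis_law_Pclass : Pclass L (axis_point a) axis_law.
Proof.
split.
- exact: axis_law_atomless.
- exact: axis_law_L2.
- exact: axis_law_mean.
- by apply: ge_ereal_sup => _ [u _ <-]; exact: axis_law_moment_ratio.
Qed.

Lemma axis_law_lambda_max :
  lambda_max (covariance_mx axis_law) <= c ^+ 2 * zeta_var L.
Proof.
have v0 := zeta_var_gt0 L1.
have HP := axis_law_Pclass.
have sE : covariance_mx axis_law = scatter axis_law (axis_point a).
  by apply: covariance_mxE => i; case: HP.
have qE w : qf (covariance_mx axis_law) w = w 0 i0 ^+ 2 * (c ^+ 2 * zeta_var L).
  rewrite sE /qf -qformE; last by case: HP.
  rewrite /qform /Rintegral ge0_integral_axis_law; last 2 first.
  - apply/measurable_EFinP; apply: measurable_funX; exact: measurable_clin.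
  - by move=> x; rewrite lee_fin sqr_ge0.
  rewrite mulrA /zeta_var -exprMn -RintegralZl//; last exact: (rintegrable_zeta2 L1).
  rewrite /Rintegral; congr fine; apply: eq_integral => t _; rewrite clin_axis_map.
  by rewrite -exprMn.
have cv0 : 0 <= c ^+ 2 * zeta_var L by rewrite mulr_ge0 ?sqr_ge0 ?ltW.
have ub b : eigenvalue (covariance_mx axis_law) b -> b <= c ^+ 2 * zeta_var L.
  move=> /eigenvalueP[v vb vn0].
  have n0 : 0 < sqnorm v.
    rewrite lt_neqAle sqnorm_ge0 andbT eq_sym; apply: contra_neq vn0.
    exact: sqnorm_eq0.
  have := qE v; rewrite /qf vb -scalemxAl mxE -sqnormE => h.
  rewrite -(ler_pM2r n0) h mulrC ler_wpM2l//.
  by rewrite /sqnorm (bigD1 i0)//= lerDl sumr_ge0// => i _; exact: sqr_ge0.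
have [[b hb]|no] := pselect (exists b, eigenvalue (covariance_mx axis_law) b).
  by apply: ge_sup; [exists b|move=> b' /=; exact: ub].
rewrite /lambda_max (_ : [set _ | _] = set0) ?sup0//.
by apply/seteqP; split => // b hb; apply: no; exists b.
Qed.

Lemma norm2_axis_point x : norm2 (axis_point x) = `|x|.
Proof.
rewrite /norm2 /dot (bigD1 i0)//= !tnth_mktuple eqxx big1 ?addr0.
  by rewrite -expr2 sqrtr_sqr.
by move=> i /negPf h; rewrite !tnth_mktuple h mulr0.
Qed.

End axis_law.

Lemma Pclass0_nonempty {R : realType} (d : nat) (L : R) : (0 < d)%N -> 1 < L ->
  exists P : probability (d.-tuple R) R, Pclass L (@vec0 R d) P.
Proof.
move=> d0 L1; exists (axis_law L (Ordinal d0) 0 1).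
have -> : @vec0 R d = axis_point (Ordinal d0) 0.
  by apply: eq_from_tnth => i; rewrite !tnth_mktuple; case: ifP.
exact: axis_law_Pclass.
Qed.

(** Mean |e| on one axis and variance lstar / 2 along it. *)
Lemma Qclass_nonempty {R : realType} (d : nat) (L lstar e : R) : (0 < d)%N -> 1 < L ->
  0 < lstar -> exists P : probability (d.-tuple R) R, Qclass L lstar e P.
Proof.
move=> d0 L1 l0; have v0 := zeta_var_gt0 L1.
pose c := Num.sqrt (lstar / (2 * zeta_var L)).
have c20 : 0 < lstar / (2 * zeta_var L) by rewrite divr_gt0// mulr_gt0.
have c0 : 0 < c by rewrite sqrtr_gt0.
exists (axis_law L (Ordinal d0) `|e| c), (axis_point (Ordinal d0) `|e|); split.
- exact: axis_law_Pclass.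
- by rewrite norm2_axis_point normr_id ler_norm.
- apply: (le_lt_trans (axis_law_lambda_max _ _ L1 c0)).
  rewrite /c sqr_sqrtr ?(ltW c20)//.
  rewrite (_ : _ * _ = lstar / 2); first by lra.
  by field; rewrite gt_eqF.
Qed.

(** * Limits along the sequence of sample sizes *)

Section limit_criteria.
Context {R : realType}.
Implicit Types u : nat -> \bar R.

Lemma cvg_ereal_eps u (l : R) :
  (forall e, 0 < e -> exists N, forall n, (N <= n)%N ->
    ((l - e)%:E <= u n <= (l + e)%:E)%E) ->
  u @ \oo --> l%:E.
Proof.
move=> h; apply/fine_cvgP; split.
  have [N hN] := h 1 ltr01; exists N => // n /= Nn.
  have /andP[h1 h2] := hN n Nn.
  by rewrite fin_numE; move: h1 h2; case: (u n).
apply/cvgrPdist_le => e e0; have [N hN] := h e e0; exists N => // n /= Nn.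
have /andP[] := hN n Nn; case: (u n) => //= r; rewrite !lee_fin => h1 h2.
rewrite ler_norml; apply/andP; split; lra.
Qed.

Lemma limn_esup_le_eventually u c N :
  (forall n, (N <= n)%N -> (u n <= c)%E) -> (limn_esup u <= c)%E.
Proof.
move=> h; rewrite /limn_esup limf_esupE.
apply: (@le_trans _ _ (ereal_sup (u @` [set n | (N <= n)%N]))).
  by apply: ereal_inf_lbound; exists [set n | (N <= n)%N] => //; exists N.
by apply: ge_ereal_sup => _ [n /= Nn <-]; exact: h.
Qed.

Lemma ereal_sup_between T (A : set T) (F : T -> \bar R) (a b : \bar R) :
  A !=set0 -> (forall t, A t -> (a <= F t <= b)%E) ->
  (a <= ereal_sup [set F t | t in A] <= b)%E.
Proof.
move=> [t0 At0] h; apply/andP; split.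
  have /andP[h1 _] := h _ At0; apply: (le_trans h1).
  by apply: ereal_sup_ubound; exists t0.
by apply: ge_ereal_sup => _ [t At <-]; have /andP[] := h _ At.
Qed.

End limit_criteria.

Section rejection_probability.
Context {R : realType} {d n m : nat} (alpha : R) (P : probability (d.-tuple R) R).

Let mT : measurable_fun setT (@T_mean R d n m) := @measurable_T_mean R d n m.

Lemma expectation_phi_mean :
  'E_(iid_law P n)[phi_mean m alpha]%E =
  (fine (iid_law P n [set X | zquantile (1 - alpha) < T_mean m X]))%:E.
Proof.
have mA := measurable_gt_set (zquantile (1 - alpha)) mT.
by rewrite expectation_indic// fineK// fin_num_measure.
Qed.

Lemma expectation_phi_meanC :
  'E_(iid_law P n)[(fun X => 1 - phi_mean m alpha X)%R]%E =
  (fine (iid_law P n [set X | T_mean m X <= zquantile (1 - alpha)]))%:E.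
Proof.
have mA := measurable_le_set (zquantile (1 - alpha)) mT.
rewrite -[RHS]/(_%:E) fineK ?fin_num_measure// -expectation_indic//.
congr ('E_(_)[_])%E; apply/funext => X.
rewrite /phi_mean !indicE.
have [h|h] := ltP (zquantile (1 - alpha)) (T_mean m X).
  by rewrite mem_set// memNset ?subrr//= leNgt h.
by rewrite memNset ?mem_set ?subr0//= ltNge h.
Qed.

End rejection_probability.

(** D stands for sqrt d, so that the hypothesis on r is the separation rate
    |mu|^2 >= K^2 sqrt d / n; D >= 1 absorbs the dimension-free terms. *)
Lemma weak_signal_rate {R : realType} (lambda B K D n k m r kl kh : R) :
  0 < lambda -> 0 < B -> 1 <= K -> 1 <= D -> 0 < n -> 0 < kl -> 0 < kh ->
  kl * n <= m -> kh * n <= k -> K ^+ 2 * D / n <= r ->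
  4 * lambda / (k * r) + 8 * B ^+ 2 * lambda / (m * r) +
  8 * B ^+ 2 * lambda ^+ 2 * D ^+ 2 / (k * m * r ^+ 2) <=
  (4 * lambda / kh + 8 * B ^+ 2 * lambda / kl + 8 * B ^+ 2 * lambda ^+ 2 / (kh * kl)) / K ^+ 2.
Proof.
move=> l0 B0 K1 D1 n0 kl0 kh0 hm hk hr.
have K0 : 0 < K by lra.
have D0 : 0 < D by lra.
have K2 : 1 <= K ^+ 2 by rewrite exprn_ege1.
have K20 : 0 < K ^+ 2 by lra.
have r0 : 0 < r by apply: lt_le_trans hr; rewrite divr_gt0// mulr_gt0.
have size_signal a b : 0 < a -> a * n <= b -> a * (K ^+ 2 * D) <= b * r.
  move=> a0 ab; apply: (@le_trans _ _ (a * n * (K ^+ 2 * D / n))).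
    by rewrite le_eqVlt; apply/orP; left; apply/eqP; field; rewrite gt_eqF.
  by apply: ler_pM => //; [rewrite mulr_ge0 ?ltW|rewrite ltW// divr_gt0 ?mulr_gt0].
have hkr := size_signal _ _ kh0 hk.
have hmr := size_signal _ _ kl0 hm.
have KD0 : 0 < K ^+ 2 * D by rewrite mulr_gt0.
have a0 : 0 < kh * (K ^+ 2 * D) by rewrite mulr_gt0.
have b0 : 0 < kl * (K ^+ 2 * D) by rewrite mulr_gt0.
have KD : K ^+ 2 <= K ^+ 2 * D by rewrite ler_peMr// ltW.
have frac (c x y : R) : 0 <= c -> 0 < y -> y <= x -> c / x <= c / y.
  move=> c0 y0 yx; apply: ler_wpM2l => //.
  by rewrite lef_pV2// posrE; exact: lt_le_trans yx.
rewrite [leRHS]mulrDl [X in _ <= X + _]mulrDl; apply: lerD; first apply: lerD.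
- rewrite -[leRHS]mulrA -invfM; apply: frac; first by rewrite mulr_ge0 ?ltW.
    by rewrite mulr_gt0.
  by apply: le_trans hkr; rewrite ler_pM2l.
- rewrite -[leRHS]mulrA -invfM; apply: frac.
  + by rewrite !mulr_ge0 ?exprn_ge0 ?ltW.
  + by rewrite mulr_gt0.
  + by apply: le_trans hmr; rewrite ler_pM2l.
- have -> : k * m * r ^+ 2 = (k * r) * (m * r) by ring.
  have p0 : 0 < (kh * (K ^+ 2 * D)) * (kl * (K ^+ 2 * D)) by rewrite mulr_gt0.
  apply: (@le_trans _ _ (8 * B ^+ 2 * lambda ^+ 2 * D ^+ 2 /
      ((kh * (K ^+ 2 * D)) * (kl * (K ^+ 2 * D))))).
    apply: frac => //; first by rewrite !mulr_ge0 ?exprn_ge0 ?ltW.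
    by apply: ler_pM => //; exact: ltW.
  rewrite (_ : _ / _ = 8 * B ^+ 2 * lambda ^+ 2 / (kh * kl * K ^+ 2 * K ^+ 2)).
    rewrite -[leRHS]mulrA -invfM; apply: frac.
    + by rewrite !mulr_ge0 ?exprn_ge0 ?ltW.
    + by rewrite !mulr_gt0.
    + by rewrite ler_peMr// ltW// !mulr_gt0.
  by field; rewrite !gt_eqF.
Qed.

Section sequences.
Context {R : realType} (m1 : nat -> nat) (kappa_lo kappa_hi : R).
Hypothesis hm1 : forall n, (1 < n)%N -> (0 < m1 n < n)%N.
Hypothesis klo0 : 0 < kappa_lo.
Hypothesis khi1 : kappa_hi < 1.
Hypothesis hratio : forall n, (1 < n)%N ->
  kappa_lo <= (m1 n)%:R / n%:R <= kappa_hi.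

Lemma split_sizes N : exists N', forall n, (N' <= n)%N ->
  exists k, [/\ n = (m1 n + k)%N, (N <= m1 n)%N, (0 < m1 n)%N, (0 < k)%N &
    [/\ (1 < n)%N, kappa_lo * n%:R <= (m1 n)%:R & (1 - kappa_hi) * n%:R <= k%:R :> R]].
Proof.
have [N' hN'] := eventually_div_le (N%:R : R) klo0.
exists (maxn N' 2) => n; rewrite geq_max => /andP[/hN'[n0 hn] n1].
have n0' : 0 < n%:R :> R by rewrite ltr0n.
have /andP[m0 mn] := hm1 n1; have := hratio n1.
rewrite ler_pdivlMr// ler_pdivrMr// => /andP[h1 h2].
have nE : n = (m1 n + (n - m1 n))%N by rewrite subnKC// ltnW.
exists (n - m1 n)%N; split => //.
- move: hn; rewrite ler_pdivrMr// => hn.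
  by rewrite -(ler_nat R); apply: le_trans hn h1.
- by rewrite subn_gt0.
- by split => //; rewrite natrB ?(ltnW mn)//; lra.
Qed.

Lemma eventual_null_level (L z e : R) : 0 <= L -> 0 < e ->
  exists N, forall n, (N <= n)%N -> forall d (P : probability (d.-tuple R) R),
  Pclass L (@vec0 R d) P ->
  `|fine (iid_law P n [set X | z < T_mean (m1 n) X]) - (1 - Phi z)| <= e.
Proof.
move=> L0 e0; have [N hN] := uniform_null_level z L0 e0.
have [N' hN'] := split_sizes N; exists N' => n /hN'[k [nE Nm m0 k0 _]] d P HP.
move: (m1 n) nE Nm m0 => m nE Nm m0; move: {hN'} nE => ->.
exact: hN.
Qed.

Lemma Qclass_qform_le d (P : probability (d.-tuple R) R) L lstar mu w :
  (0 < d)%N -> Pclass L mu P -> lambda_max (covariance_mx P) < lstar ->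
  qform P mu w <= lstar * sqnorm w.
Proof.
move=> d0 [_ X2 Xmu _]; rewrite (covariance_mxE Xmu) => hl.
rewrite qformE//; apply: (le_trans (rayleigh_bound w d0 (scatter_sym P mu))).
by apply: ler_wpM2r; [exact: sqnorm_ge0|exact: ltW].
Qed.

(** K only has to pass 2 C / e for the fixed constant C of [weak_signal_rate],
    K^2 >= K being enough. *)
Lemma eventual_power (L lstar z e : R) (d : nat -> nat) (K eps : nat -> R) :
  0 <= L -> 0 < lstar -> (forall n, (0 < d n)%N) -> K @ \oo --> +oo ->
  (forall n, (1 < n)%N ->
     K n * (d n)%:R `^ 4^-1 * n%:R `^ (- 2^-1) <= eps n) ->
  0 < e ->
  exists N, forall n, (N <= n)%N -> forall P : probability ((d n).-tuple R) R,
  Qclass L lstar (eps n) P ->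
  fine (iid_law P n [set X | T_mean (m1 n) X <= z]) <= e.
Proof.
move=> L0 l0 hd Koo heps e0; have e2 : 0 < e / 2 by lra.
have scale (c x : R) : 2 * c / e <= x -> c <= e / 2 * x.
  by rewrite ler_pdivrMr//; lra.
have [N [B [B0 hB]]] := uniform_power z L0 e2.
have [N1 hN1] := split_sizes N.
have kh0 : 0 < 1 - kappa_hi by rewrite subr_gt0.
pose C := 4 * lstar / (1 - kappa_hi) + 8 * B ^+ 2 * lstar / kappa_lo +
  8 * B ^+ 2 * lstar ^+ 2 / ((1 - kappa_hi) * kappa_lo).
have [N2 _ hN2] := (cvgryPge _).1 Koo (Num.max 1 (2 * C / e)).
exists (maxn N1 N2) => n; rewrite geq_max => /andP[/hN1 hn /hN2 /=].
rewrite ge_max => /andP[K1 KC] P [mu [HP hmu hl]].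
have [k [nE Nm m0 k0 [n1 hm hk]]] := hn.
have n0 : 0 < n%:R :> R by rewrite ltr0n ltnW.
have d0 : 0 < (d n)%:R :> R by rewrite ltr0n.
have K0 : 0 < K n by lra.
pose D := (d n)%:R `^ 4^-1 ^+ 2 : R.
have D1 : 1 <= D by rewrite exprn_ege1// -[X in X <= _](powRr0 (d n)%:R) ler_powR// ?ler1n ?hd// invr_ge0.
have D2 : D ^+ 2 = (d n)%:R.
  by rewrite /D -exprM -powR_mulrn ?powR_ge0// -powRrM mulVf// powRr1// ltW.
have hr : K n ^+ 2 * D / n%:R <= sqnorm (rv mu).
  rewrite -norm2_sqr; have := le_trans (heps _ n1) hmu.
  set x := (X in X <= _) => hx.
  have x0 : 0 <= x by rewrite !mulr_ge0 ?powR_ge0 ?ltW.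
  suff <- : x ^+ 2 = K n ^+ 2 * D / n%:R by rewrite lerXn2r ?nnegrE//; exact: le_trans hx.
  rewrite /x !exprMn; congr (_ * _).
  by rewrite -powR_mulrn ?powR_ge0// -powRrM mulNr mulVf// powR_inv1// ltW.
have r0 : 0 < sqnorm (rv mu).
  apply: lt_le_trans hr; rewrite divr_gt0// mulr_gt0 ?exprn_gt0//.
  by rewrite powR_gt0.
have qle w : qform P mu w <= lstar * sqnorm w by exact: Qclass_qform_le (hd n) HP hl.
have rate := weak_signal_rate l0 B0 K1 D1 n0 klo0 kh0 hm hk hr.
have wb := weak_signal_bound HP qle (ltW l0) m0 k0 B0 r0.
have bad : fine (iid_law P k (weak_signal (m1 n) P mu B)) <= e / 2.
  apply: (le_trans wb); rewrite -D2; apply: (le_trans rate); rewrite -/C.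
  rewrite ler_pdivrMr ?exprn_gt0//.
  apply: (le_trans (scale _ _ KC)); rewrite ler_pM2l//.
  by rewrite expr2 ler_peMr// ltW.
(* the dimension d n depends on n, so only the sample size is rewritten *)
have transport n' : n' = n -> fine (iid_law P n' [set X | T_mean (m1 n) X <= z]) =
    fine (iid_law P n [set X | T_mean (m1 n) X <= z]) by move=> ->.
rewrite -(transport _ (esym nE)); apply: (le_trans (hB _ _ _ _ _ Nm m0 k0 HP)).
by rewrite [leRHS]splitr lerD2l.
Qed.

End sequences.

(** At a' = a + e / 2 the level statement holds up to e / 2, and p <= a means
    Phi T >= 1 - a > 1 - a' = Phi z, hence T > z.  When a + e >= 1 there is no
    such quantile, and the bound is trivial. *)
Lemma p_mean_null_level {R : realType} (m1 : nat -> nat) (kappa_lo kappa_hi L a e : R) :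
  (forall n, (1 < n)%N -> (0 < m1 n < n)%N) -> 0 < kappa_lo ->
  (forall n, (1 < n)%N -> kappa_lo <= (m1 n)%:R / n%:R <= kappa_hi) ->
  0 <= L -> 0 <= a -> 0 < e ->
  exists N, forall n, (N <= n)%N -> forall d (P : probability (d.-tuple R) R),
  Pclass L (@vec0 R d) P ->
  (iid_law P n [set X | (p_mean (m1 n) X <= a)%R] <= (a + e)%:E)%E.
Proof.
move=> hm1 klo0 hratio L0 a0 e0.
have [ae|ae] := leP 1 (a + e).
  exists 0%N => n _ d P _; apply: (@le_trans _ _ 1%E); last by rewrite lee_fin.
  apply: probability_le1.
  apply: measurable_le_set; apply: measurable_funB => //.
  exact: (measurableT_comp (@measurable_Phi R) (@measurable_T_mean R d n (m1 n))).
pose b := 1 - (a + e / 2).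
have b01 : 0 < b < 1 by rewrite /b; apply/andP; split; lra.
have e2 : 0 < e / 2 by lra.
have [N hN] := eventual_null_level hm1 klo0 hratio (zquantile b) L0 e2.
exists N => n /hN H d P /H.
have mT := @measurable_T_mean R d n (m1 n).
have mA := measurable_gt_set (zquantile b) mT.
have mB : measurable [set X : n.-tuple (d.-tuple R) | p_mean (m1 n) X <= a].
  apply: measurable_le_set; apply: measurable_funB => //.
  exact: (measurableT_comp (@measurable_Phi R)).
rewrite Phi_zquantile// ler_norml => /andP[_ h].
rewrite -(fineK (fin_num_measure _ _ mB)) lee_fin.
apply: (@le_trans _ _ (fine (iid_law P n [set X | zquantile b < T_mean (m1 n) X]))).
  apply: fine_probability_le => // X /=; rewrite /p_mean => hX.
  rewrite ltNge; apply/negP => /Phi_le; rewrite Phi_zquantile// /b; lra.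
move: h; rewrite /b; lra.
Qed.

Theorem theorem2p8 (R : realType) (alpha L lstar : R)
  (halpha : 0 < alpha < 1) (hL : 1 < L) (hlstar : 0 < lstar)
  (d : nat -> nat) (hd : forall n, (0 < d n)%N)
  (m1 : nat -> nat) (hm1 : forall n, (1 < n)%N -> (0 < m1 n < n)%N)
  (kappa_lo kappa_hi : R)
  (hkappa : 0 < kappa_lo /\ kappa_lo <= kappa_hi /\ kappa_hi < 1)
  (hratio : forall n, (1 < n)%N ->
     kappa_lo <= (m1 n)%:R / n%:R <= kappa_hi)
  (K : nat -> R) (hK0 : forall n, 0 < K n) (hKincr : nondecreasing_seq K)
  (hKoo : K @ \oo --> +oo)
  (eps : nat -> R)
  (heps : forall n, (1 < n)%N ->
     K n * (d n)%:R `^ 4^-1 * n%:R `^ (- 2^-1) <= eps n) :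
  [/\ (fun n => ereal_sup
         [set 'E_(iid_law P n)[phi_mean (m1 n) alpha]%E
            | P in Pclass L (@vec0 R (d n))]) @ \oo --> alpha%:E,
      (fun n => ereal_sup
         [set 'E_(iid_law P n)[(fun X => 1 - phi_mean (m1 n) alpha X)%R]%E
            | P in @Qclass R (d n) L lstar (eps n)]) @ \oo --> 0%E &
      forall a : R, 0 <= a <= 1 ->
        (limn_esup (fun n => ereal_sup
           [set iid_law P n [set X | (p_mean (m1 n) X <= a)%R]
              | P in Pclass L (@vec0 R (d n))]) <= a%:E)%E].
Proof.
have [klo0 [_ khi1]] := hkappa.
have L0 : 0 <= L by apply: ltW; exact: lt_trans hL.
have b01 : 0 < 1 - alpha < 1 by case/andP: halpha => *; apply/andP; split; lra.
split.
- apply: cvg_ereal_eps => e e0.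
  have [N hN] := eventual_null_level hm1 klo0 hratio (zquantile (1 - alpha)) L0 e0.
  exists N => n /hN H; apply: ereal_sup_between.
    by have [P HP] := Pclass0_nonempty (hd n) hL; exists P.
  move=> P /H; rewrite Phi_zquantile// expectation_phi_mean !lee_fin.
  by rewrite ler_norml => /andP[? ?]; apply/andP; split; lra.
- apply: cvg_ereal_eps => e e0.
  have [N hN] := eventual_power hm1 klo0 khi1 hratio (zquantile (1 - alpha))
    L0 hlstar hd hKoo heps e0.
  exists N => n /hN H; apply: ereal_sup_between.
    by have [P HP] := Qclass_nonempty (eps n) (hd n) hL hlstar; exists P.
  move=> P /H; rewrite expectation_phi_meanC !lee_fin !add0r => ->.
  by rewrite andbT (@le_trans _ _ 0) ?oppr_le0 ?(ltW e0)// fine_ge0.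
- move=> a /andP[a0 _]; apply/lee_addgt0Pr => e e0; rewrite -EFinD.
  have [N hN] := p_mean_null_level hm1 klo0 hratio L0 a0 e0.
  apply: (@limn_esup_le_eventually _ _ _ N) => n /hN H.
  by apply: ge_ereal_sup => _ [P /H h <-].
Qed.
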